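(* Suppose that the operator $\mathcal{L}_A$ in an open set $\Omega\subseteq\mathbb{R}^{N+1}$ satisfies the Cordes-Landis condition: the ellipticity bounds $\lambda\mathbb{I}_{p_0}\le\mathbb{A}(z)\le\Lambda\mathbb{I}_{p_0}$ hold for all $z\in\Omega$ with $\frac{\Lambda}{\lambda}<1+\frac{2}{Q}$. There exist structural constants $b_B,K,\sigma_0,C>0$ with $K>\sigma_0$ such that, for all $z_0\in\mathbb{R}^{N+1}$ and $r>0$ with $\mathcal{Q}_{Kr}^{-b_Br^2,0}(z_0)\Subset\Omega$ and all $u\in C^2(\Omega)$ satisfying $$u\ge0\quad\text{and}\quad\mathcal{L}_Au=0\quad\text{in }\mathcal{Q}_{Kr}^{-b_Br^2,0}(z_0),$$ we have $$\sup_{\mathcal{Q}_r^-}u\le C\inf_{\mathcal{Q}_r^+}u,$$ where $\mathcal{Q}_r^-:=\mathcal{Q}_{\frac{\sigma_0}{2}r}^{-\frac{3b_B}{4}r^2,-\frac{b_B}{2}r^2}(z_0)$ and $\mathcal{Q}_r^+:=\mathcal{Q}_{\frac{\sigma_0}{2}r}^{-\frac{b_B}{4}r^2,0}(z_0)$.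
   Context: Setting. $N,p_0,n\in\mathbb{N}$ with $1\le p_0<N$, $n\ge1$. Points of $\mathbb{R}^{N+1}$ are written $z=(x,t)\in\mathbb{R}^N\times\mathbb{R}$; $\nabla=\nabla_x$, $D^2=D^2_x$. $B\in\mathbb{R}^{N\times N}$ is the block matrix whose only nonzero blocks are $\mathbb{B}_1,\dots,\mathbb{B}_n$ placed just above the diagonal (for the partition $N=p_0+p_1+\dots+p_n$, $p_0\ge p_1\ge\dots\ge p_n\ge1$), where $\mathbb{B}_j$ is a $p_{j-1}\times p_j$ matrix of rank $p_j$. For an open set $\Omega\subseteq\mathbb{R}^{N+1}$, $$\mathcal{L}_A=\mathrm{trace}(A(z)D^2)+\langle x,B\nabla\rangle-\partial_t,\qquad A(z)=\begin{bmatrix}\mathbb{A}(z)&0\\0&0\end{bmatrix},\quad z\in\Omega,$$ where $\mathbb{A}(z)\in\mathbb{R}^{p_0\times p_0}$ is symmetric and $\lambda\mathbb{I}_{p_0}\le\mathbb{A}(z)\le\Lambda\mathbb{I}_{p_0}$ for all $z\in\Omega$, with constants $\lambda,\Lambda>0$. No regularity of $A$ in $z$ is assumed. Notation. $Q:=p_0+3p_1+\dots+(2n+1)p_n$. $E(\sigma):=\exp(-\sigma B^T)$. Group law: $(x,t)\circ(\xi,\tau)=(\xi+E(\tau)x,\,t+\tau)$. Writing $x=(x^{(p_0)},\dots,x^{(p_n)})\in\mathbb{R}^{p_0}\times\dots\times\mathbb{R}^{p_n}$, set $|x|_B=\sum_{i=0}^n|x^{(p_i)}|^{\frac1{2i+1}}$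 (Euclidean norms on the right). $B_r(0)=\{x\in\mathbb{R}^N:|x|_B<r\}$; $\mathcal{Q}_r^{t_1,t_2}=B_r(0)\times(t_1,t_2)$; $\mathcal{Q}_r^{t_1,t_2}(z_0)=z_0\circ\mathcal{Q}_r^{t_1,t_2}$. $F\Subset\Omega$ means that the closure of $F$ is compact and contained in $\Omega$. A structural constant is one depending solely on $B,Q,n,\lambda,\Lambda$. *)

(* Defs.v *)
From HB Require Import structures.
From mathcomp Require Import all_boot all_order all_algebra.
From mathcomp Require Import all_classical all_reals all_analysis.

Set Implicit Arguments.
Unset Strict Implicit.
Unset Printing Implicit Defensive.

Import Order.TTheory GRing.Theory Num.Theory.
Import numFieldNormedType.Exports.

Local Open Scope classical_set_scope.
Local Open Scope ring_scope.

(* The block sizes p_0, ..., p_n are [p : 'I_n.+1 -> nat]. *)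
Definition block_sizes (n : nat) (p : 'I_n.+1 -> nat) : Prop :=
  (forall i j : 'I_n.+1, (i <= j)%N -> (p j <= p i)%N) /\
  (forall i : 'I_n.+1, (0 < p i)%N).

Definition dimN (n : nat) (p : 'I_n.+1 -> nat) : nat := (\sum_(i < n.+1) p i)%N.

Definition homdim (n : nat) (p : 'I_n.+1 -> nat) : nat :=
  (\sum_(i < n.+1) (2 * i + 1) * p i)%N.

(* A point (x, t) of R^N x R; the x-part is a column vector. *)
Notation spacetime R p := ('cV[R]_(dimN p) * R)%type.

Section Geometry.
Variables (R : realType) (n : nat) (p : 'I_n.+1 -> nat).
Local Notation N := (dimN p).
Local Notation pt := (spacetime R p).

(* Block (i, i+1) is a p_i x p_(i+1) matrix of full rank p_(i+1). *)
Definition superdiag_blocks (B : 'M[R]_N) : Prop :=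
  forall i j : 'I_n.+1,
    if (j == i.+1 :> nat) then \rank (submxblock B i j) = p j
    else submxblock B i j = 0.

Definition loewner_le k (M1 M2 : 'M[R]_k) : Prop :=
  forall v : 'cV[R]_k, 0 <= (v^T *m (M2 - M1) *m v) 0 0.

(* A(z) is zero outside its upper left p_0 x p_0 block, which is symmetric and
   lies between lam I and Lam I. *)
Definition elliptic_on (Omega : set pt) (lam Lam : R) (A : pt -> 'M[R]_N)
    : Prop :=
  forall z, Omega z ->
    (forall i j : 'I_n.+1, ~~ ((i == ord0) && (j == ord0)) ->
       submxblock (A z) i j = 0) /\
    let A0 := submxblock (A z) ord0 ord0 in
    [/\ A0^T = A0, loewner_le lam%:M A0 & loewner_le A0 Lam%:M].

Definition mxexp k (M : 'M[R]_k) : 'M[R]_k :=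
  lim (series (fun j : nat => (j`!%:R)^-1 *: M ^+ j) @ \oo).

Definition Emx (B : 'M[R]_N) (s : R) : 'M[R]_N := mxexp (- s *: B^T).

Definition gop (B : 'M[R]_N) (z zeta : pt) : pt :=
  (zeta.1 + Emx B zeta.2 *m z.1, z.2 + zeta.2).

Definition enorm k (v : 'cV[R]_k) : R := Num.sqrt (\sum_i v i 0 ^+ 2).

Definition Bnorm (x : 'cV[R]_N) : R :=
  \sum_(i < n.+1) enorm (submxcol x i) `^ ((2 * i + 1)%N%:R)^-1.

Definition cyl0 (r t1 t2 : R) : set pt :=
  [set z | Bnorm z.1 < r /\ t1 < z.2 < t2].

Definition cyl (B : 'M[R]_N) (r t1 t2 : R) (z0 : pt) : set pt :=
  [set gop B z0 z | z in cyl0 r t1 t2].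

Definition rel_compact_in (F Omega : set pt) : Prop :=
  compact (closure F) /\ closure F `<=` Omega.

(* The coordinate directions of R^(N+1): [Some i] is x_i and [None] is t. *)
Definition dir (k : option 'I_N) : pt :=
  if k is Some i then (delta_mx i 0, 0) else (0, 1).

Definition C2_on (Omega : set pt) (u : pt -> R) : Prop :=
  forall z, Omega z ->
    {for z, continuous u} /\
    forall k, [/\ derivable u z (dir k),
      {for z, continuous (fun y => 'D_(dir k) u y)} &
      forall l, derivable (fun y => 'D_(dir k) u y) z (dir l) /\
        {for z, continuous (fun y => 'D_(dir l) (fun y' => 'D_(dir k) u y') y)}].

Definition grad_x (u : pt -> R) (z : pt) : 'cV[R]_N :=
  \col_i 'D_(dir (Some i)) u z.

Definition hess_x (u : pt -> R) (z : pt) : 'M[R]_N :=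
  \matrix_(i, j) 'D_(dir (Some i)) (fun y => 'D_(dir (Some j)) u y) z.

Definition dt (u : pt -> R) (z : pt) : R := 'D_(dir None) u z.

Definition LA (A : pt -> 'M[R]_N) (B : 'M[R]_N) (u : pt -> R) (z : pt) : R :=
  \tr (A z *m hess_x u z) + (z.1^T *m (B *m grad_x u z)) 0 0 - dt u z.

End Geometry.

(* Main.v *)
(** Landis's comparison method.  Let [M] be the inverse of the controllability
    matrix [C] of the drift, [th] the time since the pole, and [eta] the
    position relative to the translated pole, rescaled by the dilation of
    parameter [th^(-1/2)].  By the Riccati equation for [M], the kernel
    [th^-s exp (- <M eta, eta> / (4 lam))] is a subsolution for every [A] with
    ellipticity constants [lam], [Lam] as soon as [s >= Lam Q / (2 lam)].  The
    Cordes-Landis condition leaves room for [s < Q / 2 + 1], and then the kernel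
    is integrable near its pole, so that superpositions of kernels with poles on
    a fine lattice stay bounded.  The comparison principle turns this into a
    growth lemma: a nonnegative solution that is at least 1 on a positive
    proportion of the lattice points is bounded below at later times.  If the
    Harnack inequality failed, the growth lemma applied to [u] and to
    [sup u - u] would give points at which [u] grows geometrically, at
    geometrically shrinking distances, contradicting local boundedness.
    Lattices and finite sums replace sets of positive measure and integrals. *)
Require Import Defs.
From HB Require Import structures.
From mathcomp Require Import all_boot all_order all_algebra.
From mathcomp Require Import all_classical all_reals all_analysis.
From mathcomp Require Import ring lra zify.
From mathcomp Require polyrcf.

Import Order.TTheory GRing.Theory Num.Theory.
Import numFieldNormedType.Exports.

Local Open Scope classical_set_scope.
Local Open Scope ring_scope.

Set Implicit Arguments.
Unset Strict Implicit.
Unset Printing Implicit Defensive.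

(** Since A has no regularity in z, there is no adjoint and no fundamental solution to work with;
    the usable information is a factorization A(z) = H H^T at each separate point. It turns trace(A
    D^2 u) into second derivatives along the columns of H, so solutions and kernels meet only
    through one-variable expansions at a minimum point, and the class of solutions is stable under
    translations, dilations and affine changes of the value, whatever A is. A superposition of
    kernels is unbounded near its poles, so it is compared with v only where v <= 1/2, while the
    poles lie in cells where v >= 1. The mesh of the lattice depends on the modulus of continuity of
    u, hence every lattice estimate has to be uniform in the mesh. A lattice of size r acts at unit
    distance with the homogeneous volume r^(Q+2), whereas each failure of the inequality gains a
    factor 1 + ka. Radii of ratio th < 1 with th^(Q+2) (1 + ka) >= 1 balance loss and gain and still
    have a finite sum. *)

(** * Quadratic forms and Cholesky factorization *)

Section QuadraticForms.
Variable R : realType.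

Definition qform {n} (A : 'M[R]_n) (v : 'cV[R]_n) : R := (v^T *m A *m v) 0 0.

Definition sqnorm {n} (v : 'cV[R]_n) : R := \sum_k v k 0 ^+ 2.

Lemma sqnormE n (v : 'cV[R]_n) : sqnorm v = (v^T *m v) 0 0.
Proof. by rewrite mxE; apply: eq_bigr => i _; rewrite mxE expr2. Qed.

Lemma sqnorm_ge0 n (v : 'cV[R]_n) : 0 <= sqnorm v.
Proof. by apply: sumr_ge0 => i _; exact: sqr_ge0. Qed.

Lemma sqnorm_eq0 n (v : 'cV[R]_n) : sqnorm v = 0 -> v = 0.
Proof.
move=> /eqP; rewrite psumr_eq0; last by move=> i _; exact: sqr_ge0.
move=> /allP h; apply/matrixP => i j; rewrite (ord1 j) mxE.
by have := h i (mem_index_enum _); rewrite /= sqrf_eq0 => /eqP.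
Qed.

Lemma qform_gram m n (L : 'M[R]_(m, n)) (v : 'cV[R]_m) :
  qform (L *m L^T) v = sqnorm (L^T *m v).
Proof. by rewrite sqnormE trmx_mul trmxK /qform !mulmxA. Qed.

Lemma qform_sum n (A : 'M[R]_n) v :
  qform A v = \sum_i \sum_j A i j * v i 0 * v j 0.
Proof.
rewrite /qform mxE exchange_big; apply: eq_bigr => j _.
rewrite mxE big_distrl /=; apply: eq_bigr => i _; rewrite mxE; ring.
Qed.

Lemma bform_delta n (A : 'M[R]_n) i j :
  ((delta_mx i 0 : 'cV_n)^T *m A *m (delta_mx j 0 : 'cV_n)) 0 0 = A i j.
Proof. by rewrite trmx_delta -rowE -colE !mxE. Qed.

Lemma qform_line n (A : 'M[R]_n) (u v : 'cV[R]_n) (s : R) :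
  qform A (v + s *: u) = qform A v
    + s * ((u^T *m A *m v) 0 0 + (v^T *m A *m u) 0 0) + s ^+ 2 * qform A u.
Proof.
rewrite /qform; have -> : (v + s *: u)^T = v^T + s *: u^T.
  by apply/matrixP => i j; rewrite !mxE.
rewrite !mulmxDl !mulmxDr -!(scalemxAl, scalemxAr) !mxE; ring.
Qed.

(** Induction on the Schur complement of the leading entry. If that entry is zero, semidefiniteness
    forces its whole row to vanish. *)
Lemma psd_cholesky n (A : 'M[R]_n) : A^T = A -> (forall v, 0 <= qform A v) ->
  exists L : 'M[R]_n, A = L *m L^T.
Proof.
elim: n A => [|n IH] A; first by exists 0; apply/matrixP; case.
rewrite -[n.+1]/(1 + n)%N in A * => symA psd.
have symE i j : A i j = A j i by rewrite -[in LHS]symA mxE.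
set al := A 0 0.
have al0 : 0 <= al.
  by have := psd (delta_mx 0 0); rewrite /qform bform_delta.
have [al_gt0|] := ltP 0 al; last first.
  move=> ale; have al_eq : al = 0 by apply/eqP; rewrite eq_le ale al0.
  have rowA j : A 0 j = 0.
    (* On e_j + s e_0 the form is affine in s when A 0 0 = 0, so nonnegativity forces its slope to
       vanish. *)
    have test s : 0 <= 2 * s * A 0 j + A j j.
      have := psd (delta_mx j 0 + s *: delta_mx 0 0).
      rewrite qform_line /qform !bform_delta (symE j 0) -/al al_eq; lra.
    have [//|nz] := eqVneq (A 0 j) 0; exfalso.
    have := test (- (1 + A j j) / (2 * A 0 j)).
    have -> : 2 * (- (1 + A j j) / (2 * A 0 j)) * A 0 j = - (1 + A j j).
      by field.
    lra.
  have [|v|L' eL] := IH (drsubmx A).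
  - by rewrite trmx_drsub symA.
  - have := psd (col_mx 0 v); rewrite /qform -{1}[A]submxK tr_col_mx trmx0.
    by rewrite mul_row_block mul_row_col !mul0mx mulmx0 !add0r.
  exists (block_mx 0 0 0 L').
  rewrite tr_block_mx mulmx_block !trmx0 !mulmx0 !mul0mx !addr0 add0r -eL.
  rewrite -[LHS]submxK; congr block_mx; apply/matrixP => i j; rewrite !mxE.
  - by rewrite !(ord1 i) !(ord1 j) lshift0 -/al al_eq.
  - by rewrite !(ord1 i) lshift0 rowA.
  - by rewrite !(ord1 j) lshift0 symE rowA.
set b := dlsubmx A.
have urE : ursubmx A = b^T by rewrite /b trmx_dlsub symA.
have ulE : ulsubmx A = al%:M.
  by apply/matrixP => i j; rewrite !(ord1 i) !(ord1 j) !mxE lshift0 eqxx mulr1n.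
have [|v|L' eL] := IH (drsubmx A - al^-1 *: (b *m b^T)).
- have -> : (drsubmx A - al^-1 *: (b *m b^T))^T
      = (drsubmx A)^T - al^-1 *: (b *m b^T)^T.
    by apply/matrixP => i j; rewrite !mxE.
  by rewrite trmx_mul trmxK trmx_drsub symA.
- set w := b^T *m v; have vb : v^T *m b = w^T by rewrite trmx_mul trmxK.
  (* For fixed v this first coordinate minimizes the form, and the minimum is the form of the Schur
     complement. *)
  have := psd (col_mx (- al^-1 *: w) v).
  rewrite /qform -{1}[A]submxK tr_col_mx mul_row_block mul_row_col urE ulE -/b.
  have -> : (- al^-1 *: w)^T = - al^-1 *: w^T.
    by apply/matrixP => i j; rewrite !mxE.
  rewrite mulmxBr mulmxBl vb mul_mx_scalar !mulmxDl -!(scalemxAl, scalemxAr).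
  have -> : v^T *m (b *m b^T) *m v = w^T *m w by rewrite mulmxA vb -mulmxA.
  rewrite -[w^T *m b^T *m v]mulmxA -/w !scalerA.
  set X := v^T *m drsubmx A *m v; set Y := w^T *m w => h; apply: le_trans h _.
  rewrite !mxE le_eqVlt; apply/orP; left; apply/eqP; field.
  by rewrite gt_eqF.
have sq : Num.sqrt al ^+ 2 = al by rewrite sqr_sqrtr.
have sq0 : Num.sqrt al != 0 by rewrite gt_eqF // sqrtr_gt0.
exists (block_mx (Num.sqrt al)%:M 0 ((Num.sqrt al)^-1 *: b) L').
rewrite tr_block_mx mulmx_block !trmx0 !mulmx0 !mul0mx !addr0 -eL.
rewrite tr_scalar_mx -[LHS]submxK ulE urE; congr block_mx.
- by rewrite -scalar_mxM -expr2 sq.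
- by rewrite linearZ /= mul_scalar_mx scalerA mulfV // scale1r.
- by rewrite mul_mx_scalar scalerA mulfV // scale1r.
- rewrite linearZ /= -scalemxAl -scalemxAr scalerA -invfM -expr2 sq.
  by rewrite addrC subrK.
Qed.

Lemma unitmx_of_qform n (A : 'M[R]_n) :
  (forall v, qform A v = 0 -> v = 0) -> A \in unitmx.
Proof.
move=> h; rewrite -row_free_unit; apply: inj_row_free => v vA.
apply: trmx_inj; rewrite trmx0; apply: h.
by rewrite /qform trmxK vA mul0mx mxE.
Qed.

Lemma cauchy_schwarz n (u v : 'cV[R]_n) :
  ((u^T *m v) 0 0) ^+ 2 <= sqnorm u * sqnorm v.
Proof.
have [/eqP|nz] := eqVneq (sqnorm v) 0.
  by move=> /eqP/sqnorm_eq0 ->; rewrite mulmx0 mxE expr0n mulr_ge0 ?sqnorm_ge0.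
have pos : 0 < sqnorm v by rewrite lt_def nz sqnorm_ge0.
have uv : (v^T *m u) 0 0 = (u^T *m v) 0 0.
  have -> : v^T *m u = (u^T *m v)^T by rewrite trmx_mul trmxK.
  by rewrite mxE.
have := sqnorm_ge0 (u + (- (u^T *m v) 0 0 / sqnorm v) *: v).
have := qform_line 1%:M v u (- (u^T *m v) 0 0 / sqnorm v).
rewrite /qform !mulmx1 -!sqnormE uv => ->.
set c := (u^T *m v) 0 0; set x := sqnorm u; set y := sqnorm v => h.
have -> : x * y = (x + - c / y * (c + c) + (- c / y) ^+ 2 * y) * y + c ^+ 2.
  by field.
by rewrite lerDr mulr_ge0 // ltW.
Qed.

Lemma sqnorm_mulmx_le m n (L : 'M[R]_(m, n)) (v : 'cV[R]_n) :
  sqnorm (L *m v) <= (\sum_i sqnorm (row i L)^T) * sqnorm v.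
Proof.
rewrite {1}/sqnorm big_distrl /=; apply: ler_sum => i _.
have -> : (L *m v) i 0 = (((row i L)^T)^T *m v) 0 0.
  by rewrite trmxK -row_mul [RHS]mxE.
exact: cauchy_schwarz.
Qed.

(** A Cholesky factor replaces compactness of the sphere: v = W (L^T v) with W the inverse of L^T,
    and the constant comes from the rows of W. *)
Lemma qform_coercive n (A : 'M[R]_n) : A^T = A -> (forall v, 0 <= qform A v) ->
  (forall v, qform A v = 0 -> v = 0) ->
  exists2 c : R, 0 < c & forall v, c * sqnorm v <= qform A v.
Proof.
move=> symA psd def; have [L eL] := psd_cholesky symA psd.
have uL : L^T \in unitmx.
  have := unitmx_of_qform def; rewrite eL unitmx_mul => /andP[].
  by rewrite unitmx_tr.
set W := invmx L^T; set c := 1 + \sum_i sqnorm (row i W)^T.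
have c0 : 0 < c by rewrite ltr_wpDr // sumr_ge0 // => i _; exact: sqnorm_ge0.
exists c^-1; rewrite ?invr_gt0 // => v.
rewrite eL qform_gram mulrC ler_pdivrMr // mulrC.
have {1}-> : v = W *m (L^T *m v) by rewrite mulmxA mulVmx // mul1mx.
apply: le_trans (sqnorm_mulmx_le _ _) _.
by rewrite ler_wpM2r ?sqnorm_ge0 // lerDr.
Qed.

End QuadraticForms.

(** * Positive definiteness of the Hilbert matrix *)

Section HilbertForm.
Variable R : realType.

(** The form is the integral of p^2 over [0,1]. A polynomial primitive turns the integral into a
    difference of values, whose sign the mean value theorem gives. *)
Lemma hilbert_form_mvt n (al : nat -> R) (p := \poly_(i < n) al i) :
  exists P : {poly R}, P^`() = p ^+ 2 /\
    P.[1] - P.[0] = \sum_(i < n) \sum_(j < n) al i * al j / (i + j).+1%:R.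
Proof.
exists (\sum_(i < n) \sum_(j < n) (al i * al j / (i + j).+1%:R) *: 'X^((i + j).+1)).
split.
  rewrite linear_sum /= expr2 {1}/p poly_def mulr_suml; apply: eq_bigr => i _.
  rewrite linear_sum /= /p poly_def mulr_sumr; apply: eq_bigr => j _.
  rewrite derivZ derivXn /=. rewrite -[X in _ *: X]scaler_nat scalerA divfK ?pnatr_eq0 //.
  by rewrite -scalerAl -scalerAr scalerA exprD.
rewrite !horner_sum -sumrB; apply: eq_bigr => i _.
rewrite !horner_sum -sumrB; apply: eq_bigr => j _.
by rewrite !hornerE !expr1n expr0n /= mulr0 subr0 mulr1.
Qed.

Lemma hilbert_form_ge0 n (al : nat -> R) :
  0 <= \sum_(i < n) \sum_(j < n) al i * al j / (i + j).+1%:R.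
Proof.
have [P [dP <-]] := hilbert_form_mvt n al.
have [c _ ->] := polyrcf.poly_mvt P (@ltr01 R).
by rewrite dP horner_exp subr0 mulr1 sqr_ge0.
Qed.

(** A vanishing integral makes the monotone primitive P constant on [0,1]; having too many roots, P
    - P(0) is zero, so p^2 = P' = 0. *)
Lemma hilbert_form_eq0 n (al : nat -> R) :
  \sum_(i < n) \sum_(j < n) al i * al j / (i + j).+1%:R = 0 ->
  forall i, (i < n)%N -> al i = 0.
Proof.
have [P [dP <-]] := hilbert_form_mvt n al => /eqP; rewrite subr_eq0 => /eqP P10.
have mono x y : x <= y -> P.[x] <= P.[y].
  rewrite le_eqVlt => /orP[/eqP -> //|xy].
  have [c _ e] := polyrcf.poly_mvt P xy; rewrite -subr_ge0 e dP horner_exp.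
  by rewrite mulr_ge0 ?sqr_ge0 // subr_ge0 ltW.
have cst x : 0 <= x <= 1 -> P.[x] = P.[0].
  by move=> /andP[x0 x1]; apply/eqP; rewrite eq_le (mono 0 x x0) andbT -P10 mono.
have P0 : P - P.[0]%:P = 0.
  apply/eqP/negPn/negP => nz.
  (* The points 1/(k+1) are distinct roots in [0,1], as many as the size of the polynomial, which is
     one more than its degree. *)
  pose rs := [seq (k.+1%:R)^-1 : R | k <- iota 0 (size (P - P.[0]%:P))].
  have := max_poly_roots nz (rs := rs); rewrite size_map size_iota ltnn.
  case/(_ _ _)/Bool.diff_false_true => //.
    apply/allP => _ /mapP[k _ ->]; rewrite rootE !hornerE cst ?subrr //.
    by rewrite invr_ge0 ler0n invf_le1 ?ltr0Sn // ler1n.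
  rewrite map_inj_uniq ?iota_uniq // => k l /invr_inj /eqP.
  by rewrite eqr_nat => /eqP [].
have := congr1 deriv P0; rewrite derivB derivC subr0 deriv0 dP => /eqP.
rewrite sqrf_eq0 => /eqP p0 i lin.
by have := coef_poly n al i; rewrite p0 coef0 lin.
Qed.

End HilbertForm.

(** * Drift group, dilations, and the controllability matrix with its Lyapunov and Riccati
    equations *)

(* The weight of the coordinate [x_k] in the block [i] is [wt k = 2i+1]. *)
Section KolmogorovAlgebra.
Variables (R : realType) (N : nat) (wt : 'I_N -> nat) (B : 'M[R]_N).
Hypothesis B_graded : forall k l, B k l != 0 -> wt l = (wt k).+2.

Definition wtsum : nat := \sum_k wt k.
Local Notation n1 := wtsum.+1.

Lemma wt_le_sum k : (wt k <= wtsum)%N.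
Proof. by rewrite /wtsum (bigD1 k) //= leq_addr. Qed.

Lemma exp_graded j k l : (B ^+ j) k l != 0 -> wt l = (wt k + 2 * j)%N.
Proof.
elim: j l => [|j IH] l.
  rewrite expr0 mxE; case: (k =P l) => [->|_]; first by rewrite muln0 addn0.
  by rewrite eqxx.
rewrite exprSr mxE; move=> /eqP h.
have [m] : exists m, (B ^+ j) k m * B m l != 0.
  apply: contra_notP h => /forallNP h; rewrite big1 // => m _.
  by have /negP := h m; rewrite negbK => /eqP.
rewrite mulf_eq0 negb_or => /andP[/IH e1 /B_graded ->]; rewrite e1; lia.
Qed.

Lemma exp_nilp j : (n1 <= j)%N -> B ^+ j = 0.
Proof.
move=> jn; apply/matrixP => k l; rewrite [RHS]mxE; apply/eqP/negPn/negP.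
move=> /exp_graded e; have := wt_le_sum l; rewrite e => h; move: jn h.
lia.
Qed.

Lemma tr_exp j : (B ^+ j)^T = B^T ^+ j.
Proof.
elim: j => [|j IH]; first by rewrite !expr0 trmx1.
by rewrite exprS exprSr -IH [in LHS](_ : B * B ^+ j = B *m B ^+ j) // trmx_mul.
Qed.

Lemma exp_tr_nilp j : (n1 <= j)%N -> B^T ^+ j = 0.
Proof. by move=> jn; rewrite -tr_exp exp_nilp // trmx0. Qed.

(** The exponential series of -s B^T, complete because B is nilpotent. Its entries are polynomials
    in s, which is how they are differentiated and shown to be continuous. *)
Definition drift_exp (s : R) : 'M[R]_N :=
  \sum_(j < n1) ((- s) ^+ j / j`!%:R) *: B^T ^+ j.

Lemma drift_expD s t : drift_exp (s + t) = drift_exp s *m drift_exp t.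
Proof.
pose F i j : R := (- s) ^+ i / i`!%:R * ((- t) ^+ j / j`!%:R).
have -> : drift_exp s *m drift_exp t
    = \sum_(i < n1) \sum_(j < n1) F i j *: B^T ^+ (i + j).
  rewrite mulmx_suml; apply: eq_bigr => i _; rewrite mulmx_sumr.
  apply: eq_bigr => j _; rewrite -scalemxAl -scalemxAr scalerA exprD.
  by congr (_ *: _).
have coef (k : 'I_n1) : (- (s + t)) ^+ k / k`!%:R
    = \sum_(i < n1) \sum_(j < n1 | (i + j)%N == k) F i j.
  transitivity (\sum_(i < n1 | (i < k.+1)%N) F i (k - i)%N); last first.
    rewrite big_mkcond; apply: eq_bigr => i _; case: ifP => ik.
      have jn : (k - i < n1)%N by have := ltn_ord k; lia.
      rewrite (big_pred1 (Ordinal jn)) // => j /=.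
      by rewrite -val_eqE /=; apply/eqP/eqP; lia.
    by rewrite big_pred0 // => j; apply/eqP; lia.
  rewrite (big_ord_narrow (ltn_ord k)) opprD addrC exprDn mulr_suml.
  apply: eq_bigr => i _ /=; rewrite /F.
  have ik : (i <= k)%N by rewrite -ltnS.
  rewrite -[_ *+ 'C(k, i)]mulr_natr.
  have : (k`!%:R : R) != 0 by rewrite pnatr_eq0 -lt0n fact_gt0.
  have : (i`!%:R : R) != 0 by rewrite pnatr_eq0 -lt0n fact_gt0.
  have : ((k - i)`!%:R : R) != 0 by rewrite pnatr_eq0 -lt0n fact_gt0.
  have : 'C(k, i)%:R * (i`!%:R * (k - i)`!%:R) = k`!%:R :> R.
    by rewrite -!natrM bin_fact.
  move=> <- h1 h2; rewrite mulf_eq0 negb_or => /andP[h3 _].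
  by field; rewrite h3 h2 h1.
(* Terms with i + j beyond the truncation vanish by nilpotency, so a product of truncated series
   loses nothing. *)
have split_ij (i j : 'I_n1) : F i j *: B^T ^+ (i + j)
    = \sum_(k < n1 | (i + j)%N == k) F i j *: B^T ^+ k.
  have [ijn|ijn] := ltnP (i + j) n1.
    by rewrite (big_pred1 (Ordinal ijn)) // => k; rewrite -val_eqE eq_sym.
  rewrite exp_tr_nilp // scaler0 big_pred0 // => k.
  by apply/eqP; have := ltn_ord k; lia.
under [RHS]eq_bigr do under eq_bigr do rewrite split_ij.
under [RHS]eq_bigr do rewrite (exchange_big_dep xpredT) //=.
rewrite exchange_big; apply: eq_bigr => k _; rewrite coef scaler_suml.
by apply: eq_bigr => i _; rewrite scaler_suml.
Qed.

Lemma drift_exp0 : drift_exp 0 = 1%:M.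
Proof.
rewrite /drift_exp big_ord_recl big1 => [|j _].
  by rewrite !expr0 fact0 divr1 scale1r addr0.
by rewrite oppr0 expr0n mul0r scale0r.
Qed.

Lemma drift_expNK s : drift_exp s *m drift_exp (- s) = 1%:M.
Proof. by rewrite -drift_expD subrr drift_exp0. Qed.

Definition dilation (rho : R) : 'M[R]_N := diag_mx (\row_k rho ^+ wt k).

Lemma dilationE rho (v : 'cV[R]_N) k : (dilation rho *m v) k 0 = rho ^+ wt k * v k 0.
Proof. by rewrite mul_diag_mx !mxE. Qed.

Lemma dilation_mul rho sg : dilation rho *m dilation sg = dilation (rho * sg).
Proof.
apply/matrixP => k l; rewrite mul_diag_mx !mxE exprMn.
by case: (k =P l) => [->|_]; rewrite ?mulr1n // !mulr0n mulr0.
Qed.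

Lemma dilation1 : dilation 1 = 1%:M.
Proof. by apply/matrixP => k l; rewrite !mxE expr1n. Qed.

(** An entry of B^j is nonzero only between weights that differ by 2j. *)
Lemma dilation_trX rho j :
  dilation rho *m B^T ^+ j = rho ^+ (2 * j) *: (B^T ^+ j *m dilation rho).
Proof.
apply/matrixP => k l; rewrite mul_diag_mx mxE [RHS]mxE mul_mx_diag !mxE.
have -> : (B^T ^+ j) k l = (B ^+ j) l k by rewrite -tr_exp mxE.
have [->|/exp_graded ->] := eqVneq ((B ^+ j) l k) 0; first by rewrite !(mulr0,mul0r).
by rewrite exprD; ring.
Qed.

Lemma dilation_drift_exp rho s :
  dilation rho *m drift_exp s = drift_exp (rho ^+ 2 * s) *m dilation rho.
Proof.
rewrite mulmx_sumr mulmx_suml; apply: eq_bigr => j _.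
rewrite -scalemxAr -scalemxAl dilation_trX scalerA; congr (_ *: _).
rewrite -mulrN exprMn -exprM; ring.
Qed.

Definition proj0 : 'M[R]_N := diag_mx (\row_k (wt k == 1)%:R).
Definition wtmx : 'M[R]_N := diag_mx (\row_k (wt k)%:R).

Lemma proj0_idem : proj0 *m proj0 = proj0.
Proof.
apply/matrixP => k l; rewrite mul_diag_mx !mxE.
by case: (wt k == 1); rewrite ?mul1r // !mul0r mul0rn.
Qed.

(** The matrices in the expansion of E(s) A_0 E(s)^T into powers of s; the coefficients [cc] are the
    scalar factors after integration over [0,1]. *)
Let X i j : 'M[R]_N := B^T ^+ i *m proj0 *m B ^+ j.

Let proj0_exp_wt j : proj0 *m B ^+ j *m wtmx = (2 * j).+1%:R *: (proj0 *m B ^+ j).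
Proof.
apply/matrixP => k l; rewrite mul_mx_diag mxE [RHS]mxE mul_diag_mx !mxE.
have [->|/exp_graded ->] := eqVneq ((B ^+ j) k l) 0; first by rewrite !(mulr0,mul0r).
have [->|_] := eqVneq; last by rewrite !(mulr0,mul0r).
by rewrite add1n; ring.
Qed.

Let X_tr i j : (X i j)^T = X j i.
Proof. by rewrite /X !trmx_mul tr_diag_mx -!tr_exp trmxK mulmxA. Qed.

Let X_wt i j : X i j *m wtmx = (2 * j).+1%:R *: X i j.
Proof. by rewrite /X -!mulmxA (mulmxA proj0) proj0_exp_wt -scalemxAr. Qed.

Let X_B i j : X i j *m B = X i j.+1.
Proof. by rewrite /X -mulmxA exprSr. Qed.

Let cc i j : R := (-1) ^+ (i + j) / (i`!%:R * j`!%:R * (i + j).+1%:R).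

Let cc_sym i j : cc i j = cc j i.
Proof. by rewrite /cc [(i + j)%N]addnC [i`!%:R * _]mulrC. Qed.

(* [Cmat] is the integral over [0,1] of [E(s) A_0 E(s)^T]. *)
Definition Cmat : 'M[R]_N := \sum_(i < n1) \sum_(j < n1) cc i j *: X i j.

Lemma Cmat_tr : Cmat^T = Cmat.
Proof.
rewrite /Cmat [in LHS]exchange_big linear_sum; apply: eq_bigr => i _.
rewrite linear_sum; apply: eq_bigr => j _; rewrite linearZ /= X_tr.
by rewrite cc_sym.
Qed.

Let shift_sum (f : nat -> R) (Y : nat -> 'M[R]_N) : Y n1 = 0 ->
  \sum_(j < n1) f j *: Y j.+1
    = \sum_(j < n1) (if nat_of_ord j is j'.+1 then f j' else 0) *: Y (nat_of_ord j).
Proof.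
move=> Y0.
pose G j := (if j is j'.+1 then f j' else 0) *: Y j.
have eG : \sum_(j < n1.+1) G j = \sum_(j < n1) f j *: Y j.+1.
  by rewrite big_ord_recl /G /= scale0r add0r; apply: eq_bigr.
by rewrite -eG big_ord_recr /= {2}/G Y0 scaler0 addr0.
Qed.

(** For i + j > 0 the two shifted terms are -(-1)^(i+j)/(i! j!) times j/(i+j) and i/(i+j), so
    together they cancel the third; at (0,0) there is no shift. *)
Let coef_B i j : (if j is j'.+1 then cc i j' else 0) + (if i is i'.+1 then cc i' j else 0)
  + (i + j).+1%:R * cc i j = ((i == 0) && (j == 0))%:R.
Proof.
have f0 m : (m`!%:R : R) != 0 by rewrite pnatr_eq0 -lt0n fact_gt0.
have fS m : (m.+1%:R : R) != 0 by rewrite pnatr_eq0.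
have g1 m : 1 + m%:R != 0 :> R by rewrite gt_eqF // ltr_pwDl // ler0n.
have g2 m : 2 + m%:R != 0 :> R by rewrite gt_eqF // ltr_pwDl // ler0n.
rewrite /cc; case: i => [|i]; case: j => [|j] /=.
- by rewrite fact0 !add0r; field.
- by rewrite !add0n factS exprS natrM addr0; field; rewrite !f0 g1 g2.
- by rewrite !addn0 factS exprS natrM add0r; field; rewrite !f0 g1 g2.
- rewrite !addSn !addnS !factS !exprS !natrM.
  have h2 : ((i + j).+2%:R : R) != 0 by [].
  have h3 : ((i + j).+3%:R : R) != 0 by [].
  have e2 : (i + j).+2%:R = i.+1%:R + j.+1%:R :> R by rewrite -natrD addSn addnS.
  apply/eqP; rewrite -(inj_eq (mulfI h2)) mulr0; apply/eqP.
  transitivity ((-1) ^+ (i + j) / (i`!%:R * j`!%:R) *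
    ((i + j).+2%:R - i.+1%:R - j.+1%:R) / (i.+1%:R * j.+1%:R) : R).
    by field; rewrite !f0 !g1 !gt_eqF // ltr_pwDl // addr_ge0 ?ler0n.
  by rewrite e2; field; rewrite !f0 !g1.
Qed.

(** Let C(t) be the integral of E(s) A_0 E(s)^T over [0,t]. Then C'(1) = A_0 - B^T C - C B, while
    the homogeneity C(t) = dil(sqrt t) C dil(sqrt t) gives C'(1) = (W C + C W)/2 with W = [wtmx].
    The proof checks the resulting identity on coefficients. *)
Lemma lyapunov : Cmat *m (B + 2^-1 *: wtmx) + (B^T + 2^-1 *: wtmx) *m Cmat = proj0.
Proof.
have trC : (B^T + 2^-1 *: wtmx) *m Cmat = (Cmat *m (B + 2^-1 *: wtmx))^T.
  by rewrite trmx_mul Cmat_tr linearD linearZ /= tr_diag_mx.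
have CB : Cmat *m (B + 2^-1 *: wtmx) = \sum_(i < n1) \sum_(j < n1)
    ((if (j : nat) is j'.+1 then cc i j' else 0) + (2 * j).+1%:R / 2 * cc i j) *: X i j.
  rewrite mulmx_suml; apply: eq_bigr => i _; rewrite mulmx_suml.
  transitivity (\sum_(j < n1) cc i j *: X i j.+1
      + \sum_(j < n1) ((2 * j).+1%:R / 2 * cc i j) *: X i j).
    rewrite -big_split; apply: eq_bigr => j _ /=.
    rewrite mulmxDr -!scalemxAl X_B -!scalemxAr X_wt !scalerA.
    by congr (_ + _ *: _); ring.
  rewrite shift_sum; last by rewrite /X exp_nilp // mulmx0.
  by rewrite -big_split; apply: eq_bigr => j _ /=; rewrite -scalerDl.
rewrite trC CB linear_sum /=.
under [X in _ + X]eq_bigr do rewrite linear_sum /=.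
rewrite [X in _ + X]exchange_big -big_split /=.
transitivity (\sum_(i < n1) \sum_(j < n1) ((i == 0 :> nat) && (j == 0 :> nat))%:R *: X i j).
  apply: eq_bigr => i _; rewrite -big_split; apply: eq_bigr => j _ /=.
  rewrite linearZ /= X_tr -scalerDl -coef_B; congr (_ *: _).
  rewrite [cc j i]cc_sym.
  have -> : (match (i : nat) with 0 => 0 | i'.+1 => cc j i' end) =
     (match (i : nat) with 0 => 0 | i'.+1 => cc i' j end).
    by case: (nat_of_ord i).
  move: (cc i j) (match _ with 0 => _ | _ => _ end) (match _ with 0 => _ | _ => _ end).
  by move=> c x y; field.
rewrite big_ord_recl /= big_ord_recl /= scale1r !big1 ?addr0 => [|i _|j _].
- by rewrite /X !expr0 mulmx1 mul1mx.
- by rewrite big1 // => j _; rewrite scale0r.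
- by rewrite scale0r.
Qed.

Hypothesis B_observable : forall v : 'cV[R]_N,
  (forall j k, wt k = 1 -> (B ^+ j *m v) k 0 = 0) -> v = 0.

(** One Hilbert form per coordinate, in the Taylor coefficients of A_0 E(s)^T v, so that
    definiteness of [Cmat] is reduced to that of the Hilbert matrix. *)
Lemma qform_Cmat v : qform Cmat v = \sum_k \sum_(i < n1) \sum_(j < n1)
  ((-1) ^+ i / i`!%:R * (proj0 *m B ^+ i *m v) k 0) *
  ((-1) ^+ j / j`!%:R * (proj0 *m B ^+ j *m v) k 0) / (i + j).+1%:R.
Proof.
rewrite /qform /Cmat mulmx_sumr mulmx_suml summxE exchange_big.
apply: eq_bigr => i _; rewrite mulmx_sumr mulmx_suml summxE exchange_big.
apply: eq_bigr => j _; rewrite -scalemxAr -scalemxAl mxE.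
have -> : v^T *m X i j *m v = (proj0 *m B ^+ i *m v)^T *m (proj0 *m B ^+ j *m v).
  by rewrite !trmx_mul tr_diag_mx tr_exp /X -[in LHS]proj0_idem !mulmxA.
rewrite [X in _ * X]mxE mulr_sumr; apply: eq_bigr => k _.
rewrite [X in _ * (X * _)]mxE /cc exprD.
have f0 m : (m`!%:R : R) != 0 by rewrite pnatr_eq0 -lt0n fact_gt0.
by field; rewrite !f0 /= gt_eqF // ltr_pwDl // addr_ge0 ?ler0n.
Qed.

Lemma Cmat_ge0 v : 0 <= qform Cmat v.
Proof.
rewrite qform_Cmat; apply: sumr_ge0 => k _.
exact: (hilbert_form_ge0 n1 (fun i => (-1) ^+ i / i`!%:R * (proj0 *m B ^+ i *m v) k 0)).
Qed.

(** Vanishing Hilbert forms give A_0 B^j v = 0 for all j, and the Kalman condition [B_observable]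
    concludes. *)
Lemma Cmat_def v : qform Cmat v = 0 -> v = 0.
Proof.
rewrite qform_Cmat => /eqP; rewrite psumr_eq0 => [/allP h|k _]; last first.
  exact: (hilbert_form_ge0 n1 (fun i => (-1) ^+ i / i`!%:R * (proj0 *m B ^+ i *m v) k 0)).
apply: B_observable => j k wk.
have [jn|jn] := ltnP j n1; last by rewrite exp_nilp // mul0mx mxE.
have /eqP hk := h k (mem_index_enum _).
have /eqP := hilbert_form_eq0
  (al := fun i => (-1) ^+ i / i`!%:R * (proj0 *m B ^+ i *m v) k 0) hk jn.
rewrite !mulf_eq0 signr_eq0 invr_eq0 pnatr_eq0 -leqn0 leqNgt fact_gt0 /=.
by rewrite -mulmxA mul_diag_mx !mxE wk eqxx mul1r => /eqP.
Qed.

Definition Mmat : 'M[R]_N := invmx Cmat.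

Lemma Cmat_unit : Cmat \in unitmx.
Proof. exact: unitmx_of_qform Cmat_def. Qed.

Lemma Mmat_tr : Mmat^T = Mmat.
Proof. by rewrite /Mmat trmx_inv Cmat_tr. Qed.

Let qform_Mmat v : qform Mmat v = qform Cmat (Mmat *m v).
Proof.
by rewrite /qform trmx_mul Mmat_tr !mulmxA mulmxKV // Cmat_unit.
Qed.

Lemma Mmat_ge0 v : 0 <= qform Mmat v.
Proof. by rewrite qform_Mmat Cmat_ge0. Qed.

Lemma Mmat_def v : qform Mmat v = 0 -> v = 0.
Proof.
rewrite qform_Mmat => /Cmat_def /(congr1 (mulmx Cmat)).
by rewrite mulmx0 mulKVmx // Cmat_unit.
Qed.

(** The Lyapunov equation multiplied by [Mmat] on both sides. It makes the derivative of the
    rescaled quadratic form along the drift a perfect square in the diffusion directions. *)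
Lemma riccati : (B + 2^-1 *: wtmx) *m Mmat + Mmat *m (B^T + 2^-1 *: wtmx)
  = Mmat *m proj0 *m Mmat.
Proof.
rewrite -lyapunov mulmxDr mulmxDl; congr (_ + _).
  by rewrite mulmxA mulVmx ?Cmat_unit // mul1mx.
by rewrite -!mulmxA mulmxV ?Cmat_unit // mulmx1.
Qed.

(** The origin of Q in the exponent: multiplied by M, the Lyapunov equation has trace tr([wtmx]),
    because B has zero diagonal. *)
Lemma trace_proj0_Mmat : \tr (proj0 *m Mmat) = wtsum%:R.
Proof.
have -> : wtsum%:R = \tr wtmx :> R.
  by rewrite /mxtrace natr_sum; apply: eq_bigr => k _; rewrite !mxE eqxx.
have trB : \tr B = 0.
  rewrite /mxtrace big1 // => k _; apply/eqP/negPn/negP => /B_graded; lia.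
rewrite -lyapunov mulmxDl linearD /= mxtrace_mulC mulmxA mulVmx ?Cmat_unit //.
rewrite mul1mx -mulmxA mulmxV ?Cmat_unit // mulmx1 !linearD /= mxtrace_tr trB.
by rewrite !add0r linearZ /= -mulrDl -[RHS]mul1r; congr (_ * _); field.
Qed.

End KolmogorovAlgebra.

(** * One-variable expansions at a minimum *)

Section Taylor.
Variable R : realType.
Implicit Types (f g : R -> R) (a b c e x s : R).

(** Peano expansions are what a test at a minimum needs. The companion [rderiv] is one-sided
    because, at the final time of a box, the drift curve can be followed only into the past. *)
Definition taylor2 f b a := forall e, 0 < e -> exists2 d, 0 < d &
  forall s, `|s| < d -> `|f s - f 0 - b * s - a * s ^+ 2| <= e * s ^+ 2.

Definition rderiv f a := forall e, 0 < e -> exists2 d, 0 < d &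
  forall s, 0 < s < d -> `|f s - f 0 - a * s| <= e * s.

Lemma is_derive_approx f x a : is_derive x 1 f a -> forall e, 0 < e ->
  exists2 d, 0 < d & forall h, `|h| < d -> `|f (x + h) - f x - a * h| <= e * `|h|.
Proof.
move=> [df <-] e e0.
have /cvgrPdist_le /(_ e e0) [d /= d0 dP] :
  h^-1 *: ((f \o shift x) (h *: (1 : R)) - f x) @[h --> 0^'] --> 'D_1 f x by exact: df.
exists d => // h hd; have [->|h0] := eqVneq h 0.
  by rewrite addr0 subrr mulr0 subrr !normr0 mulr0.
have := dP h; rewrite /= sub0r normrN => /(_ hd h0).
rewrite scaler1 [h + x]addrC /= => le_e.
have -> : f (x + h) - f x - 'D_1 f x * h = - (h * ('D_1 f x - h^-1 * (f (x + h) - f x))).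
  by field.
by rewrite normrN normrM mulrC ler_wpM2r.
Qed.

Lemma rderiv_is_derive f a : is_derive (0 : R) 1 f a -> rderiv f a.
Proof.
move=> df e e0; have [d d0 dP] := is_derive_approx df e0; exists d => // s /andP[s0 sd].
by have := dP s; rewrite add0r gtr0_norm // => /(_ sd).
Qed.

Lemma mean_value_le f f' (d K : R) : (forall x, `|x| < d -> is_derive x 1 f (f' x)) ->
  forall s, `|s| < d -> (forall x, `|x| <= `|s| -> `|f' x| <= K) ->
  `|f s - f 0| <= K * `|s|.
Proof.
move=> df s sd bd.
have inD x y z : `|x| < d -> `|y| < d -> x <= z <= y -> `|z| < d.
  rewrite !ltr_norml => /andP[? ?] /andP[? ?] /andP[xz zy].
  by rewrite (lt_le_trans _ xz) ?(le_lt_trans zy).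
have d0 : `|0 : R| < d by rewrite normr0 (le_lt_trans _ sd).
have cont x y : `|x| < d -> `|y| < d -> {within `[x, y], continuous f}.
  move=> xd yd; apply: derivable_within_continuous => z; rewrite in_itv /= => xzy.
  by have [] := df z (inD x y z xd yd xzy).
have [sp|sn|->] := ltgtP s 0; last by rewrite subrr !normr0 mulr0.
- have [||c cs e] := @MVT _ f f' s 0 sp; last 1 first.
  + rewrite distrC e normrM sub0r normrN ler_wpM2r // bd //.
    by move: cs; rewrite in_itv /= => /andP[sc c0]; rewrite !ltr0_norm // lerN2 ltW.
  + by move=> x; rewrite in_itv /= => /andP[/ltW ? /ltW ?]; apply/df/(inD s 0) => //; apply/andP.
  + exact: cont.
- have [||c cs e] := @MVT _ f f' 0 s sn; last 1 first.
  + rewrite e normrM subr0 ler_wpM2r // bd //.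
    by move: cs; rewrite in_itv /= => /andP[sc c0]; rewrite !gtr0_norm // ltW.
  + by move=> x; rewrite in_itv /= => /andP[/ltW ? /ltW ?]; apply/df/(inD 0 s) => //; apply/andP.
  + exact: cont.
Qed.

(** The mean value bound is applied to f minus its quadratic part, so f' has to be differentiable at
    0 only. *)
Lemma taylor2_is_derive f f' a :
  (exists2 d, 0 < d & forall s, `|s| < d -> is_derive s 1 f (f' s)) ->
  is_derive (0 : R) 1 f' (2 * a) -> taylor2 f (f' 0) a.
Proof.
move=> [d1 d10 df] df' e e0; have [d2 d20 dP] := is_derive_approx df' e0.
exists (Num.min d1 d2); rewrite ?lt_min ?d10 // => s; rewrite lt_min => /andP[s1 s2].
pose h x := f x - f' 0 * x - a * x ^+ 2.
have dh x : `|x| < d1 -> is_derive x 1 h (f' x - f' 0 - 2 * a * x).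
  move=> xd; have ? := df x xd; apply: is_derive_eq.
  by rewrite /GRing.scale /= !(mulr0,mulr1); ring.
have -> : f s - f 0 - f' 0 * s - a * s ^+ 2 = h s - h 0 by rewrite /h; ring.
rewrite -[s ^+ 2]real_normK ?num_real // expr2 mulrA.
apply: (mean_value_le dh s1) => x xs.
have := dP x; rewrite add0r => /(_ (le_lt_trans xs s2)) /le_trans; apply.
by rewrite ler_wpM2l // ltW.
Qed.

Lemma taylor2D f g b a b' a' : taylor2 f b a -> taylor2 g b' a' ->
  taylor2 (fun s => f s + g s) (b + b') (a + a').
Proof.
move=> Tf Tg e e0; have e2 : 0 < e / 2 by rewrite divr_gt0.
have [d1 d10 P1] := Tf _ e2; have [d2 d20 P2] := Tg _ e2.
exists (Num.min d1 d2); rewrite ?lt_min ?d10 // => s; rewrite lt_min => /andP[s1 s2].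
have -> : f s + g s - (f 0 + g 0) - (b + b') * s - (a + a') * s ^+ 2 =
  (f s - f 0 - b * s - a * s ^+ 2) + (g s - g 0 - b' * s - a' * s ^+ 2) by ring.
rewrite (le_trans (ler_normD _ _)) //.
have -> : e * s ^+ 2 = e / 2 * s ^+ 2 + e / 2 * s ^+ 2 by field.
by rewrite lerD ?P1 ?P2.
Qed.

Lemma rderivD f g a a' : rderiv f a -> rderiv g a' -> rderiv (fun s => f s + g s) (a + a').
Proof.
move=> Tf Tg e e0; have e2 : 0 < e / 2 by rewrite divr_gt0.
have [d1 d10 P1] := Tf _ e2; have [d2 d20 P2] := Tg _ e2.
exists (Num.min d1 d2); rewrite ?lt_min ?d10 // => s; rewrite lt_min => /and3P[s0 s1 s2].
have -> : f s + g s - (f 0 + g 0) - (a + a') * s =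
  (f s - f 0 - a * s) + (g s - g 0 - a' * s) by ring.
rewrite (le_trans (ler_normD _ _)) //.
have -> : e * s = e / 2 * s + e / 2 * s by field.
by rewrite lerD ?P1 ?P2 // s0.
Qed.

Lemma taylor2_affine f b a c k : taylor2 f b a -> taylor2 (fun s => c * f s + k) (c * b) (c * a).
Proof.
move=> Tf e e0; have c0 : 0 < `|c| + 1 by rewrite ltr_wpDl.
have [d d0 P] := Tf (e / (`|c| + 1)) (divr_gt0 e0 c0); exists d => // s sd.
have -> : c * f s + k - (c * f 0 + k) - c * b * s - c * a * s ^+ 2 =
  c * (f s - f 0 - b * s - a * s ^+ 2) by ring.
rewrite normrM (le_trans (ler_wpM2l _ (P s sd))) // mulrA ler_wpM2r ?sqr_ge0 //.
by rewrite mulrA ler_pdivrMr // mulrDr mulr1 [e * _]mulrC lerDl ltW.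
Qed.

Lemma rderiv_affine f a c k : rderiv f a -> rderiv (fun s => c * f s + k) (c * a).
Proof.
move=> Tf e e0; have c0 : 0 < `|c| + 1 by rewrite ltr_wpDl.
have [d d0 P] := Tf (e / (`|c| + 1)) (divr_gt0 e0 c0); exists d => // s sd.
have -> : c * f s + k - (c * f 0 + k) - c * a * s = c * (f s - f 0 - a * s) by ring.
have s0 : 0 <= s by case/andP: sd => /ltW.
rewrite normrM (le_trans (ler_wpM2l _ (P s sd))) // mulrA ler_wpM2r //.
by rewrite mulrA ler_pdivrMr // mulrDr mulr1 [e * _]mulrC lerDl ltW.
Qed.

Lemma taylor2_cst k : taylor2 (fun=> k) 0 0.
Proof.
move=> e e0; exists 1 => // s _.
by rewrite !mul0r subrr !subr0 normr0 mulr_ge0 ?sqr_ge0 // ltW.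
Qed.

Lemma taylor2_sum (I : finType) (F : I -> R -> R) (b a : I -> R) :
  (forall i, taylor2 (F i) (b i) (a i)) ->
  taylor2 (fun s => \sum_i F i s) (\sum_i b i) (\sum_i a i).
Proof.
move=> h; elim: (index_enum I) => [|i r IH].
  under eq_fun do rewrite big_nil; rewrite !big_nil; exact: taylor2_cst.
by under eq_fun do rewrite big_cons; rewrite !big_cons; exact: taylor2D.
Qed.

Lemma rderiv_cst k : rderiv (fun=> k) 0.
Proof.
move=> e e0; exists 1 => // s /andP[/ltW s0 _].
by rewrite !mul0r subrr subr0 normr0 mulr_ge0 // ltW.
Qed.

Lemma rderiv_sum (I : finType) (F : I -> R -> R) (a : I -> R) :
  (forall i, rderiv (F i) (a i)) -> rderiv (fun s => \sum_i F i s) (\sum_i a i).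
Proof.
move=> h; elim: (index_enum I) => [|i r IH].
  under eq_fun do rewrite big_nil; rewrite !big_nil; exact: rderiv_cst.
by under eq_fun do rewrite big_cons; rewrite !big_cons; exact: rderivD.
Qed.

Lemma taylor2_scale f b a r : 0 < r ->
  taylor2 f b a -> taylor2 (fun s => f (r * s)) (r * b) (r ^+ 2 * a).
Proof.
move=> r0 Tf e e0; have [d d0 P] := Tf (e / r ^+ 2) (divr_gt0 e0 (exprn_gt0 2 r0)).
exists (d / r) => [|s sd]; first exact: divr_gt0.
have := P (r * s); rewrite normrM gtr0_norm // mulrC -ltr_pdivlMr // => /(_ sd).
have -> : e / r ^+ 2 * (r * s) ^+ 2 = e * s ^+ 2 by field; rewrite gt_eqF.
rewrite mulr0 => le_e.
by apply: le_trans le_e; rewrite le_eqVlt; apply/orP; left; apply/eqP; congr `|_|; ring.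
Qed.

Lemma rderiv_scale f a r : 0 < r -> rderiv f a -> rderiv (fun s => f (r * s)) (r * a).
Proof.
move=> r0 Tf e e0; have [d d0 P] := Tf (e / r) (divr_gt0 e0 r0).
exists (d / r) => [|s /andP[s0 sd]]; first exact: divr_gt0.
have := P (r * s); rewrite mulr_gt0 //= mulrC -ltr_pdivlMr // => /(_ sd).
have -> : e / r * (s * r) = e * s by field; rewrite gt_eqF.
by rewrite mulr0 [s * r]mulrC mulrA [r * a]mulrC.
Qed.

(** Adding the expansions at s and -s removes the linear term. *)
Lemma taylor2_min f b a d : taylor2 f b a -> 0 < d ->
  (forall s, `|s| < d -> f 0 <= f s) -> 0 <= a.
Proof.
move=> Tf d0 mf; rewrite leNgt; apply/negP => a0.
have e0 : 0 < - a / 2 by rewrite divr_gt0 // oppr_gt0.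
have [d' d'0 P] := Tf _ e0.
pose s := Num.min d d' / 2; have md : 0 < Num.min d d' by rewrite lt_min d0.
have s0 : 0 < s by rewrite divr_gt0.
have sm : s < Num.min d d' by rewrite ltr_pdivrMr // ltr_pMr // ltr1n.
move: (sm); rewrite lt_min => /andP[sd sd'].
have := P s; have := P (- s); rewrite normrN gtr0_norm // sqrrN !ler_norml.
move=> /(_ sd') /andP[_ h1] /(_ sd') /andP[_ h2].
have m1 := mf s; rewrite gtr0_norm // in m1.
have m2 := mf (- s); rewrite normrN gtr0_norm // in m2.
have {}m1 := m1 sd; have {}m2 := m2 sd.
have : a * s ^+ 2 < 0 by rewrite nmulr_rlt0 // exprn_gt0.
by move: h1 h2 m1 m2; lra.
Qed.

Lemma rderiv_min f a d : rderiv f a -> 0 < d ->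
  (forall s, 0 < s < d -> f 0 <= f s) -> 0 <= a.
Proof.
move=> Tf d0 mf; rewrite leNgt; apply/negP => a0.
have e0 : 0 < - a / 2 by rewrite divr_gt0 // oppr_gt0.
have [d' d'0 P] := Tf _ e0.
pose s := Num.min d d' / 2; have md : 0 < Num.min d d' by rewrite lt_min d0.
have s0 : 0 < s by rewrite divr_gt0.
have sm : s < Num.min d d' by rewrite ltr_pdivrMr // ltr_pMr // ltr1n.
move: (sm); rewrite lt_min => /andP[sd sd'].
have := P s; rewrite s0 sd' ler_norml => /(_ isT) /andP[_ h1].
have := mf s; rewrite s0 sd => /(_ isT) h2.
have : a * s < 0 by rewrite nmulr_rlt0.
by move: h1 h2; lra.
Qed.

End Taylor.

(** * Calculus rules for explicit functions of one variable *)

Section TaylorExamples.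
Variable R : realType.

Lemma rderiv_ext (f g : R -> R) (a d : R) : 0 < d ->
  (forall s, 0 <= s < d -> f s = g s) -> rderiv f a -> rderiv g a.
Proof.
move=> d0 fg Tf e e0; have [d' d'0 P] := Tf e e0.
exists (Num.min d d'); rewrite ?lt_min ?d0 // => s; rewrite lt_min => /and3P[s0 sd sd'].
rewrite -!fg ?lexx ?d0 // ?(ltW s0) //; exact/P/andP.
Qed.

Lemma taylor2_expR_quad (c c1 c2 : R) :
  taylor2 (fun s => c * expR (c1 * s + c2 * s ^+ 2)) (c * c1) (c * (c1 ^+ 2 / 2 + c2)).
Proof.
pose f' s := c * ((c1 + 2 * c2 * s) * expR (c1 * s + c2 * s ^+ 2)).
have e0 : c1 * 0 + c2 * 0 ^+ 2 = 0 by ring.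
have -> : c * c1 = f' 0 by rewrite /f' e0 expR0; ring.
apply: taylor2_is_derive; first exists 1 => // s _.
  by apply: is_derive_eq; rewrite /f' /GRing.scale /= !(mulr0,mulr1); ring.
by apply: is_derive_eq; rewrite /GRing.scale /= e0 expR0; field.
Qed.

Lemma is_derive_cast (f : R -> R) (x a b : R) : a = b -> is_derive x 1 f a -> is_derive x 1 f b.
Proof. by move=> ->. Qed.

Lemma is_derive_mulf (f g : R -> R) (x a b : R) : is_derive x 1 f a -> is_derive x 1 g b ->
  is_derive x 1 (fun s => f s * g s) (f x * b + g x * a).
Proof. by move=> df dg; exact: is_deriveM df dg. Qed.

Lemma is_derive_cmulf (c : R) (f : R -> R) (x a : R) : is_derive x 1 f a ->
  is_derive x 1 (fun s => c * f s) (c * a).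
Proof.
move=> df; apply: is_derive_cast (is_derive_mulf (is_derive_cst c x (1 : R)) df).
by rewrite mulr0 addr0.
Qed.

Lemma is_derive_addf (f g : R -> R) (x a b : R) : is_derive x 1 f a -> is_derive x 1 g b ->
  is_derive x 1 (fun s => f s + g s) (a + b).
Proof. by move=> df dg; exact: is_deriveD df dg. Qed.

Lemma is_derive_exprf (f : R -> R) n (x a : R) : is_derive x 1 f a ->
  is_derive x 1 (fun s => f s ^+ n) (n%:R * f x ^+ n.-1 * a).
Proof.
move=> df; elim: n => [|n IH].
  by under eq_fun do rewrite expr0; rewrite !mul0r; exact: is_derive_cst.
under eq_fun do rewrite exprS; apply: is_derive_cast (is_derive_mulf df IH).
case: n {IH} => [|n] /=; first by rewrite expr0; ring.
by rewrite -[n.+2%:R]natr1 exprS; ring.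
Qed.

Lemma is_derive_sumf (I : finType) (F : I -> R -> R) (x : R) (a : I -> R) :
  (forall i, is_derive x 1 (F i) (a i)) ->
  is_derive x 1 (fun s => \sum_i F i s) (\sum_i a i).
Proof.
move=> h; elim: (index_enum I) => [|i r IH].
  by under eq_fun do rewrite big_nil; rewrite big_nil; exact: is_derive_cst.
under eq_fun do rewrite big_cons; rewrite big_cons; exact: is_derive_addf (h i) IH.
Qed.

Lemma is_derive_expf (f : R -> R) (x a : R) : is_derive x 1 f a ->
  is_derive x 1 (fun s => expR (f s)) (expR (f x) * a).
Proof. move=> df; exact: (@is_derive1_comp _ expR f x _ _ (is_derive_expR _) df). Qed.

Lemma is_derive_subl (t x : R) : is_derive x 1 (fun s : R => t - s) (-1).
Proof. by apply: is_derive_eq; ring. Qed.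

End TaylorExamples.

(** * The Gaussian kernel is a subsolution *)

Section Kernel.
Variables (R : realType) (N : nat) (wt : 'I_N -> nat) (B : 'M[R]_N).
Hypothesis B_graded : forall k l, B k l != 0 -> wt l = (wt k).+2.
Hypothesis B_observable : forall v : 'cV[R]_N,
  (forall j k, wt k = 1 -> (B ^+ j *m v) k 0 = 0) -> v = 0.
Local Notation pt := ('cV[R]_N * R)%type.
Local Notation E := (drift_exp wt B).
Local Notation M := (Mmat wt B).
Local Notation P0 := (proj0 R wt).
Local Notation dil := (dilation wt).
Local Notation Q := (wtsum wt).

Lemma proj0_tr : P0^T = P0. Proof. exact: tr_diag_mx. Qed.

Lemma proj0E m (X : 'M[R]_(N, m)) k l : (P0 *m X) k l = (wt k == 1)%:R * X k l.
Proof. by rewrite mul_diag_mx !mxE. Qed.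

Lemma dilation_mxE m rho (X : 'M[R]_(N, m)) k l : (dil rho *m X) k l = rho ^+ wt k * X k l.
Proof. by rewrite mul_diag_mx !mxE. Qed.

(** For A = H H^T this says lam A_0 <= A <= Lam A_0 as quadratic forms, since |H^T w|^2 = <A w,
    w>. *)
Definition elliptic_frame (lam Lam : R) (H : 'M[R]_N) := forall w : 'cV[R]_N,
  lam * sqnorm (P0 *m w) <= sqnorm (H^T *m w) <= Lam * sqnorm (P0 *m w).

(* The equation [L_A v (z) = 0] with [A(z) = H H^T], tested on the lines in the
   direction of the columns of [H] and on the integral curve of the drift. *)
Definition solution_at (lam Lam : R) (v : pt -> R) (z : pt) :=
  exists2 H, elliptic_frame lam Lam H & exists b a : 'I_N -> R, exists e,
  [/\ forall j, taylor2 (fun s => v (z.1 + s *: col j H, z.2)) (b j) (a j),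
      rderiv (fun s => v (E (- s) *m z.1, z.2 - s)) e
    & \sum_j 2 * a j + e = 0].

Variables be ss : R.

Definition kphase (th : R) (y : 'cV[R]_N) : R :=
  - (ss * ln th) - be * qform M (dil (Num.sqrt th)^-1 *m y).

Definition kernel (ze z : pt) : R := let th := z.2 - ze.2 in
  if 0 < th then expR (kphase th (z.1 - E th *m ze.1)) else 0.

Lemma kernel_ge0 ze z : 0 <= kernel ze z.
Proof. by rewrite /kernel; case: ifP => // _; exact: expR_ge0. Qed.

Lemma is_derive_drift (y : 'cV[R]_N) k :
  is_derive (0 : R) 1 (fun s => (E (- s) *m y) k 0) ((B^T *m y) k 0).
Proof.
pose p := \poly_(j < Q.+1) ((B^T ^+ j *m y) k 0 / j`!%:R).
have -> : (fun s => (E (- s) *m y) k 0) = horner p.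
  apply/funext => s; rewrite /p horner_poly mulmx_suml summxE; apply: eq_bigr => j _.
  by rewrite opprK -scalemxAl mxE; ring.
apply: is_derive_eq; rewrite horner_coef0 coef_deriv coef_poly.
case: ifP => [_|/negbT]; first by rewrite expr1 -[1%N`!]/1%N divr1.
(* When Q = 0 the truncated series has only its constant term, and B^T vanishes as well. *)
rewrite -leqNgt ltnS leqn0 => /eqP Q0.
have -> : B^T = B^T ^+ 1 by [].
by rewrite (exp_tr_nilp B_graded) ?Q0 // mul0mx mxE mul0rn.
Qed.

Lemma is_derive_inv_sqrt (th : R) : 0 < th ->
  is_derive (0 : R) 1 (fun s => (Num.sqrt (th - s))^-1) ((Num.sqrt th)^-1 ^+ 3 / 2).
Proof.
move=> th0; have s0 : 0 < Num.sqrt th by rewrite sqrtr_gt0.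
have e0 : th - 0 = th by rewrite subr0.
have d2 : is_derive (th - 0) 1 Num.sqrt (2 * Num.sqrt th)^-1.
  by rewrite subr0; exact: is_derive1_sqrt.
have d3 := @is_derive1_comp R Num.sqrt (fun s => th - s) 0 _ _ d2 (is_derive_subl th 0).
have nz : Num.sqrt (th - 0) != 0 by rewrite subr0 gt_eqF.
have d4 : is_derive (0 : R) 1 (fun s => (Num.sqrt (th - s))^-1)
    (- (Num.sqrt (th - 0)) ^- 2 * ((2 * Num.sqrt th)^-1 * -1)).
  exact: (is_deriveV (f := fun s => Num.sqrt (th - s)) nz d3).
apply: is_derive_cast d4. by rewrite e0; field; rewrite gt_eqF.
Qed.

Hypothesis wt_gt0 : forall k, (0 < wt k)%N.

(** The dilation contributes half of [wtmx] and the drift contributes B^T; by homogeneity both carry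
    the same factor rho^2 = 1/th. *)
Lemma is_derive_dil_drift (th : R) (y : 'cV[R]_N) k (rho := (Num.sqrt th)^-1)
    (eta := dil rho *m y) : 0 < th ->
  is_derive (0 : R) 1 (fun s => (dil (Num.sqrt (th - s))^-1 *m (E (- s) *m y)) k 0)
    (rho ^+ 2 * ((B^T + 2^-1 *: wtmx R wt) *m eta) k 0).
Proof.
move=> th0; under eq_fun do rewrite dilationE.
have d1 := is_derive_exprf (wt k) (is_derive_inv_sqrt th0).
apply: is_derive_cast (is_derive_mulf d1 (is_derive_drift y k)).
rewrite /= [(th - 0 : R)%R]subr0 oppr0 drift_exp0 mul1mx -/rho mulmxDl.
set BTy := B^T *m y.
have -> : B^T *m eta = rho ^- 2 *: (dil rho *m (B^T *m y)).
  have := dilation_trX B_graded rho 1; rewrite expr1 muln1 mulmxA => ->.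
  rewrite -scalemxAl scalerA mulVf ?scale1r -?mulmxA // expf_neq0 // invr_neq0 //.
  by rewrite gt_eqF // sqrtr_gt0.
rewrite [X in _ = _ * X]mxE [X in _ = _ * (X + _)]mxE dilationE -scalemxAl.
rewrite [X in _ = _ * (_ + X)]mxE mul_diag_mx [X in _ = _ * (_ + _ * X)]mxE dilationE.
rewrite [(\row__ _) 0 k]mxE.
have r0 : rho != 0 by rewrite invr_neq0 // gt_eqF // sqrtr_gt0.
have -> : rho ^+ wt k = rho * rho ^+ (wt k).-1 by rewrite -exprS prednK.
by field.
Qed.

(** The derivative of the quadratic form is the symmetrized product that [riccati] turns into |A_0 M
    eta|^2. *)
Lemma is_derive_kphase (th : R) (y : 'cV[R]_N) (rho := (Num.sqrt th)^-1)
    (eta := dil rho *m y) : 0 < th ->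
  is_derive (0 : R) 1 (fun s => kphase (th - s) (E (- s) *m y))
    (ss / th - be * (rho ^+ 2 * sqnorm (P0 *m (M *m eta)))).
Proof.
move=> th0; pose et s := dil (Num.sqrt (th - s))^-1 *m (E (- s) *m y).
have et0 : et 0 = eta by rewrite /et [(th - 0 : R)%R]subr0 oppr0 drift_exp0 mul1mx.
set D := (B^T + 2^-1 *: wtmx R wt) *m eta.
have dl : is_derive (0 : R) 1 (fun s => ln (th - s)) (th^-1 * -1).
  have d2 : is_derive (th - 0) 1 (@ln R) th^-1 by rewrite subr0; exact: is_derive1_ln.
  exact: (@is_derive1_comp R (@ln R) (fun s => th - s) 0 _ _ d2 (is_derive_subl th 0)).
have dq : is_derive (0 : R) 1 (fun s => qform M (et s))
   (\sum_i \sum_j M i j * (rho ^+ 2 * (eta i 0 * D j 0 + eta j 0 * D i 0))).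
  under eq_fun do rewrite qform_sum.
  apply: is_derive_sumf => i; apply: is_derive_sumf => j.
  have d1 := is_derive_mulf (is_derive_dil_drift y i th0) (is_derive_dil_drift y j th0).
  have d2 := is_derive_cmulf (M i j) d1.
  under eq_fun do rewrite -mulrA.
  apply: is_derive_cast d2; rewrite /= -/(et 0) et0 -/rho -/eta -/D /=; ring.
have d3 := is_derive_addf (is_derive_cmulf (- ss) dl) (is_derive_cmulf (- be) dq).
have -> : (fun s => kphase (th - s) (E (- s) *m y)) =
   (fun s => - ss * ln (th - s) + (- be) * qform M (et s)).
  by apply/funext => s; rewrite /kphase mulNr mulNr.
apply: is_derive_cast d3; rewrite /=.
have -> : \sum_i \sum_j M i j * (rho ^+ 2 * (eta i 0 * D j 0 + eta j 0 * D i 0)) =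
   rho ^+ 2 * sqnorm (P0 *m (M *m eta)); last by rewrite mulrN1 mulrNN mulNr.
have -> : sqnorm (P0 *m (M *m eta)) = (eta^T *m (M *m P0 *m M) *m eta) 0 0.
  rewrite sqnormE !trmx_mul Mmat_tr proj0_tr -!mulmxA.
  by rewrite (mulmxA P0 P0) proj0_idem.
rewrite -(riccati B_graded B_observable) mulmxDr mulmxDl mxE.
have bf (u v : 'cV[R]_N) : (u^T *m M *m v) 0 0 = \sum_i \sum_j M i j * u i 0 * v j 0.
  rewrite mxE exchange_big; apply: eq_bigr => j _.
  rewrite mxE big_distrl /=; apply: eq_bigr => i _; rewrite mxE; ring.
have -> : eta^T *m ((B + 2^-1 *: wtmx R wt) *m M) *m eta = D^T *m M *m eta.
  have -> : B + 2^-1 *: wtmx R wt = (B^T + 2^-1 *: wtmx R wt)^T.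
    by rewrite [RHS]linearD /= linearZ /= trmxK tr_diag_mx.
  by rewrite [D^T]trmx_mul !mulmxA.
rewrite [eta^T *m (M *m _)]mulmxA -[eta^T *m M *m _ *m eta]mulmxA -/D !bf -big_split mulr_sumr.
apply: eq_bigr => i _; rewrite -big_split mulr_sumr; apply: eq_bigr => j _ /=; ring.
Qed.

Variables lam Lam : R.
Hypothesis lam_gt0 : 0 < lam.
Hypothesis Lam_gt0 : 0 < Lam.
Hypothesis be_gt0 : 0 < be.
Hypothesis be_lam : be * 4 * lam = 1.
Hypothesis ss_ge : 2 * be * Lam * Q%:R <= ss.

(** The sum is the trace of A against the rescaled M. With M = L L^T it becomes a sum over the
    columns of dil L, to each of which ellipticity applies; [trace_proj0_Mmat] then yields Q. *)
Lemma sum_qform_frame_le H rho : elliptic_frame lam Lam H ->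
  \sum_j qform M (dil rho *m col j H) <= Lam * (rho ^+ 2 * Q%:R).
Proof.
move=> eH; have [L eL] := psd_cholesky (Mmat_tr wt B) (Mmat_ge0 B_graded B_observable).
pose K := dil rho *m L.
have -> : \sum_j qform M (dil rho *m col j H) = \sum_l sqnorm (H^T *m col l K).
  rewrite exchange_big /=; apply: eq_bigr => j _; rewrite eL qform_gram /sqnorm.
  apply: eq_bigr => l _; congr (_ ^+ 2); rewrite mulmxA.
  have -> : L^T *m dil rho = K^T by rewrite trmx_mul tr_diag_mx.
  by rewrite !mxE; apply: eq_bigr => i _; rewrite !mxE mulrC.
rewrite -(trace_proj0_Mmat B_graded B_observable).
apply: (@le_trans _ _ (\sum_l Lam * sqnorm (P0 *m col l K))).
  by apply: ler_sum => l _; have /andP[] := eH (col l K).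
rewrite -mulr_sumr ler_pM2l // le_eqVlt; apply/orP; left; apply/eqP.
rewrite /sqnorm exchange_big /mxtrace mulr_sumr; apply: eq_bigr => k _.
rewrite proj0E eL mxE mulr_sumr mulr_sumr; apply: eq_bigr => l _.
rewrite proj0E [col l K _ _]mxE dilation_mxE [L^T _ _]mxE.
by case: eqP => [->|_]; rewrite ?expr1 /=; ring.
Qed.

(** The square of the gradient compensates the Riccati term, since 4 be lam = 1, and ss / th pays
    for the trace, since ss >= 2 be Lam Q. *)
Lemma kernel_subsolution H (ze z : pt) : elliptic_frame lam Lam H ->
  exists b a : 'I_N -> R, exists e,
  [/\ forall j, taylor2 (fun s => kernel ze (z.1 + s *: col j H, z.2)) (b j) (a j),
      rderiv (fun s => kernel ze (E (- s) *m z.1, z.2 - s)) e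
    & 0 <= \sum_j 2 * a j + e].
Proof.
move=> eH; rewrite /kernel /=; have [th0|th0] := ltP 0 (z.2 - ze.2); last first.
  (* Up to the time of the pole the kernel vanishes on the lines and on the drift curve, which runs
     into the past. *)
  exists (fun=> 0), (fun=> 0), 0; split.
  - by move=> j; exact: taylor2_cst.
  - apply: (rderiv_ext (@ltr01 R) _ (rderiv_cst 0)) => s /andP[s0 _].
    by rewrite ltNge; case: leP => //; move: th0 s0; lra.
  - by rewrite addr0 sumr_ge0 // => j _; rewrite mulr0.
set th := z.2 - ze.2 in th0 *; set y := z.1 - E th *m ze.1.
set rho := (Num.sqrt th)^-1; set eta := dil rho *m y.
have rho2 : rho ^+ 2 = th^-1 by rewrite exprVn sqr_sqrtr // ltW.
set G := expR (kphase th y); have G0 : 0 < G by exact: expR_gt0.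
set W := dil rho *m (M *m eta).
(* Half the derivative of the quadratic form along the j-th column of H. *)
pose be1 j := ((col j H)^T *m W) 0 0; pose A j := qform M (dil rho *m col j H).
exists (fun j => G * (- 2 * be * be1 j)), (fun j => G * ((- 2 * be * be1 j) ^+ 2 / 2 + - be * A j)).
exists (G * (ss / th - be * (rho ^+ 2 * sqnorm (P0 *m (M *m eta))))); split.
- move=> j.
  have -> : (fun s => expR (kphase th (z.1 + s *: col j H - E th *m ze.1))) =
     (fun s => G * expR ((- 2 * be * be1 j) * s + - be * A j * s ^+ 2)).
    apply/funext => s; rewrite -expRD; congr expR; rewrite /kphase -/rho.
    have -> : dil rho *m (z.1 + s *: col j H - E th *m ze.1) = eta + s *: (dil rho *m col j H).
      by rewrite /eta scalemxAr -mulmxDr /y addrAC.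
    rewrite qform_line -/eta.
    have e1 : ((dil rho *m col j H)^T *m M *m eta) 0 0 = be1 j.
      by rewrite trmx_mul tr_diag_mx -!mulmxA.
    have -> : (eta^T *m M *m (dil rho *m col j H)) 0 0 = be1 j.
      have -> : eta^T *m M *m (dil rho *m col j H) = ((dil rho *m col j H)^T *m M *m eta)^T.
        rewrite [RHS]trmx_mul [X in _ = _ *m X]trmx_mul trmxK Mmat_tr.
        exact: esym (mulmxA _ _ _).
      by rewrite mxE e1.
    by rewrite e1 -/(A j); ring.
  exact: taylor2_expR_quad.
- have d := is_derive_kphase y th0.
  have := rderiv_is_derive (is_derive_expf d).
  rewrite /= -/rho -/eta oppr0 drift_exp0 mul1mx [(th + 0 : R)%R]addr0 -/G.
  apply: (rderiv_ext th0) => s /andP[s0 sth].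
  have -> : z.2 - s - ze.2 = th - s by rewrite /th; ring.
  rewrite subr_gt0 sth; congr (expR (kphase _ _)).
  by rewrite mulmxBr mulmxA -(drift_expD B_graded) [(- s + th)%R]addrC.
have S1 : lam * rho ^+ 2 * sqnorm (P0 *m (M *m eta)) <= \sum_j be1 j ^+ 2.
  have -> : \sum_j be1 j ^+ 2 = sqnorm (H^T *m W).
    by apply: eq_bigr => j _; congr (_ ^+ 2); rewrite /be1 tr_col -row_mul mxE.
  have /andP[h _] := eH W; apply: le_trans h; rewrite -mulrA ler_pM2l //.
  rewrite le_eqVlt; apply/orP; left; apply/eqP.
  rewrite /sqnorm mulr_sumr; apply: eq_bigr => k _.
  rewrite !proj0E dilation_mxE.
  by case: eqP => [->|_]; rewrite ?expr1 /=; ring.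
have S2 := sum_qform_frame_le rho eH; rewrite -/A in S2.
have -> : \sum_j 2 * (G * ((- 2 * be * be1 j) ^+ 2 / 2 + - be * A j)) =
   G * (4 * be ^+ 2 * (\sum_j be1 j ^+ 2) - 2 * be * \sum_j A j).
  rewrite mulrBr !mulr_sumr -sumrB; apply: eq_bigr => j _; by field.
rewrite -mulrDr mulr_ge0 ?(ltW G0) //.
set X := \sum_j be1 j ^+ 2 in S1 *; set Y := \sum_j A j in S2 *.
set V := sqnorm _ in S1 *.
have h1 : be * (rho ^+ 2 * V) <= 4 * be ^+ 2 * X.
  have -> : be * (rho ^+ 2 * V) = 4 * be ^+ 2 * (lam * rho ^+ 2 * V).
    transitivity (be * 4 * lam * (be * (rho ^+ 2 * V))); last by ring.
    by rewrite be_lam mul1r.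
  by rewrite ler_pM2l // mulr_gt0 // exprn_gt0.
have h2 : 2 * be * Y <= ss / th.
  apply: (@le_trans _ _ (2 * be * (Lam * (rho ^+ 2 * Q%:R)))).
    by rewrite ler_pM2l // mulr_gt0.
  rewrite rho2 ler_pdivlMr //; apply: le_trans ss_ge.
  rewrite le_eqVlt; apply/orP; left; apply/eqP; field.
  by rewrite gt_eqF.
by move: h1 h2; lra.
Qed.

End Kernel.

(** * Sup norm estimates and the maximum of th^-s e^(-A/th) *)

Section SupNorm.
Variable R : realType.

Lemma coord_le_norm m n (A : 'M[R]_(m, n)) i j : `|A i j| <= `|A|.
Proof.
rewrite [leRHS]mx_normrE; exact: (le_bigmax _ (fun ij => `|A ij.1 ij.2|) (i, j)).
Qed.

Lemma norm_le_coord m n (A : 'M[R]_(m, n)) (r : R) : 0 <= r ->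
  (forall i j, `|A i j| <= r) -> `|A| <= r.
Proof. by move=> r0 h; rewrite [leLHS]mx_normrE; apply: bigmax_le => // -[i j] _. Qed.

Lemma norm_coordP n (x : 'cV[R]_n) (r : R) : 0 < r -> r <= `|x| ->
  exists k, r <= `|x k 0|.
Proof.
move=> r0 rx; have /mx_norm_neq0[[k j] /= e] : mx_norm x != 0.
  by rewrite gt_eqF // (lt_le_trans r0).
by exists k; rewrite -(ord1 j) -e.
Qed.

Lemma norm_mulmx_le m n (A : 'M[R]_(m, n)) (x : 'cV[R]_n) :
  `|A *m x| <= (\sum_i \sum_j `|A i j|) * `|x|.
Proof.
have s0 i : 0 <= \sum_j `|A i j| by apply: sumr_ge0.
apply: norm_le_coord => [|i j]; first by rewrite mulr_ge0 // sumr_ge0.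
rewrite (ord1 j) mxE (le_trans (ler_norm_sum _ _ _)) //.
apply: (@le_trans _ _ ((\sum_j `|A i j|) * `|x|)).
  rewrite mulr_suml; apply: ler_sum => k _.
  by rewrite normrM ler_wpM2l // coord_le_norm.
by rewrite ler_wpM2r // (bigD1 i) //= lerDl sumr_ge0.
Qed.

Lemma qform_le n (A : 'M[R]_n) : A^T = A -> (forall v, 0 <= qform A v) ->
  exists2 c, 0 < c & forall v, qform A v <= c * sqnorm v.
Proof.
move=> symA psd; have [L eL] := psd_cholesky symA psd.
have S0 : 0 <= \sum_i sqnorm (row i L^T)^T by apply: sumr_ge0 => i _; exact: sqnorm_ge0.
exists (1 + \sum_i sqnorm (row i L^T)^T) => [|v]; first by rewrite ltr_wpDr.
rewrite eL qform_gram (le_trans (sqnorm_mulmx_le _ _)) //.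
by rewrite ler_wpM2r ?sqnorm_ge0 // lerDr.
Qed.

Lemma sqnorm_le_norm n (v : 'cV[R]_n) : sqnorm v <= n%:R * `|v| ^+ 2.
Proof.
rewrite /sqnorm -[n in n%:R]card_ord -sum1_card natr_sum mulr_suml.
apply: ler_sum => k _; rewrite mul1r -real_normK ?num_real //.
by rewrite lerXn2r ?nnegrE // coord_le_norm.
Qed.

Definition gaussian_bound (s A : R) : R := expR (s * (ln s - ln A) - s).

(* The maximum over [th > 0] of [th^-s e^(-A/th)], attained at [th = A/s]. *)
Lemma le_gaussian_bound (s A th : R) : 0 < s -> 0 < A -> 0 < th ->
  expR (- (s * ln th) - A / th) <= gaussian_bound s A.
Proof.
move=> s0 A0 th0; rewrite ler_expR; have := expR_ge1Dx (ln (A / (s * th))).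
rewrite lnK ?posrE ?divr_gt0 ?mulr_gt0 // ln_div ?posrE ?mulr_gt0 // lnM ?posrE //.
move=> h; have := ler_wpM2l (ltW s0) h.
have -> : s * (A / (s * th)) = A / th by field; rewrite !gt_eqF.
lra.
Qed.

Lemma gaussian_bound_le_eps (s e : R) : 0 < s -> 0 < e ->
  exists2 A0, 0 < A0 & forall A, A0 <= A -> gaussian_bound s A <= e.
Proof.
(* The witness solves s (ln s - ln A) = ln e; the remaining factor e^(-s) is below 1. *)
move=> s0 e0; exists (expR (ln s - ln e / s)) => [|A hA]; first exact: expR_gt0.
have A0 : 0 < A by apply: lt_le_trans hA; exact: expR_gt0.
rewrite -[leRHS]lnK ?posrE // ler_expR.
have : ln s - ln e / s <= ln A by rewrite -ler_expR lnK.
move=> /(ler_wpM2l (ltW s0)); rewrite mulrBr mulrCA divff ?gt_eqF // mulr1.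
move: s0; lra.
Qed.

End SupNorm.

(** * Upper and lower bounds for the kernel *)

Section KernelBounds.
Variables (R : realType) (N : nat) (wt : 'I_N -> nat) (B : 'M[R]_N).
Hypothesis B_graded : forall k l, B k l != 0 -> wt l = (wt k).+2.
Hypothesis B_observable : forall v : 'cV[R]_N,
  (forall j k, wt k = 1 -> (B ^+ j *m v) k 0 = 0) -> v = 0.
Hypothesis wt_gt0 : forall k, (0 < wt k)%N.
Variables be ss : R.
Hypothesis be_gt0 : 0 < be.
Hypothesis ss_gt0 : 0 < ss.
Local Notation pt := ('cV[R]_N * R)%type.
Local Notation E := (drift_exp wt B).
Local Notation M := (Mmat wt B).
Local Notation dil := (dilation wt).
Local Notation kernel := (kernel wt B be ss).

(** The range 4 exceeds the time span 7/2 of the boxes used for comparison. *)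
Lemma drift_exp_bound : exists2 c, 1 <= c & forall s (x : 'cV[R]_N), `|s| <= 4 ->
  `|E s *m x| <= c * `|x| /\ `|E s *m x - x| <= c * `|s| * `|x|.
Proof.
pose K := \sum_(j < wtsum wt) 4 ^+ j * \sum_k \sum_l `|(B^T ^+ j.+1) k l|.
have K0 : 0 <= K.
  by apply: sumr_ge0 => j _; rewrite mulr_ge0 ?exprn_ge0 // sumr_ge0 // => k _; exact: sumr_ge0.
have diff s (x : 'cV[R]_N) : `|s| <= 4 -> `|E s *m x - x| <= K * `|s| * `|x|.
  move=> s4; rewrite /drift_exp big_ord_recl /= !expr0 fact0 divr1 scale1r mulmxDl mul1mx.
  rewrite addrC addKr mulmx_suml (le_trans (ler_norm_sum _ _ _)) //.
  rewrite !mulr_suml; apply: ler_sum => j _; rewrite -scalemxAl normrZ.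
  rewrite [leRHS](_ : _ = 4 ^+ j * `|s| * ((\sum_k \sum_l `|(B^T ^+ j.+1) k l|) * `|x|)); last by ring.
  apply: ler_pM => //; last exact: norm_mulmx_le.
  rewrite normrM normrV ?unitfE ?pnatr_eq0 -?lt0n ?fact_gt0 // normr_nat normrX normrN exprSr.
  have f1 : (1 : R) <= (lift ord0 j)`!%:R by rewrite ler1n fact_gt0.
  rewrite ler_pdivrMr ?(lt_le_trans _ f1) //.
  rewrite (le_trans (ler_wpM2r _ (_ : `|s| ^+ j <= 4 ^+ j))) ?lerXn2r ?nnegrE //.
  by rewrite ler_peMr // mulr_ge0 ?exprn_ge0.
exists (1 + 4 * K) => [|s x s4]; first by rewrite lerDl mulr_ge0.
have h := diff s x s4; split.
  rewrite -[E s *m x](subrK x) (le_trans (ler_normD _ _)) //.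
  rewrite mulrDl mul1r [leRHS]addrC lerD2r (le_trans h) // ler_wpM2r // mulrC ler_wpM2r //.
rewrite (le_trans h) // ler_wpM2r // ler_wpM2r //; move: K0; lra.
Qed.

(** Dilations conjugate E(th) into E(1), so a single coercivity constant, that of E(1)^T M E(1),
    serves for all th. *)
Lemma qform_drift_coercive : exists2 c, 0 < c & forall th (xi : 'cV[R]_N), 0 < th ->
  c * (\sum_k xi k 0 ^+ 2 / th ^+ wt k) <= qform M (dil (Num.sqrt th)^-1 *m (E th *m xi)).
Proof.
have EE s t : E (s + t) = E s *m E t by exact: (drift_expD B_graded).
pose A := (E 1)^T *m M *m E 1.
have qA v : qform A v = qform M (E 1 *m v) by rewrite /qform trmx_mul !mulmxA.
have [||v|c c0 cP] := @qform_coercive R N A.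
- by rewrite /A !trmx_mul trmxK Mmat_tr mulmxA.
- by move=> v; rewrite qA Mmat_ge0.
- rewrite qA => /(Mmat_def B_graded B_observable) /(congr1 (mulmx (E (- 1)))).
  by rewrite mulmxA -EE addNr drift_exp0 mul1mx mulmx0.
exists c => // th xi th0.
have s0 : 0 < Num.sqrt th by rewrite sqrtr_gt0.
have -> : dil (Num.sqrt th)^-1 *m (E th *m xi) = E 1 *m (dil (Num.sqrt th)^-1 *m xi).
  rewrite !mulmxA (dilation_drift_exp B_graded) exprVn sqr_sqrtr ?(ltW th0) //.
  by rewrite mulVf // gt_eqF.
rewrite -qA; apply: le_trans (cP _); rewrite ler_pM2l // le_eqVlt; apply/orP; left; apply/eqP.
apply: eq_bigr => k _; rewrite dilationE exprMn mulrC; congr (_ * _).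
by rewrite -exprM mulnC exprM exprVn sqr_sqrtr ?exprVn // ltW.
Qed.

(** The offset E(-th) x - y is carried back along the drift to the time of the pole. In these
    coordinates the exponent is a sum over coordinates, so Gaussian sums over a lattice factor. *)
Lemma kernel_le : exists2 c, 0 < c & forall (ze z : pt), 0 < z.2 - ze.2 ->
  kernel ze z <= expR (- (ss * ln (z.2 - ze.2)) -
    c * (\sum_k ((E (- (z.2 - ze.2)) *m z.1) k 0 - ze.1 k 0) ^+ 2 / (z.2 - ze.2) ^+ wt k)).
Proof.
have [c c0 cP] := qform_drift_coercive.
exists (be * c) => [|ze z th0]; first exact: mulr_gt0.
rewrite /kernel th0 ler_expR /kphase lerD2l lerN2 -mulrA ler_pM2l //.
set th := z.2 - ze.2 in th0 *.
have := cP th (E (- th) *m z.1 - ze.1) th0.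
rewrite [E th *m _]mulmxBr mulmxA drift_expNK // mul1mx => h.
apply: le_trans h; rewrite ler_pM2l // le_eqVlt; apply/orP; left; apply/eqP.
by apply: eq_bigr => k _; rewrite !mxE.
Qed.

Lemma kernel_ge (Y : R) : exists2 c1, 0 < c1 & forall (ze z : pt),
  `|z.1| <= Y -> `|ze.1| <= Y -> 1 <= z.2 - ze.2 <= 4 -> c1 <= kernel ze z.
Proof.
have [CE CE1 CEP] := drift_exp_bound.
have [C C0 CP] := qform_le (Mmat_tr wt B) (Mmat_ge0 B_graded B_observable).
pose D := C * (N%:R * (Y + CE * Y) ^+ 2).
exists (expR (- (ss * 4) - be * D)) => [|ze z zY zeY /andP[th1 th4]]; first exact: expR_gt0.
have Y0 : 0 <= Y by apply: le_trans zY.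
rewrite /kernel /=; set th := z.2 - ze.2 in th1 th4 *.
have th0 : 0 < th by exact: lt_le_trans ltr01 th1.
rewrite th0 ler_expR /kphase; apply: lerB.
  rewrite lerN2 ler_pM2l // (le_trans _ th4) // ltW // ln_sublinear //.
rewrite ler_pM2l // (le_trans (CP _)) // ler_pM2l //.
apply: le_trans (sqnorm_le_norm _) _; rewrite ler_wpM2l ?ler0n // lerXn2r ?nnegrE //.
  by rewrite addr_ge0 // mulr_ge0 // (le_trans _ CE1).
apply: norm_le_coord => [|k j]; first by rewrite addr_ge0 // mulr_ge0 // (le_trans _ CE1).
rewrite (ord1 j) dilationE normrM.
have rho1 : `|(Num.sqrt th)^-1| <= 1.
  rewrite ger0_norm ?invr_ge0 ?sqrtr_ge0 // invf_le1 ?sqrtr_gt0 //.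
  by rewrite -[leLHS]sqrtr1 ler_wsqrtr.
rewrite normrX (@le_trans _ _ (1 * `|(z.1 - E th *m ze.1) k 0|)) //.
  by rewrite ler_wpM2r // exprn_ile1.
rewrite mul1r (le_trans (coord_le_norm _ _ _)) // (le_trans (ler_normB _ _)) // lerD //.
have [|h _] := CEP th ze.1; first by rewrite gtr0_norm.
by apply: le_trans h _; rewrite ler_wpM2l // (le_trans _ CE1).
Qed.

(** Only one coordinate at least r in absolute value is kept, and th <= 4 gives th^wt <= 4^Q th,
    which reduces every weight to one. *)
Lemma kernel_le_far : exists2 c, 0 < c & forall (ze z : pt) r,
  0 < z.2 - ze.2 <= 4 -> 0 <= r <= `|E (- (z.2 - ze.2)) *m z.1 - ze.1| ->
  kernel ze z <= expR (- (ss * ln (z.2 - ze.2)) - c * r ^+ 2 / (z.2 - ze.2)).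
Proof.
have [c c0 cP] := kernel_le; pose K : R := 4 ^+ wtsum wt.
have K0 : 0 < K by exact: exprn_gt0.
exists (c / K) => [|ze z r /andP[th0 th4] /andP[r0 rx]]; first exact: divr_gt0.
apply: le_trans (cP _ _ th0) _; rewrite ler_expR lerD2l lerN2.
move: rx; set x := _ - ze.1; set th := z.2 - ze.2 in th0 th4 *.
have -> : \sum_k ((E (- th) *m z.1) k 0 - ze.1 k 0) ^+ 2 / th ^+ wt k =
  \sum_k x k 0 ^+ 2 / th ^+ wt k by apply: eq_bigr => k _; rewrite !mxE.
have pos k : 0 <= x k 0 ^+ 2 / th ^+ wt k by rewrite divr_ge0 ?sqr_ge0 // exprn_ge0 // ltW.
move=> rx; have [r0'|rn] := ltP 0 r; last first.
  have -> : r = 0 by apply/eqP; rewrite eq_le rn r0.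
  by rewrite expr0n /= mulr0 mul0r mulr_ge0 ?(ltW c0) // sumr_ge0.
have [k rk] := norm_coordP r0' rx.
rewrite (bigD1 k) //= mulrDr (@le_trans _ _ (c * (x k 0 ^+ 2 / th ^+ wt k))) //; last first.
  by rewrite lerDl mulr_ge0 ?(ltW c0) // sumr_ge0.
have -> : c / K * r ^+ 2 / th = c * (r ^+ 2 * (K * th)^-1).
  by field; rewrite !gt_eqF.
rewrite ler_pM2l // ler_pM ?sqr_ge0 //.
- by rewrite invr_ge0 mulr_ge0 ?(ltW th0) ?(ltW K0).
- by rewrite -[x k 0 ^+ 2]real_normK ?num_real // lerXn2r ?nnegrE.
rewrite lef_pV2 ?posrE ?exprn_gt0 ?mulr_gt0 //.
rewrite -(prednK (wt_gt0 k)) exprSr ler_pM2r //.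
apply: (@le_trans _ _ (4 ^+ (wt k).-1)); first by rewrite lerXn2r ?nnegrE // ltW.
by rewrite ler_weXn2l ?ler1n // (leq_trans (leq_pred _)) // wt_le_sum.
Qed.

(** This fixes the width of the boxes. As E(th) has bounded norm, E(-th) x is far from the pole
    whenever x is, and there the Gaussian factor beats th^-ss uniformly in th. *)
Lemma kernel_lateral (Y e : R) : 0 <= Y -> 0 < e -> exists2 R0, Y < R0 & forall (ze z : pt),
  `|ze.1| <= Y -> R0 <= `|z.1| -> z.2 - ze.2 <= 4 -> kernel ze z <= e.
Proof.
move=> Y0 e0; have [CE CE1 CEP] := drift_exp_bound.
have [c c0 cP] := kernel_le_far.
have [A0 A00 A0P] := gaussian_bound_le_eps ss_gt0 e0.
(* Since (1 + a)^2 >= a, the exponent c r^2 is at least A0. *)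
pose r := 1 + A0 / c; have r0 : 0 <= r by rewrite addr_ge0 // divr_ge0 // ltW.
have CE0 : 0 < CE by exact: lt_le_trans ltr01 CE1.
exists (CE * (r + Y) + Y + 1) => [|ze z zeY zR th4].
  have : 0 <= CE * (r + Y) by apply: mulr_ge0; [exact: ltW|exact: addr_ge0].
  lra.
have [th0|th0] := ltP 0 (z.2 - ze.2); last by rewrite /kernel ltNge th0 /= ltW.
set th := z.2 - ze.2 in th0 th4 *.
have rx : r <= `|E (- th) *m z.1 - ze.1|.
  have [|h _] := CEP th (E (- th) *m z.1); first by rewrite gtr0_norm.
  rewrite mulmxA drift_expNK // mul1mx in h.
  have h2 : r + Y <= `|E (- th) *m z.1|.
    rewrite -(ler_pM2l CE0) (le_trans _ h) //; move: zR Y0; lra.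
  by have := lerB_dist (E (- th) *m z.1) ze.1; move: h2 zeY; lra.
have := cP ze z r; rewrite -/th th0 th4 r0 rx => /(_ isT isT) /le_trans; apply.
apply: le_trans (le_gaussian_bound ss_gt0 _ th0) _.
  by rewrite mulr_gt0 // exprn_gt0 // ltr_wpDr // divr_ge0 // ltW.
apply: A0P; have -> : A0 = c * (A0 / c) by field; rewrite gt_eqF.
rewrite ler_pM2l // /r; have : 0 <= A0 / c by rewrite divr_ge0 // ltW.
move: (A0 / c) => a a0; rewrite expr2; nra.
Qed.

(** The Gaussian maximum is taken with the exponent ss + 1, which leaves one factor th over. It
    yields continuity at the time of the pole. *)
Lemma kernel_le_linear (A : R) : 0 < A -> exists2 K, 0 < K & forall (ze z : pt),
  0 < z.2 - ze.2 <= 4 -> A <= `|E (- (z.2 - ze.2)) *m z.1 - ze.1| ->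
  kernel ze z <= K * (z.2 - ze.2).
Proof.
move=> A0; have [c c0 cP] := kernel_le_far.
exists (gaussian_bound (ss + 1) (c * A ^+ 2)) => [|ze z th04 Ax]; first exact: expR_gt0.
have th0 : 0 < z.2 - ze.2 by case/andP: th04.
have := cP ze z A th04; rewrite Ax ltW // => /(_ isT) /le_trans; apply.
set th := _ - _ in th0 *.
have -> : - (ss * ln th) - c * A ^+ 2 / th = - ((ss + 1) * ln th) - c * A ^+ 2 / th + ln th.
  ring.
rewrite expRD lnK ?posrE // ler_pM2r //; apply: le_gaussian_bound => //.
- by rewrite addr_gt0.
- by rewrite mulr_gt0 // exprn_gt0.
Qed.

End KernelBounds.

(** * Compactness and uniform continuity on space-time boxes *)

Section SpaceTime.
Variables (R : realType) (N : nat).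
Local Notation pt := ('cV[R]_N * R)%type.

Lemma near_ptP (z : pt) (P : pt -> Prop) : (\forall x \near z, P x) <->
  exists2 e, 0 < e & forall x, `|x.1 - z.1| < e -> `|x.2 - z.2| < e -> P x.
Proof.
split.
  move=> /nbhs_normP[e /= e0 eP]; exists e => // x x1 x2; apply: eP => /=.
  by rewrite distrC prod_normE /= gt_max x1 x2.
move=> [e e0 eP]; apply/nbhs_normP; exists e => //= x /=.
by rewrite /ball_ /= distrC prod_normE /= gt_max => /andP[x1 x2]; exact: eP.
Qed.

Lemma continuous_ptP (f : pt -> R) (z : pt) : {for z, continuous f} <->
  forall e, 0 < e -> exists2 d, 0 < d &
    forall x, `|x.1 - z.1| < d -> `|x.2 - z.2| < d -> `|f x - f z| <= e.
Proof.
split=> [/cvgrPdist_le cf e e0|h].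
  have /near_ptP[d d0 dP] := cf e e0.
  by exists d => // x x1 x2; rewrite distrC; exact: dP.
apply/cvgrPdist_le => e e0; apply/near_ptP; have [d d0 dP] := h e e0.
by exists d => // x x1 x2; rewrite distrC; exact: dP.
Qed.

Definition box (r s t : R) : set pt := [set z | `|z.1| <= r /\ s <= z.2 <= t].

Lemma trmx_rV_continuous : continuous (trmx : 'rV[R]_N -> 'cV[R]_N).
Proof.
move=> x.
apply: (@cvgrPdist_le R 'cV[R]_N 'rV[R]_N (nbhs x) (nbhs_filter x) trmx x^T).2 => e e0.
apply: filterS (nbhsx_ballx x e e0) => y; rewrite mx_norm_ball /ball_ /= => xy.
apply: norm_le_coord => [|i j]; first exact: ltW.
rewrite (_ : (x^T - y^T) i j = (x - y) j i); last by rewrite !mxE.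
by rewrite (le_trans (coord_le_norm _ _ _)) // ltW.
Qed.

(** The cube is a product of segments in the space of row vectors, and transposition carries it to
    columns. *)
Lemma box_compact r s t : compact (box r s t).
Proof.
have c1 : compact [set x : 'cV[R]_N | `|x| <= r].
  have [r0|r0] := ltP r 0.
    have -> : [set x : 'cV[R]_N | `|x| <= r] = set0; last exact: compact0.
    by apply/seteqP; split => // x /= xr; have := le_lt_trans (le_trans (normr_ge0 _) xr) r0; rewrite ltxx.
  have -> : [set x : 'cV[R]_N | `|x| <= r]
     = trmx @` [set x : 'rV[R]_N | forall i, x ord0 i \in `[- r, r]].
    apply/seteqP; split => [x /= xr|_ [x /= xr <-]].
      exists x^T; last by rewrite trmxK.
      by move=> i /=; rewrite mxE in_itv /= -ler_norml (le_trans (coord_le_norm _ _ _)).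
    apply: norm_le_coord => // i j; rewrite mxE (ord1 j).
    by have := xr i; rewrite in_itv /= -ler_norml.
  apply: continuous_compact; last exact: (rV_compact (fun=> @segment_compact R (- r) r)).
  exact/continuous_subspaceT/trmx_rV_continuous.
have -> : box r s t = [set x : 'cV[R]_N | `|x| <= r] `*` `[s, t]%classic.
  by apply/seteqP; split => z; rewrite /box /= in_itv.
exact: compact_setX c1 (@segment_compact R s t).
Qed.

Lemma sublevel_box_compact r s t (v : pt -> R) (c : R) :
  (forall z, box r s t z -> {for z, continuous v}) ->
  compact [set z | box r s t z /\ v z <= c].
Proof.
move=> cv; apply: (subclosed_compact _ (@box_compact r s t)); last by move=> z [].
have clb : closed (box r s t).
  exact: compact_closed (@norm_hausdorff _ _) (@box_compact r s t).
move=> z clz; have bz : box r s t z by apply: clb => U /clz [y [[? _] ?]]; exists y.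
split => //; rewrite leNgt; apply/negP => cvz.
have [|d d0 dP] := (continuous_ptP v z).1 (cv z bz) ((v z - c) / 2).
  by rewrite divr_gt0 // subr_gt0.
have /clz[y [[_ vy] /= yd]] : nbhs z [set x : pt | `|x.1 - z.1| < d /\ `|x.2 - z.2| < d].
  by apply/near_ptP; exists d.
have := dP y yd.1 yd.2; rewrite ler_norml => /andP[]; move: vy cvz; lra.
Qed.

(** The second point may leave the box, because continuity at the points of the box is assumed in
    the ambient space. *)
Lemma box_unif_continuous r s t (v : pt -> R) :
  (forall z, box r s t z -> {for z, continuous v}) ->
  forall e, 0 < e -> exists2 d, 0 < d & forall x y, box r s t x ->
    `|y.1 - x.1| < d -> `|y.2 - x.2| < d -> `|v y - v x| <= e.
Proof.
move=> cv e e0.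
pose P (d : R) (x : pt) := forall y : pt,
  `|y.1 - x.1| < d -> `|y.2 - x.2| < d -> `|v y - v x| <= e.
have := (compact_near_coveringP _).1 (@box_compact r s t) R 0^'+ P _.
case=> [x bx|d /= d0 dP].
  have [|d d0 dP] := (continuous_ptP v x).1 (cv x bx) (e / 2); first by rewrite divr_gt0.
  exists ([set y : pt | `|y.1 - x.1| < d / 2 /\ `|y.2 - x.2| < d / 2], [set c | c < d / 2]).
    split => /=; first by apply/near_ptP; exists (d / 2) => //; rewrite divr_gt0.
    by apply: nbhs_right_lt; rewrite divr_gt0.
  move=> [x' c] /= [[x1 x2] cd] y y1 y2.
  have tri (V : normedZmodType R) (p q w : V) : `|p - q| < c -> `|q - w| < d / 2 -> `|p - w| < d.
    by move=> h1 h2; have := ler_distD q p w; move: h1 h2 cd; lra.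
  have h1 := dP y (tri _ _ _ _ y1 x1) (tri _ _ _ _ y2 x2).
  have dd : d / 2 < d by move: d0; lra.
  have h2 := dP x' (lt_trans x1 dd) (lt_trans x2 dd).
  by rewrite distrC in h2; have := ler_distD (v x) (v y) (v x'); move: h1 h2; lra.
exists (d / 2) => [|x y bx]; first by rewrite divr_gt0.
apply: (dP (d / 2)) => //=; last by rewrite divr_gt0.
by rewrite sub0r normrN gtr0_norm ?divr_gt0 //; move: d0; lra.
Qed.

End SpaceTime.

Lemma norm_le_addr (R : realType) (V : normedZmodType R) (x z : V) (d : R) :
  `|x - z| <= d -> `|x| <= `|z| + d.
Proof.
by move=> h; have := ler_normD (x - z) z; rewrite subrK addrC => /le_trans; apply; rewrite lerD2l.
Qed.

Lemma ler_dist_quarter (R : realFieldType) (a b e x z r : R) :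
  x <= a -> a <= r / 4 -> b <= x + e -> r <= z + b -> z < r / 4 -> r / 2 <= e.
Proof. lra. Qed.

(** * Continuity of the kernel and the comparison principle *)

Section Comparison.
Variables (R : realType) (N : nat) (wt : 'I_N -> nat) (B : 'M[R]_N).
Hypothesis B_graded : forall k l, B k l != 0 -> wt l = (wt k).+2.
Hypothesis B_observable : forall v : 'cV[R]_N,
  (forall j k, wt k = 1 -> (B ^+ j *m v) k 0 = 0) -> v = 0.
Hypothesis wt_gt0 : forall k, (0 < wt k)%N.
Variables be ss : R.
Hypothesis be_gt0 : 0 < be.
Hypothesis ss_gt0 : 0 < ss.
Local Notation pt := ('cV[R]_N * R)%type.
Local Notation E := (drift_exp wt B).
Local Notation M := (Mmat wt B).
Local Notation dil := (dilation wt).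
Local Notation kernel := (kernel wt B be ss).

Lemma cvg_compose (T : Type) (F : set_system T) (FF : Filter F) (f : T -> R) (h : R -> R)
    (a : R) : {for a, continuous h} -> f @ F --> a -> h (f t) @[t --> F] --> h a.
Proof. by move=> hc fa; exact: (@continuous_cvg _ _ _ F FF f h a). Qed.

Lemma cvg_drift_exp (T : Type) (F : set_system T) (FF : Filter F) (f : T -> R) (a : R)
    (x : 'cV[R]_N) k :
  f @ F --> a -> (E (f t) *m x) k 0 @[t --> F] --> (E a *m x) k 0.
Proof.
move=> fa; pose p := \poly_(j < (wtsum wt).+1) ((-1) ^+ j * (B^T ^+ j *m x) k 0 / j`!%:R).
have pE s : (E s *m x) k 0 = p.[s].
  rewrite /p horner_poly mulmx_suml summxE; apply: eq_bigr => j _.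
  by rewrite -scalemxAl mxE [(- s) ^+ j]exprNn; ring.
under eq_fun do rewrite pE; rewrite pE.
exact: (cvg_compose FF (@continuous_horner R p a) fa).
Qed.

Lemma cvg_kphase (T : Type) (F : set_system T) (FF : Filter F) (x : T -> 'cV[R]_N)
    (th : T -> R) (x0 y0 : 'cV[R]_N) (a : R) : 0 < a ->
  (forall k, x t k 0 @[t --> F] --> x0 k 0) -> th @ F --> a ->
  expR (kphase wt B be ss (th t) (x t - E (th t) *m y0)) @[t --> F] -->
  expR (kphase wt B be ss a (x0 - E a *m y0)).
Proof.
move=> a0 cx cth; apply: (cvg_compose _ (@continuous_expR R _)).
pose eta t (v : 'cV[R]_N) := dil (Num.sqrt t)^-1 *m (v - E t *m y0).
have ceta k : eta (th t) (x t) k 0 @[t --> F] --> eta a x0 k 0.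
  have yE t (v : 'cV[R]_N) : eta t v k 0 = (Num.sqrt t)^-1 ^+ wt k * (v k 0 - (E t *m y0) k 0).
    by rewrite /eta dilationE !mxE.
  under eq_fun do rewrite yE; rewrite yE.
  apply: cvgM.
    apply: (cvg_compose _ (@exprn_continuous R (wt k) _)).
    apply: cvgV; first by rewrite gt_eqF // sqrtr_gt0.
    exact: (cvg_compose _ (@sqrt_continuous R _) cth).
  by apply: cvgB; [exact: cx|exact: (cvg_drift_exp FF cth)].
apply: cvgB; first apply: cvgN.
  apply: cvgM; first exact: cvg_cst.
  exact: (cvg_compose _ (continuous_ln a0) cth).
apply: cvgM; first exact: cvg_cst.
under eq_fun do rewrite qform_sum; rewrite qform_sum.
apply: (@cvg_big R^o _ _ _ _ (@add_continuous R^o)) => i _.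
apply: (@cvg_big R^o _ _ _ _ (@add_continuous R^o)) => j _.
by apply: cvgM (ceta j); apply: cvgM (ceta i); exact: cvg_cst.
Qed.

Lemma kernel_continuous_pos (ze z : pt) : 0 < z.2 - ze.2 -> {for z, continuous (kernel ze)}.
Proof.
move=> th0; apply/continuous_ptP => e e0.
have cth : (fun x : pt => x.2 - ze.2) @ nbhs z --> z.2 - ze.2 by apply: cvgB; [exact: cvg_snd|exact: cvg_cst].
have cx (k : 'I_N) : (fun x : pt => x.1 k 0) @ nbhs z --> z.1 k 0.
  apply: (@cvg_comp _ _ _ fst (fun w : 'cV[R]_N => w k 0)); first exact: cvg_fst.
  exact: coord_continuous.
have := cvg_kphase (y0 := ze.1) (nbhs_filter z) th0 cx cth.
move=> /(@cvgrPdist_le _ _ _ _ (nbhs_filter z)) /(_ e e0) /near_ptP[d d0 dP].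
exists (Num.min d (z.2 - ze.2)); rewrite ?lt_min ?d0 // => x; rewrite !lt_min.
move=> /andP[x1 _] /andP[x2 x3]; rewrite /kernel th0.
have -> : 0 < x.2 - ze.2 by move: x3; rewrite ltr_norml; lra.
by rewrite distrC; exact: dP.
Qed.

(** Only the time of the pole is delicate: away from the pole itself, [kernel_le_linear] bounds the
    kernel by a multiple of the elapsed time. *)
Lemma kernel_continuous (ze z : pt) : z <> ze -> {for z, continuous (kernel ze)}.
Proof.
move=> zze; have [th0|th0|th0] := ltgtP (z.2 - ze.2) 0; last 1 first.
- apply/continuous_ptP => e e0.
  have k0 : kernel ze z = 0 by rewrite /kernel th0 ltxx.
  have t0 : z.2 = ze.2 by apply/eqP; rewrite -subr_eq0 th0.
  have nz : 0 < `|z.1 - ze.1|.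
    rewrite normr_gt0 subr_eq0; apply/eqP => x0; apply: zze.
    by move: z ze x0 t0 {th0 k0} => [x1 x2] [y1 y2] /= -> ->.
  set r := `|z.1 - ze.1| in nz *.
  have [K K0 KP] := kernel_le_linear B_graded B_observable wt_gt0 be_gt0 ss_gt0 (divr_gt0 nz (ltr0n _ 2)).
  have [CE CE1 CEP] := drift_exp_bound wt B.
  have CE0 : 0 < CE := lt_le_trans ltr01 CE1.
  (* Within time d1 the drift displaces the points near z by at most r / 4. *)
  pose d1 := r / (4 * CE * (`|z.1| + 1)).
  have z10 : 0 < `|z.1| + 1 by rewrite ltr_wpDl.
  have d10 : 0 < d1 by rewrite divr_gt0 // !mulr_gt0.
  exists (Num.min (Num.min d1 (e / K)) (Num.min 1 (r / 4))).
    by rewrite !lt_min d10 ltr01 !divr_gt0.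
  move=> x; rewrite !lt_min => /andP[_ /andP[x1 xr]] /andP[/andP[xd xe] /andP[xt _]].
  rewrite k0 subr0 ger0_norm ?kernel_ge0 //.
  have [th|th] := ltP 0 (x.2 - ze.2); last by rewrite /kernel ltNge th /= ltW.
  move: xd xe xt; rewrite t0 gtr0_norm // => xd xe xt.
  have := KP ze x; rewrite th (ltW (lt_trans xt _)) ?ltr1n // => /(_ isT) h.
  apply: le_trans (h _) _; last by rewrite mulrC -ler_pdivlMr // ltW.
  have [|_ hE] := CEP (- (x.2 - ze.2)) x.1.
    by rewrite normrN gtr0_norm // ltW // (lt_trans xt) // ltr1n.
  rewrite normrN gtr0_norm // in hE.
  have xn : `|x.1| <= `|z.1| + 1.
    by apply: norm_le_addr; exact: ltW.
  have h2 : CE * (x.2 - ze.2) * `|x.1| <= r / 4.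
    apply: (@le_trans _ _ (CE * d1 * (`|z.1| + 1))).
      by rewrite ler_pM ?mulr_ge0 ?(ltW CE0) ?(ltW th) // ler_pM2l // ltW.
    rewrite /d1 le_eqVlt; apply/orP; left; apply/eqP; field.
    by rewrite !gt_eqF.
  have t2 := ler_distD (E (- (x.2 - ze.2)) *m x.1) x.1 ze.1.
  have t3 := ler_distD x.1 z.1 ze.1; rewrite -/r [`|z.1 - x.1|]distrC in t3.
  rewrite distrC in hE; exact: ler_dist_quarter hE h2 t2 t3 xr.
- apply/continuous_ptP => e e0; exists (- (z.2 - ze.2)); first by rewrite oppr_gt0.
  move=> x _; rewrite ltr_norml => /andP[_ h].
  rewrite /kernel [0 < z.2 - _]ltNge (ltW th0) /= ltNge.
  by have -> /= : x.2 - ze.2 <= 0; [move: h; lra|rewrite subrr normr0 ltW].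
- exact: kernel_continuous_pos.
Qed.

Lemma cvg_scale_kernel (c : R) (ze z : pt) : (c != 0 -> z <> ze) ->
  (fun x => c * kernel ze x) @ nbhs z --> c * kernel ze z.
Proof.
have [-> _|c0 /(_ isT) zze] := eqVneq c 0; last first.
  by apply: cvgM; [exact: cvg_cst|exact: kernel_continuous].
have -> : (fun x => 0 * kernel ze x) = fun=> 0 by apply/funext => x; rewrite mul0r.
by rewrite mul0r; exact: cvg_cst.
Qed.

End Comparison.

(** The function v - phi + kap + ep (t - t0) is minimized over the part of the box where v <= 1/2,
    which contains no pole. A negative minimum is excluded at the bottom because phi = 0 there, on
    the lateral side by kap, on the level v = 1/2 by phi <= 1/2, and elsewhere by the expansions at
    the minimum, where ep makes the inequality strict. *)
Lemma comparison (R : realType) (N : nat) (wt : 'I_N -> nat) (B : 'M[R]_N)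
    (B_graded : forall k l, B k l != 0 -> wt l = (wt k).+2)
    (B_observable : forall v : 'cV[R]_N,
      (forall j k, wt k = 1 -> (B ^+ j *m v) k 0 = 0) -> v = 0)
    (wt_gt0 : forall k, (0 < wt k)%N) (be ss lam Lam : R) (be_gt0 : 0 < be) (ss_gt0 : 0 < ss)
    (lam_gt0 : 0 < lam) (Lam_gt0 : 0 < Lam) (be_lam : be * 4 * lam = 1)
    (ss_ge : 2 * be * Lam * (wtsum wt)%:R <= ss)
    (R0 t0 T kap : R) (v : 'cV[R]_N * R -> R) (I : finType) (c : I -> R)
    (ze : I -> 'cV[R]_N * R) (phi := fun z => \sum_i c i * kernel wt B be ss (ze i) z) :
  (forall z, box R0 t0 T z -> {for z, continuous v}) ->
  (forall z, box R0 t0 T z -> 0 <= v z) ->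
  (forall z, box R0 t0 T z -> t0 < z.2 -> `|z.1| < R0 -> solution_at wt B lam Lam v z) ->
  (forall i, 0 <= c i) -> (forall i, c i != 0 -> t0 <= (ze i).2) -> 0 <= kap ->
  (forall z, box R0 t0 T z -> v z <= 1/2 -> phi z <= 1/2 /\ forall i, c i != 0 -> z <> ze i) ->
  (forall z, box R0 t0 T z -> `|z.1| = R0 -> phi z <= kap) ->
  forall z, box R0 t0 T z -> v z <= 1/2 -> phi z - kap <= v z.
Proof.
move=> cv v0 sv c0 zet kap0 phi_small phi_lat z1 bz1 vz1.
rewrite leNgt; apply/negP => neg.
(* Over the whole height of the box the penalty costs at most half of the deficit; the summand 1
   keeps the denominator positive when T = t0. *)
pose ep := (phi z1 - kap - v z1) / (2 * (T - t0 + 1)).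
have bt : 0 <= z1.2 - t0 <= T - t0 by case: bz1 => _ /andP[h1 h2]; rewrite subr_ge0 h1 lerD2r.
have Tt0 : 0 < T - t0 + 1 by case/andP: bt; lra.
have ep0 : 0 < ep by rewrite divr_gt0 ?mulr_gt0 // subr_gt0.
pose w z := v z - phi z + kap + ep * (z.2 - t0).
have w1 : w z1 < 0.
  have : ep * (z1.2 - t0) <= ep * (T - t0 + 1).
    by rewrite ler_pM2l //; case/andP: bt; lra.
  have -> : ep * (T - t0 + 1) = (phi z1 - kap - v z1) / 2 by rewrite /ep; field; rewrite gt_eqF.
  rewrite /w; move: neg; move: (phi z1) (v z1) (ep * _); clear; move=> *; lra.
pose D := [set z | box R0 t0 T z /\ v z <= 1/2].
have cD : compact D by exact: sublevel_box_compact.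
have cw : {within D, continuous w}.
  apply: continuous_in_subspaceT => z /set_mem[bz vz].
  have [_ zne] := phi_small z bz vz.
  rewrite /w /phi; apply: cvgD; first apply: cvgD; [|exact: cvg_cst|].
    apply: cvgB; first exact: cv.
    apply: (@cvg_big R^o _ _ _ _ (@add_continuous R^o)) => i _.
    exact: (cvg_scale_kernel B_graded B_observable wt_gt0 be_gt0 ss_gt0 (zne i)).
  apply: cvgM; first exact: cvg_cst.
  by apply: cvgB; [exact: cvg_snd|exact: cvg_cst].
have wE x : w x = v x - phi x + kap + ep * (x.2 - t0) by [].
have phiE x : phi x = \sum_i c i * kernel wt B be ss (ze i) x by [].
clearbody w phi.
have [|z zD wmin] := compact_EVT_min _ cD cw; first by exists z1.
have {}wmin x : box R0 t0 T x -> v x <= 1/2 -> w z <= w x.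
  by move=> bx vx; apply: wmin; rewrite inE.
move: zD; rewrite inE => -[bz vz].
have wz : w z < 0 by apply: le_lt_trans w1; exact: wmin.
have [phz _] := phi_small z bz vz.
have zt : t0 < z.2.
  have [_ /andP[zt _]] := bz; rewrite lt_neqAle zt andbT; apply/eqP => e.
  have ph0 : phi z = 0.
    rewrite phiE; apply: big1 => i _; have [->|ci] := eqVneq (c i) 0; first by rewrite mul0r.
    rewrite /kernel; have := zet i ci; rewrite e => h.
    by rewrite subr_gt0 ltNge h /= mulr0.
  have := v0 z bz.
  move: wz; rewrite wE ph0 -e subrr mulr0; move: kap0 (v z); clear; move=> ? a; lra.
have zr : `|z.1| < R0.
  have [zr _] := bz; rewrite lt_neqAle zr andbT; apply/eqP => e.
  have := phi_lat z bz e; have := v0 z bz.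
  have : 0 <= ep * (z.2 - t0) by rewrite mulr_ge0 ?(ltW ep0) // subr_ge0 ltW.
  move: wz; rewrite wE; move: (v z) (phi z) (ep * _); clear; move=> *; lra.
have vz2 : v z < 1/2.
  have : 0 <= ep * (z.2 - t0) by rewrite mulr_ge0 ?(ltW ep0) // subr_ge0 ltW.
  move: wz phz kap0; rewrite wE; move: (v z) (phi z) (ep * _); clear; move=> *; lra.
(* Minimality is used at earlier times only, so the minimum may sit at the final time T. *)
have [d d0 dP] : exists2 d, 0 < d & forall x, `|x.1 - z.1| < d -> `|x.2 - z.2| < d ->
   x.2 <= z.2 -> w z <= w x.
  have [|d1 d10 d1P] := (continuous_ptP v z).1 (cv z bz) (1/2 - v z).
    by rewrite subr_gt0.
  exists (Num.min d1 (Num.min (R0 - `|z.1|) (z.2 - t0))).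
    by rewrite !lt_min d10 !subr_gt0 zr zt.
  move=> x; rewrite !lt_min => /and3P[x1 x2 _] /and3P[x3 _ x4] xz.
  apply: wmin; last first.
    have := d1P x x1 x3; rewrite ler_norml; move: (v x) (v z); clear; move=> *; lra.
  split; first by rewrite (le_trans (norm_le_addr (ltW x2))) // addrC subrK.
  have [_ /andP[_ zT]] := bz; move: x4; rewrite ltr_norml => /andP[h1 h2].
  move: h1 zT xz; move: x.2 z.2; clear; move=> *; apply/andP; split; lra.
have [H eH [bv [av [ev [Tv Dv sumv]]]]] := sv z bz zt zr.
have ker i := kernel_subsolution B_graded B_observable wt_gt0 lam_gt0 Lam_gt0 be_gt0
   be_lam ss_ge (ze i) z eH.
have /choice[bk kerb] := ker; have /choice[ak kera] := kerb; have /choice[ek kere] := kera.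
have sum_c i : 0 <= c i * (\sum_j 2 * ak i j + ek i).
  by rewrite mulr_ge0 //; have [_ _] := kere i.
have alow j : 0 <= av j - \sum_i c i * ak i j.
  have T1 : taylor2 (fun s => w (z.1 + s *: col j H, z.2))
     (bv j + -1 * \sum_i c i * bk i j) (av j + -1 * \sum_i c i * ak i j).
    have := taylor2D (Tv j) (taylor2_affine (-1) (kap + ep * (z.2 - t0))
      (taylor2_sum (fun i => taylor2_affine (c i) 0 (let: And3 h _ _ := kere i in h j)))).
    congr taylor2; apply/funext => s; rewrite wE /=.
    have -> : \sum_i (c i * kernel wt B be ss (ze i) (z.1 + s *: col j H, z.2) + 0) =
       phi (z.1 + s *: col j H, z.2) by rewrite phiE; apply: eq_bigr => i _; rewrite addr0.
    move: (v _) (phi _); clear; move=> *; ring.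
  have Hn : 0 < `|col j H| + 1 by rewrite ltr_wpDl.
  have := taylor2_min T1 (divr_gt0 d0 Hn); rewrite mulN1r; apply => s sd.
  rewrite scale0r addr0 -surjective_pairing; apply: dP => //=; last by rewrite subrr normr0.
  rewrite addrC addKr normrZ.
  have : `|s| * (`|col j H| + 1) < d by rewrite -ltr_pdivlMr.
  by apply: le_lt_trans; rewrite ler_wpM2l // lerDl.
have elow : 0 <= ev - \sum_i c i * ek i - ep.
  have T1 : rderiv (fun s => w (drift_exp wt B (- s) *m z.1, z.2 - s)) (ev + -1 * (\sum_i c i * ek i) - ep).
    have Tt : rderiv (fun s : R => - ep * s + (kap + ep * (z.2 - t0))) (- ep).
      move=> e e0; exists 1 => // s /andP[s0 _].
      have -> : - ep * s + (kap + ep * (z.2 - t0)) - (- ep * 0 + (kap + ep * (z.2 - t0))) - - ep * s = 0.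
        by ring.
      by rewrite normr0 mulr_ge0 // ltW.
    have := rderivD (rderivD Dv (rderiv_affine (-1) 0
      (rderiv_sum (fun i => rderiv_affine (c i) 0 (let: And3 _ h _ := kere i in h))))) Tt.
    congr rderiv; apply/funext => s; rewrite wE /=.
    have -> : \sum_i (c i * kernel wt B be ss (ze i) (drift_exp wt B (- s) *m z.1, z.2 - s) + 0) =
       phi (drift_exp wt B (- s) *m z.1, z.2 - s) by rewrite phiE; apply: eq_bigr => i _; rewrite addr0.
    ring.
  have [CE CE1 CEP] := drift_exp_bound wt B.
  have CE0 : 0 < CE := lt_le_trans ltr01 CE1.
  have Zn : 0 < CE * (`|z.1| + 1) by rewrite mulr_gt0 // ltr_wpDl.
  have dm : 0 < Num.min (Num.min d 4) (d / (CE * (`|z.1| + 1))).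
    by rewrite !lt_min d0 ltr0n divr_gt0.
  have := rderiv_min T1 dm; rewrite mulN1r; apply => s /andP[s0].
  rewrite !lt_min => /andP[/andP[sd s4] sd2].
  rewrite oppr0 drift_exp0 mul1mx addr0 -surjective_pairing; apply: dP => /=.
  - have [|_ h] := CEP (- s) z.1; first by rewrite normrN gtr0_norm // ltW.
    apply: le_lt_trans h _; rewrite normrN gtr0_norm //.
    move: sd2; rewrite ltr_pdivlMr // => h; apply: le_lt_trans h.
    rewrite [CE * s]mulrC -mulrA ler_pM2l // ler_pM2l // lerDl //.
  - by rewrite addrC addKr normrN gtr0_norm.
  - by rewrite gerBl ltW.
(* The expansion of w at its minimum has nonnegative coefficients. In their sum v contributes 0 and
   the kernels at most 0, which leaves -ep. *)
have : 0 <= \sum_j 2 * (av j - \sum_i c i * ak i j) + (ev - \sum_i c i * ek i - ep).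
  by rewrite addr_ge0 // sumr_ge0 // => j _; rewrite mulr_ge0.
have -> : \sum_j 2 * (av j - \sum_i c i * ak i j) + (ev - \sum_i c i * ek i - ep) =
  (\sum_j 2 * av j + ev) - \sum_i c i * (\sum_j 2 * ak i j + ek i) - ep.
  have -> : \sum_j 2 * (av j - \sum_i c i * ak i j) =
     \sum_j 2 * av j - \sum_i c i * \sum_j 2 * ak i j.
    under eq_bigr do rewrite mulrBr; rewrite sumrB; congr (_ - _).
    under eq_bigr do rewrite mulr_sumr; rewrite exchange_big; apply: eq_bigr => i _.
    rewrite mulr_sumr; apply: eq_bigr => j _; ring.
  under [X in _ = _ - X - _]eq_bigr do rewrite mulrDr; rewrite big_split /=; ring.
rewrite sumv.
have : 0 <= \sum_i c i * (\sum_j 2 * ak i j + ek i) by apply: sumr_ge0.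
move: (\sum_i _) ep0; clear; move=> *; lra.
Qed.

(** * The growth lemma, and invariance under translations and dilations *)

Section Growth.
Variables (R : realType) (N : nat) (wt : 'I_N -> nat) (B : 'M[R]_N).
Hypothesis B_graded : forall k l, B k l != 0 -> wt l = (wt k).+2.
Hypothesis B_observable : forall v : 'cV[R]_N,
  (forall j k, wt k = 1 -> (B ^+ j *m v) k 0 = 0) -> v = 0.
Hypothesis wt_gt0 : forall k, (0 < wt k)%N.
Variables be ss : R.
Hypothesis be_gt0 : 0 < be.
Hypothesis ss_gt0 : 0 < ss.
Variables lam Lam : R.
Hypothesis lam_gt0 : 0 < lam.
Hypothesis Lam_gt0 : 0 < Lam.
Hypothesis be_lam : be * 4 * lam = 1.
Hypothesis ss_ge : 2 * be * Lam * (wtsum wt)%:R <= ss.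
Local Notation pt := ('cV[R]_N * R)%type.
Local Notation E := (drift_exp wt B).
Local Notation dil := (dilation wt).
Local Notation kernel := (kernel wt B be ss).
Local Notation solution := (solution_at wt B lam Lam).

(* By superposition, the lower bound is linear in the total mass [\sum_i c i]. *)
Lemma growth : exists R0 c1 : R, [/\ 3 < R0, 0 < c1 &
  forall (T : R) (v : pt -> R) (I : finType) (c : I -> R) (ze : I -> pt), T <= 0 ->
  (forall z, box R0 (- (7/2)) T z -> {for z, continuous v}) ->
  (forall z, box R0 (- (7/2)) T z -> 0 <= v z) ->
  (forall z, box R0 (- (7/2)) T z -> - (7/2) < z.2 -> `|z.1| < R0 -> solution v z) ->
  (forall i, 0 <= c i) -> \sum_i c i <= 1 ->
  (forall i, c i != 0 -> `|(ze i).1| <= 3 /\ - (7/2) <= (ze i).2 <= -2) ->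
  (forall z, box R0 (- (7/2)) T z -> v z <= 1/2 ->
     \sum_i c i * kernel (ze i) z <= 1/2 /\ forall i, c i != 0 -> z <> ze i) ->
  forall z, `|z.1| <= 1 -> -1 <= z.2 <= T -> c1 * \sum_i c i <= v z].
Proof.
have [c0 c00 c0P] := kernel_ge B_graded B_observable be_gt0 ss_gt0 3.
(* The bound c0 / 2 lets the lateral error use up half of the gain c0; the bound 1/2 serves the
   points where v > 1/2. *)
pose c1 := Num.min (c0 / 2) (1 / 2).
have c10 : 0 < c1 by rewrite lt_min !divr_gt0.
have c1le : c1 <= c0 / 2 /\ c1 <= 1 / 2 by rewrite /c1 !ge_min !lexx orbT.
have [R0 R03 R0P] := kernel_lateral B_graded B_observable wt_gt0 be_gt0 ss_gt0 (ler0n R 3) c10.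
exists R0, c1; split => // T v I c ze T0 cv v0 sv cc0 c_le1 zeP small z z1 /andP[zt zT].
set S := \sum_i c i; have S0 : 0 <= S by exact: sumr_ge0.
have bz : box R0 (- (7/2)) T z.
  by split; [move: z1 R03; lra|rewrite zT andbT; move: zt; lra].
have [vz|vz] := leP (v z) (1/2); last first.
  by rewrite (le_trans _ (ltW vz)) // (le_trans _ c1le.2) // ler_piMr // ltW.
apply: le_trans (comparison B_graded B_observable wt_gt0 be_gt0 ss_gt0 lam_gt0 Lam_gt0
  be_lam ss_ge cv v0 sv cc0 _ (kap := c1 * S) _ small _ bz vz) => [|i||x bx xR].
- rewrite lerBrDr -mulrDl /S !mulr_sumr; apply: ler_sum => i _; rewrite [leRHS]mulrC.
  have [->|ci] := eqVneq (c i) 0; first by rewrite !(mulr0, mul0r).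
  rewrite ler_wpM2r // (@le_trans _ _ c0) //; first by have := c1le.1; lra.
  have [ze1 /andP[ze2 ze3]] := zeP i ci; apply: c0P => //; first by move: z1; lra.
  by apply/andP; split; move: zt zT T0 ze2 ze3; lra.
- by move=> ci; have [_ /andP[]] := zeP i ci.
- by rewrite mulr_ge0 // ltW.
rewrite /S mulr_sumr; apply: ler_sum => i _.
have [->|ci] := eqVneq (c i) 0; first by rewrite !(mulr0, mul0r).
rewrite mulrC ler_wpM2r //; have [ze1 /andP[ze2 ze3]] := zeP i ci; apply: R0P => //; first by rewrite xR.
by have [_ /andP[x1 x2]] := bx; move: T0 ze2 x2; lra.
Qed.

(* The map z0 o D_r of the homogeneous group. *)
Definition gmap (z0 : pt) (r : R) (z : pt) : pt :=
  (dil r *m z.1 + E (r ^+ 2 * z.2) *m z0.1, z0.2 + r ^+ 2 * z.2).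

(** The upper ellipticity bound makes the rows of H outside the first block vanish, so the columns
    of H scale with weight 1. *)
Lemma frame_dilation H j r : elliptic_frame wt lam Lam H -> dil r *m col j H = r *: col j H.
Proof.
move=> eH; apply/matrixP => k l; rewrite (ord1 l) dilationE !mxE.
have [->|wk] := eqVneq (wt k) 1%N; first by rewrite expr1.
have /andP[_] := eH (delta_mx k 0).
have -> : proj0 R wt *m delta_mx k 0 = 0 :> 'cV[R]_N.
  apply/matrixP => a b; rewrite proj0E !mxE.
  by have [->|] := eqVneq a k; rewrite ?(negbTE wk) ?mul0r //= mulr0.
have -> : sqnorm (0 : 'cV[R]_N) = 0.
  by apply: big1 => i _; rewrite mxE expr0n.
rewrite mulr0 => h; have /sqnorm_eq0 : sqnorm (H^T *m delta_mx k 0) = 0.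
  by apply/eqP; rewrite eq_le h sqnorm_ge0.
move=> /matrixP /(_ j 0); rewrite -colE !mxE => ->; by rewrite !mulr0.
Qed.

(** The frame H is kept: its columns scale by r, hence second derivatives by r^2, which is also the
    scaling of time along the drift. *)
Lemma solution_gmap (z0 : pt) (r : R) (v : pt -> R) (z : pt) : 0 < r ->
  solution v (gmap z0 r z) -> solution (fun x => v (gmap z0 r x)) z.
Proof.
move=> r0 [H eH [b [a [e [Tv Dv sumv]]]]]; exists H => //.
exists (fun j => r * b j), (fun j => r ^+ 2 * a j), (r ^+ 2 * e); split.
- move=> j; have := taylor2_scale r0 (Tv j); congr taylor2; apply/funext => s.
  congr v; rewrite /gmap /=; congr (_, _).
  by rewrite mulmxDr -scalemxAr (frame_dilation _ _ eH) scalerA [(s * r)%R]mulrC addrAC.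
- have := rderiv_scale (exprn_gt0 2 r0) Dv; congr rderiv; apply/funext => s.
  congr v; rewrite /gmap /=; congr (_, _); last by rewrite mulrBr addrA.
  rewrite mulmxDr !mulmxA -(drift_expD B_graded) (dilation_drift_exp B_graded) mulrN.
  by rewrite mulrBr [(- _ + _)%R]addrC.
- transitivity (r ^+ 2 * (\sum_j 2 * a j + e)); last by rewrite sumv mulr0.
  by rewrite mulrDr mulr_sumr; congr (_ + _); apply: eq_bigr => j _; ring.
Qed.

Lemma solution_affine (c k : R) (v : pt -> R) (z : pt) :
  solution v z -> solution (fun x => c * v x + k) z.
Proof.
move=> [H eH [b [a [e [Tv Dv sumv]]]]]; exists H => //.
exists (fun j => c * b j), (fun j => c * a j), (c * e); split.
- by move=> j; exact: taylor2_affine (Tv j).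
- exact: rderiv_affine Dv.
- transitivity (c * (\sum_j 2 * a j + e)); last by rewrite sumv mulr0.
  by rewrite mulrDr mulr_sumr; congr (_ + _); apply: eq_bigr => j _; ring.
Qed.

(** The offset from the pole is dilated by r and the elapsed time by r^2, so the quadratic form is
    invariant and only the factor th^-ss changes. *)
Lemma kernel_gmap (z0 ze z : pt) (r : R) : 0 < r ->
  kernel (gmap z0 r ze) (gmap z0 r z) = expR (- (2 * ss * ln r)) * kernel ze z.
Proof.
move=> r0; have r2 : 0 < r ^+ 2 by exact: exprn_gt0.
rewrite /kernel /gmap /=; have -> : z0.2 + r ^+ 2 * z.2 - (z0.2 + r ^+ 2 * ze.2) =
  r ^+ 2 * (z.2 - ze.2) by ring.
rewrite (pmulr_rgt0 _ r2); case: ifP => th0; last by rewrite mulr0.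
set th := z.2 - ze.2 in th0 *.
have -> : dil r *m z.1 + E (r ^+ 2 * z.2) *m z0.1 -
   E (r ^+ 2 * th) *m (dil r *m ze.1 + E (r ^+ 2 * ze.2) *m z0.1) = dil r *m (z.1 - E th *m ze.1).
  rewrite mulmxDr !mulmxA -(drift_expD B_graded) -(dilation_drift_exp B_graded) mulmxBr mulmxA.
  have -> : r ^+ 2 * th + r ^+ 2 * ze.2 = r ^+ 2 * z.2 by rewrite /th; ring.
  by rewrite opprD addrACA subrr addr0.
rewrite -expRD /kphase mulmxA dilation_mul.
have -> : (Num.sqrt (r ^+ 2 * th))^-1 * r = (Num.sqrt th)^-1.
  rewrite sqrtrM ?ltW // sqrtr_sqr gtr0_norm // invfM mulrAC mulVf ?mul1r // gt_eqF //.
by rewrite lnM ?posrE // lnXn // -mulr_natl; congr expR; ring.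
Qed.

End Growth.

(** * Riemann sums of a Gaussian and of a power *)

Section OneDimensionalSums.
Variable R : realType.

(** A rational majorant of the Gaussian, whose primitive arctan lets sums telescope. *)
Lemma expRN_sqr_le (c : R) : 0 < c -> exists2 K, 0 < K &
  forall x, expR (- (c * x ^+ 2)) <= K / (1 + x ^+ 2).
Proof.
move=> c0; exists (1 + c^-1) => [|x]; first by rewrite addr_gt0 // invr_gt0.
have x2 := sqr_ge0 x; have c20 : 0 <= c * x ^+ 2 by rewrite mulr_ge0 // ltW.
rewrite expRN ler_pdivlMr ?ltr_pwDl // mulrC ler_pdivrMr ?expR_gt0 //.
apply: (@le_trans _ _ ((1 + c^-1) * (1 + c * x ^+ 2))); last first.
  by rewrite ler_pM2l ?addr_gt0 ?invr_gt0 // expR_ge1Dx.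
have -> : (1 + c^-1) * (1 + c * x ^+ 2) = 1 + x ^+ 2 + (c * x ^+ 2 + c^-1).
  by field; rewrite gt_eqF.
by rewrite lerDl addr_ge0 // invr_ge0 ltW.
Qed.

(** On an interval of length at most 1 the function 1 + x^2 varies by a factor of at most 3. *)
Lemma le_atan_diff (x h : R) : 0 < h <= 1 -> h / (1 + x ^+ 2) <= 3 * (atan (x + h) - atan x).
Proof.
move=> /andP[h0 h1].
have [||c] := @MVT R (@atan R) (fun y => (1 + y ^+ 2)^-1) x (x + h).
- by rewrite ltrDl.
- exact: (continuous_subspaceT (@continuous_atan R)).
rewrite in_itv /= => /andP[xc cxh] ->; rewrite addrAC subrr add0r mulrA mulrC ler_pM2r //.
have p1 : 0 < 1 + x ^+ 2 by rewrite ltr_pwDl // sqr_ge0.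
have p2 : 0 < 1 + c ^+ 2 by rewrite ltr_pwDl // sqr_ge0.
rewrite -[leLHS]div1r ler_pdivrMr // mulrAC ler_pdivlMr // mul1r.
have d0 : 0 <= c - x by rewrite subr_ge0 ltW.
have d1 : c - x <= 1 by move: cxh h1; lra.
have -> : c = x + (c - x) by ring.
move: (c - x) d0 d1 => d d0 d1; rewrite -subr_ge0.
have -> : 3 * (1 + x ^+ 2) - (1 + (x + d) ^+ 2) = (x - d) ^+ 2 + x ^+ 2 + 2 * (1 - d ^+ 2) by ring.
rewrite !addr_ge0 ?sqr_ge0 // mulr_ge0 // subr_ge0 -[leRHS](expr1n _ 2).
by rewrite lerXn2r ?nnegrE.
Qed.

Lemma gaussian_sum (c : R) : 0 < c -> exists2 K, 0 < K & forall (L : nat) (al h : R),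
  0 < h <= 1 -> \sum_(m < L) expR (- (c * (al - m%:R * h) ^+ 2)) <= K / h.
Proof.
move=> c0; have [K K0 KP] := expRN_sqr_le c0.
exists (K * 3 * pi) => [|L al h /[dup] h01 /andP[h0 h1]]; first by rewrite !mulr_gt0 // pi_gt0.
pose x m := al - m%:R * h.
apply: (@le_trans _ _ (\sum_(m < L) K * 3 / h * (atan (x m + h) - atan (x m)))).
  apply: ler_sum => m _; apply: le_trans (KP _) _.
  rewrite -/(x m); have p1 : 0 < 1 + x m ^+ 2 by rewrite ltr_pwDl // sqr_ge0.
  have -> : K / (1 + x m ^+ 2) = K / h * (h / (1 + x m ^+ 2)) by field; rewrite !gt_eqF.
  have -> (D : R) : K * 3 / h * D = K / h * (3 * D) by ring.
  by rewrite ler_pM2l ?divr_gt0 //; exact: le_atan_diff.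
rewrite -mulr_sumr.
have -> : \sum_(m < L) (atan (x m + h) - atan (x m)) = atan (x 0%N + h) - atan (x L + h).
  elim: L => [|L IH]; first by rewrite big_ord0 subrr.
  rewrite big_ord_recr IH /=.
  have -> : x L.+1 + h = x L by rewrite /x -natr1; ring.
  ring.
have h3 : 0 < K * 3 / h by rewrite divr_gt0 // mulr_gt0.
rewrite [leRHS]mulrAC ler_pM2l //.
have := atan_ltpi2 (x 0%N + h); have := atan_gtNpi2 (x L + h); lra.
Qed.

(** The power t^ka of t clipped to [0,1]. On (0,1) it is ka times a primitive of t^(ka-1), and being
    monotone with values in [0,1] it bounds telescoping sums by 1. *)
Definition clip_pow (ka t : R) : R :=
  if t <= 0 then 0 else if t < 1 then expR (ka * ln t) else 1.

Lemma clip_pow_bounds ka t : 0 < ka -> 0 <= clip_pow ka t <= 1.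
Proof.
move=> ka0; rewrite /clip_pow; have [t0|t0] := leP t 0; first by rewrite lexx ler01.
have [t1|t1] := ltP t 1; last by rewrite ler01 lexx.
by rewrite expR_ge0 -expR0 ler_expR pmulr_rle0 // ln_le0 // ltW.
Qed.

Lemma clip_pow_mono ka s t : 0 < ka -> s <= t -> clip_pow ka s <= clip_pow ka t.
Proof.
move=> ka0 st; have /andP[t0 t1] := clip_pow_bounds t ka0.
have /andP[s0 s1] := clip_pow_bounds s ka0.
move: t0 t1 s0 s1; rewrite /clip_pow; have [s0|s0] := leP s 0 => //.
rewrite [t <= 0]leNgt (lt_le_trans s0 st) /=.
have [t1|//] := ltP t 1; rewrite (le_lt_trans st t1) => _ _ _ _.
by rewrite ler_expR ler_pM2l // ler_ln ?posrE // (lt_le_trans s0).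
Qed.

(** As ka <= 1, the function t^(ka-1) decreases, so its value at the right end is below its mean
    over the interval. *)
Lemma clip_pow_diff ka t h : 0 < ka <= 1 -> 0 < h -> h <= t < 1 ->
  h * expR ((ka - 1) * ln t) <= ka^-1 * (clip_pow ka t - clip_pow ka (t - h)).
Proof.
move=> /andP[ka0 ka1] h0 /andP[ht t1]; have t0 : 0 < t := lt_le_trans h0 ht.
rewrite {1}/clip_pow [t <= 0]leNgt t0 t1 /=.
(* For t = h the interval starts at the singularity, and h h^(ka-1) = h^ka is compared directly. *)
move: ht; rewrite le_eqVlt => /orP[/eqP <-|ht].
  rewrite /clip_pow subrr lexx subr0.
  have -> : h * expR ((ka - 1) * ln h) = expR (ka * ln h).
    by rewrite -{1}[h]lnK ?posrE // -expRD; congr expR; ring.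
  by rewrite ler_peMl ?expR_ge0 // invf_ge1.
have th0 : 0 < t - h by rewrite subr_gt0.
have th1 : t - h < 1 by move: t1 h0; lra.
rewrite /clip_pow [t - h <= 0]leNgt th0 th1 /=.
have [|||c] := @MVT R (fun y => expR (ka * ln y)) (fun y => expR (ka * ln y) * (ka * y^-1)) (t - h) t.
- by rewrite gtrBl.
- move=> y; rewrite in_itv /= => /andP[y0 _].
  by apply/is_derive_expf/is_derive_cmulf/is_derive1_ln; exact: lt_trans y0.
- apply: derivable_within_continuous => y; rewrite in_itv /= => /andP[y0 _].
  have y1 : 0 < y by exact: lt_le_trans y0.
  by have [] := is_derive_expf (is_derive_cmulf ka (is_derive1_ln y1)).
rewrite in_itv /= => /andP[hc ct] ->.
have c0 : 0 < c by exact: lt_trans hc.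
have -> : ka^-1 * (expR (ka * ln c) * (ka / c) * (t - (t - h))) = h * (expR (ka * ln c) / c).
  by field; rewrite !gt_eqF.
rewrite ler_pM2l //.
have -> : expR (ka * ln c) / c = expR ((ka - 1) * ln c).
  have -> : (ka - 1) * ln c = ka * ln c - ln c by ring.
  by rewrite expRD expRN lnK ?posrE.
by rewrite ler_expR ler_wnM2l ?subr_le0 // ler_ln ?posrE // ltW.
Qed.

(* A Riemann sum of the integrable function [t^(ka-1)] over an interval of length 1. *)
Lemma time_sum (ka : R) (n : nat) (a h : R) : 0 < ka <= 1 -> 0 < h -> n%:R * h <= 1 ->
  \sum_(j < n | h <= a - j%:R * h) h * expR ((ka - 1) * ln (a - j%:R * h)) <= 1 + ka^-1.
Proof.
move=> /[dup] ka01 /andP[ka0 ka1] h0 nh.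
pose th j := a - j%:R * h.
(* The summand h bounds the terms at times at least 1 and gives a total n h <= 1; the increments of
   [clip_pow] bound the others and telescope. *)
apply: (@le_trans _ _ (\sum_(j < n) (h + ka^-1 * (clip_pow ka (th j) - clip_pow ka (th j.+1))))).
  rewrite big_mkcond; apply: ler_sum => j _; rewrite -/(th j).
  have thS : th j.+1 = th j - h by rewrite /th -natr1; ring.
  have m0 : 0 <= ka^-1 * (clip_pow ka (th j) - clip_pow ka (th j.+1)).
    by rewrite mulr_ge0 ?invr_ge0 ?(ltW ka0) // subr_ge0 clip_pow_mono // thS gerBl ltW.
  case: ifP => hth; last by rewrite addr_ge0 // ltW.
  have [t1|t1] := ltP (th j) 1; last first.
    rewrite (@le_trans _ _ h) // ?lerDl // ger_pMr // -[leRHS]expR0 ler_expR.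
    by apply: mulr_le0_ge0; [rewrite subr_le0|exact: ln_ge0].
  rewrite (le_trans (clip_pow_diff ka01 h0 (t := th j) _)) ?hth // -thS lerDr ltW //.
rewrite big_split sumr_const card_ord -[h *+ n]mulr_natl lerD // -mulr_sumr.
have -> : \sum_(j < n) (clip_pow ka (th j) - clip_pow ka (th j.+1)) =
   clip_pow ka (th 0%N) - clip_pow ka (th n).
  elim: n {nh} => [|n IH]; first by rewrite big_ord0 subrr.
  by rewrite big_ord_recr IH /=; ring.
rewrite ger_pMr ?invr_gt0 //.
have /andP[_ h1] := clip_pow_bounds (th 0%N) ka0.
have /andP[h2 _] := clip_pow_bounds (th n) ka0.
move: h1 h2; lra.
Qed.

End OneDimensionalSums.

Lemma sqrtr_expR (R : realType) (t : R) : 0 < t -> Num.sqrt t = expR (ln t / 2).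
Proof.
move=> t0; have {1}-> : t = expR (ln t / 2) ^+ 2.
  by rewrite -expRM_natl mulrCA mulfV // mulr1 lnK.
by rewrite sqrtr_sqr gtr0_norm // expR_gt0.
Qed.

(** A progression of step h meets the open interval (0, h) at most once. *)
Lemma sum_spaced_le1 (R : realDomainType) (n : nat) (a h : R) : 0 < h ->
  \sum_(j < n) (0 < a - j%:R * h < h)%R%:R <= 1 :> R.
Proof.
move=> h0; have [j0 j0P|none] := pickP (fun j : 'I_n => 0 < a - j%:R * h < h); last first.
  by rewrite big1 // => j _; rewrite none.
rewrite (bigD1 j0) //= j0P big1 ?addr0 // => j jj0.
case: (boolP (_ && _)) => // /andP[j1 j2]; exfalso; move: jj0 => /negP; apply.
move/andP: j0P => [h1 h2]; rewrite -val_eqE /=; apply/eqP; apply: contrapT => ne.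
have [lt|lt] : (j < j0)%N \/ (j0 < j)%N by lia.
  have : j%:R * h + h <= j0%:R * h.
    by rewrite -{2}[h]mul1r -mulrDl natr1 ler_pM2r // ler_nat.
  by move: h1 h2 j1 j2; lra.
have : j0%:R * h + h <= j%:R * h.
  by rewrite -{2}[h]mul1r -mulrDl natr1 ler_pM2r // ler_nat.
by move: h1 h2 j1 j2; lra.
Qed.

(** * Homogeneous lattices and sums of kernels over them *)

Section Lattice.
Variables (R : realType) (N : nat) (wt : 'I_N -> nat).
Local Notation pt := ('cV[R]_N * R)%type.
Local Notation Q := (wtsum wt).

(** All coordinates share the range H^Q, so that the functions have a single codomain; [in_lattice]
    then restricts coordinate k to H^(wt k) values. *)
Definition lattice_index (H : nat) : finType := ('I_(H ^ 2) * {ffun 'I_N -> 'I_(H ^ Q)})%type.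

Definition in_lattice (H : nat) (i : lattice_index H) : bool :=
  i.2 \in family (fun k => [pred m : 'I_(H ^ Q) | (m < H ^ wt k)%N]).

Definition lattice_point (H : nat) (i : lattice_index H) : pt :=
  (\col_k ((i.2 k)%:R * (H%:R^-1) ^+ wt k), -3 + i.1%:R * (H%:R^-1) ^+ 2).

Lemma wtsumE (F : R) : \prod_(k < N) F ^+ wt k = F ^+ Q.
Proof. by rewrite /wtsum expr_sum. Qed.

Lemma card_lattice (H : nat) : (0 < H)%N -> #|[pred i | @in_lattice H i]| = (H ^ (Q + 2))%N.
Proof.
move=> H0; pose F := family (fun k => [pred m : 'I_(H ^ Q) | (m < H ^ wt k)%N]).
rewrite (@eq_card _ _ [predX predT & F]); last by move=> -[j m]; rewrite !inE.
rewrite cardX card_ord card_family foldrE big_map big_enum /= expnD mulnC; congr (_ * _)%N.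
rewrite [RHS](_ : _ = \prod_k H ^ wt k)%N; last by rewrite /wtsum expn_sum.
apply: eq_bigr => k _.
have le : (H ^ wt k <= H ^ Q)%N by rewrite leq_pexp2l // wt_le_sum.
transitivity (\sum_(m < H ^ Q | (m < H ^ wt k)%N) 1)%N; first by rewrite sum1_card.
by rewrite (big_ord_narrow le) sum1_card card_ord.
Qed.

(** The Gaussian factors over coordinates. After division by sqrt(th)^wt the spacing in coordinate k
    is (sqrt(th) H)^(-wt k), which is at most 1, as [gaussian_sum] requires, because th >= H^-2. *)
Lemma slice_sum (c : R) : 0 < c -> exists2 K, 0 < K &
  forall (H : nat) (th : R) (y : 'I_N -> R), (0 < H)%N -> (H%:R^-1) ^+ 2 <= th ->
  \sum_(m in family (fun k => [pred m : 'I_(H ^ Q) | (m < H ^ wt k)%N]))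
    expR (- (c * \sum_k (y k - (m k)%:R * (H%:R^-1) ^+ wt k) ^+ 2 / th ^+ wt k))
    <= K * (Num.sqrt th * H%:R) ^+ Q.
Proof.
move=> c0; have [K K0 KP] := gaussian_sum c0.
exists (K ^+ N) => [|H th y H0 dth]; first exact: exprn_gt0.
have HR : 0 < H%:R :> R by rewrite ltr0n.
have th0 : 0 < th by apply: lt_le_trans dth; rewrite exprn_gt0 // invr_gt0.
have sth0 : 0 < Num.sqrt th by rewrite sqrtr_gt0.
pose rho := Num.sqrt th * H%:R; have rho0 : 0 < rho by rewrite mulr_gt0.
have rho1 : 1 <= rho.
  rewrite -ler_pdivrMr // div1r -[leLHS]ger0_norm ?invr_ge0 ?(ltW HR) //.
  by rewrite -sqrtr_sqr ler_wsqrtr.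
pose h k := rho^-1 ^+ wt k.
have h01 k : 0 < h k <= 1.
  by rewrite exprn_gt0 ?invr_gt0 // exprn_ile1 ?invr_ge0 ?(ltW rho0) // invf_le1.
pose G k (m : 'I_(H ^ Q)) := expR (- (c * (y k / Num.sqrt th ^+ wt k - m%:R * h k) ^+ 2)).
have -> : K ^+ N * rho ^+ Q = \prod_k (K / h k).
  rewrite big_split /= prodr_const card_ord; congr (_ * _).
  by rewrite -wtsumE; apply: eq_bigr => k _; rewrite /h exprVn invrK.
apply: (@le_trans _ _ (\prod_k \sum_(m : 'I_(H ^ Q) | (m < H ^ wt k)%N) G k m)).
  rewrite (bigA_distr_big_dep (fun k (m : 'I_(H ^ Q)) => (m < H ^ wt k)%N)) /=.
  rewrite le_eqVlt; apply/orP; left; apply/eqP; apply: eq_bigr => m _.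
  rewrite -expR_sum; congr expR; rewrite sumrN; congr (- _); rewrite mulr_sumr.
  apply: eq_bigr => k _; congr (_ * _).
  have -> : th ^+ wt k = (Num.sqrt th ^+ wt k) ^+ 2.
    by rewrite -exprM mulnC exprM sqr_sqrtr // ltW.
  rewrite -expr_div_n; congr (_ ^+ 2); rewrite mulrBl; congr (_ - _).
  rewrite -mulrA; congr (_ * _); rewrite /h /rho invfM exprMn mulrC; congr (_ * _).
  by rewrite exprVn.
apply: ler_prod => k _; rewrite sumr_ge0 /=; last by move=> m _; exact: expR_ge0.
apply: le_trans (KP (H ^ Q)%N (y k / Num.sqrt th ^+ wt k) (h k) (h01 k)).
by rewrite big_mkcond; apply: ler_sum => m _; case: ifP => // _; exact: expR_ge0.
Qed.

End Lattice.

(** The cell extends only into the future of ze, since the kernel vanishes before its pole. The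
    offset is measured as in [kernel_le], carried back along the drift to the time of the pole. *)
Definition group_cell (R : realType) (N : nat) (wt : 'I_N -> nat) (B : 'M[R]_N) (de : R)
    (ze z : 'cV[R]_N * R) : Prop := 0 <= z.2 - ze.2 <= de ^+ 2 /\
  forall k, `|(drift_exp wt B (- (z.2 - ze.2)) *m z.1) k 0 - ze.1 k 0| < de ^+ wt k.

(* The condition [ss < Q/2 + 1] makes the kernel integrable near its pole. *)
Lemma lattice_sum (R : realType) (N : nat) (wt : 'I_N -> nat) (B : 'M[R]_N)
    (B_graded : forall k l, B k l != 0 -> wt l = (wt k).+2)
    (B_observable : forall v : 'cV[R]_N,
      (forall j k, wt k = 1 -> (B ^+ j *m v) k 0 = 0) -> v = 0)
    (wt_gt0 : forall k, (0 < wt k)%N) (be ss : R) (be_gt0 : 0 < be) (ss_gt0 : 0 < ss)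
    (ss_ge : (wtsum wt)%:R / 2 <= ss) (ss_lt : ss < (wtsum wt)%:R / 2 + 1) :
  exists2 CS, 0 < CS & forall (H : nat), (0 < H)%N ->
  forall (P : pred (lattice_index wt H)) (z : 'cV[R]_N * R), {subset P <= @in_lattice N wt H} ->
  (forall i, P i -> ~ group_cell wt B H%:R^-1 (lattice_point R i) z) ->
  (H%:R^-1) ^+ (wtsum wt + 2) * (\sum_(i | P i) kernel wt B be ss (lattice_point R i) z) <= CS.
Proof.
set Q := wtsum wt.
have [c c0 cP] := kernel_le B_graded B_observable ss be_gt0.
have c20 : 0 < c / 2 by rewrite divr_gt0.
have [K1 K10 K1P] := slice_sum wt c0.
have [K2 K20 K2P] := slice_sum wt c20.
(* After normalization a slice at elapsed time th contributes a multiple of th^(Q/2 - ss) = th^(ka -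
   1), so ka > 0 is integrability at the pole. *)
pose ka := 1 + Q%:R / 2 - ss.
have ka01 : 0 < ka <= 1 by apply/andP; rewrite /ka; split; move: ss_ge ss_lt; lra.
have ka0 : 0 < ka by case/andP: ka01.
pose gb := gaussian_bound ss (c / 2).
have gb0 : 0 < gb by exact: expR_gt0.
exists (gb * K2 + K1 * (1 + ka^-1)) => [|H H0 P z Plat Pcell].
  by rewrite addr_gt0 // mulr_gt0 // addr_gt0 // invr_gt0.
set de := H%:R^-1.
have HR : 0 < H%:R :> R by rewrite ltr0n.
have de0 : 0 < de by rewrite invr_gt0.
have de1 : de <= 1 by rewrite invf_le1 // ler1n.
have de20 : 0 < de ^+ 2 by exact: exprn_gt0.
pose th (j : nat) := z.2 + 3 - j%:R * de ^+ 2.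
have thE (i : lattice_index wt H) : z.2 - (lattice_point R i).2 = th i.1 by rewrite /th /= opprD opprK addrA.
pose y (j : nat) k := (drift_exp wt B (- th j) *m z.1) k 0.
pose S (d t : R) (j : nat) (m : {ffun 'I_N -> 'I_(H ^ Q)}) :=
  expR (- (d * \sum_k (y j k - (m k)%:R * de ^+ wt k) ^+ 2 / t ^+ wt k)).
have S0 d t j m : 0 <= S d t j m by exact: expR_ge0.
(* Two regimes: at most one slice has an elapsed time between 0 and de^2, and there z avoids the
   cells; the older slices are summed at their own scale. *)
pose F j m := (0 < th j < de ^+ 2)%R%:R * (gb * expR (- (ss * ln (de ^+ 2))) * S (c / 2) (de ^+ 2) j m)
  + (if de ^+ 2 <= th j then expR (- (ss * ln (th j))) * S c (th j) j m else 0).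
have F0 j m : 0 <= F j m.
  apply: addr_ge0; first by rewrite mulr_ge0 // mulr_ge0 // mulr_ge0 ?expR_ge0 ?(ltW gb0).
  by case: ifP => // _; rewrite mulr_ge0 // expR_ge0.
have kF i : P i -> kernel wt B be ss (lattice_point R i) z <= F i.1 i.2.
  move=> Pi; have [th0|th0] := ltP 0 (th i.1); last first.
    have -> : kernel wt B be ss (lattice_point R i) z = 0 by rewrite /kernel ifN // thE -leNgt.
    exact: F0.
  have kS : kernel wt B be ss (lattice_point R i) z <=
      expR (- (ss * ln (th i.1)) - c * \sum_k (y i.1 k - (i.2 k)%:R * de ^+ wt k) ^+ 2 / (th i.1) ^+ wt k).
    have := cP (lattice_point R i) z; rewrite thE => /(_ th0); congr (_ <= expR (_ - c * _)).
    by apply: eq_bigr => k _; rewrite [(lattice_point R i).1 k 0]mxE.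
  rewrite /F; have [dth|thd] := leP (de ^+ 2) (th i.1).
    by rewrite andbF mul0r add0r (le_trans kS) // expRD.
  rewrite th0 /= mul1r addr0 (le_trans kS) //.
  have [k0 k0P] : exists k, de ^+ wt k <= `|y i.1 k - (i.2 k)%:R * de ^+ wt k|.
    apply: contrapT => /forallNP none; apply: (Pcell i Pi); split.
      by rewrite thE (ltW th0) ltW.
    by move=> k; rewrite thE [X in _ - X]mxE ltNge; apply/negP; exact: none.
  pose x k := y i.1 k - (i.2 k)%:R * de ^+ wt k; rewrite -/(x k0) in k0P.
  (* Of the two copies of the exponent, one keeps a Gaussian at the scale de^2 for the sum over the
     slice; the other is at least de^2 / th, because z is outside the cell, and controls th^-ss. *)
  have key : \sum_k x k ^+ 2 / (de ^+ 2) ^+ wt k + de ^+ 2 / th i.1 <=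
     2 * \sum_k x k ^+ 2 / th i.1 ^+ wt k.
    have term k : x k ^+ 2 / (de ^+ 2) ^+ wt k <= x k ^+ 2 / th i.1 ^+ wt k.
      rewrite ler_wpM2l ?sqr_ge0 // lef_pV2 ?posrE ?exprn_gt0 //.
      by rewrite lerXn2r ?nnegrE ?(ltW th0) ?(ltW de20) // ltW.
    have big : de ^+ 2 / th i.1 <= x k0 ^+ 2 / th i.1 ^+ wt k0.
      apply: (@le_trans _ _ ((de ^+ 2 / th i.1) ^+ wt k0)).
        rewrite -[leLHS]expr1 ler_weXn2l // ler_pdivlMr // mul1r ltW //.
      rewrite expr_div_n ler_pM2r ?invr_gt0 ?exprn_gt0 // -exprM mulnC exprM.
      by rewrite -[x k0 ^+ 2]real_normK ?num_real // lerXn2r ?nnegrE // exprn_ge0 // ltW.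
    rewrite mulr_natl mulr2n lerD //; first by apply: ler_sum => k _; exact: term.
    rewrite (le_trans big) // (bigD1 k0) //= lerDl sumr_ge0 // => k _.
    by rewrite mulr_ge0 ?sqr_ge0 // invr_ge0 exprn_ge0 // ltW.
  apply: (@le_trans _ _ (expR (- (ss * ln (th i.1)) - c / 2 * de ^+ 2 / th i.1) *
     S (c / 2) (de ^+ 2) i.1 i.2)).
    rewrite -expRD ler_expR; have := ler_wpM2l (ltW c20) key; rewrite /x.
    move: (\sum_k _) (\sum_k _) (ss * _) => X Y Z; rewrite mulrDr !mulrA; lra.
  rewrite ler_wpM2r // (le_trans (le_gaussian_bound ss_gt0 _ th0)) ?mulr_gt0 //.
  rewrite /gb /gaussian_bound -expRD lnM ?posrE // ler_expR; lra.
have step1 : \sum_(i | P i) kernel wt B be ss (lattice_point R i) z <=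
   \sum_(j < H ^ 2) \sum_(m in family (fun k => [pred m : 'I_(H ^ Q) | (m < H ^ wt k)%N])) F j m.
  rewrite pair_big /= big_mkcond [leRHS]big_mkcond; apply: ler_sum => i _ /=.
  case: ifP => Pi; last by case: ifP.
  by have /Plat := Pi; rewrite unfold_in /in_lattice => ->; exact: kF.
apply: le_trans (ler_wpM2l _ step1) _; first by rewrite exprn_ge0 // ltW.
rewrite mulr_sumr.
apply: (@le_trans _ _ (\sum_(j < H ^ 2) ((0 < th j < de ^+ 2)%R%:R * (gb * K2) +
   (if de ^+ 2 <= th j then K1 * (de ^+ 2 * expR ((ka - 1) * ln (th j))) else 0)))).
  apply: ler_sum => j _; rewrite /F big_split mulrDr lerD //.
    rewrite -mulr_sumr mulrCA ler_wpM2l // -mulr_sumr.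
    have := K2P H (de ^+ 2) (y j) H0 (lexx _); rewrite -/Q -/de => h.
    rewrite sqrtr_sqr gtr0_norm // mulVf ?gt_eqF // expr1n mulr1 in h.
    (* The exponents add up to de^(2 ka), and de <= 1. *)
    have dX : de ^+ (Q + 2) * expR (- (ss * ln (de ^+ 2))) <= 1.
      rewrite lnXn // -[de in X in X * _]lnK ?posrE // -expRM_natl -expRD.
      rewrite -[leRHS]expR0 ler_expR natrD -[ln de *+ 2]mulr_natl.
      have lde : ln de <= 0 by rewrite ln_le0.
      have -> : (Q%:R + 2) * ln de - ss * (2 * ln de) = 2 * ka * ln de by rewrite /ka; field.
      by rewrite pmulr_rle0 // mulr_gt0.
    set Y := (\sum_(m in _) _) in h *.
    have Y0 : 0 <= Y by apply: sumr_ge0 => m _; exact: expR_ge0.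
    move: dX; move: (expR (- _)) => X dX.
    have -> : de ^+ (Q + 2) * (gb * X * Y) = gb * (de ^+ (Q + 2) * X * Y) by ring.
    by rewrite ler_pM2l // (le_trans _ h) // ler_piMl.
  case: ifP => dth; last by rewrite big1 ?mulr0.
  have th0 : 0 < th j by exact: lt_le_trans dth.
  have := K1P H (th j) (y j) H0 dth; rewrite -/Q -/de => h.
  rewrite -mulr_sumr mulrCA.
  apply: le_trans (ler_wpM2l (expR_ge0 _) (ler_wpM2l (exprn_ge0 _ (ltW de0)) h)) _.
  rewrite le_eqVlt; apply/orP; left; apply/eqP.
  have dH : de ^+ Q * H%:R ^+ Q = 1 by rewrite -exprMn mulVf ?expr1n // gt_eqF.
  have -> : (ka - 1) * ln (th j) = - (ss * ln (th j)) + Q%:R * (ln (th j) / 2) by rewrite /ka; field.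
  rewrite exprMn sqrtr_expR // -expRM_natl expRD exprD.
  move: (expR _) (expR _) dH; move: (de ^+ Q) (H%:R ^+ Q) => dQ HQ X Y dH.
  transitivity (K1 * (de ^+ 2 * (X * Y)) * (dQ * HQ)); last by rewrite dH mulr1 [Y * X]mulrC.
  by ring.
rewrite big_split /= lerD //.
  rewrite -mulr_suml -[leRHS]mul1r ler_wpM2r ?mulr_ge0 ?(ltW gb0) ?(ltW K20) //.
  exact: sum_spaced_le1.
rewrite -big_mkcond -mulr_sumr ler_pM2l //; apply: time_sum => //.
by rewrite natrX -exprMn mulfV ?gt_eqF // expr1n.
Qed.

(** * The weak type estimate *)

Section Harnack.
Variables (R : realType) (N : nat) (wt : 'I_N -> nat) (B : 'M[R]_N).
Hypothesis B_graded : forall k l, B k l != 0 -> wt l = (wt k).+2.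
Hypothesis B_observable : forall v : 'cV[R]_N,
  (forall j k, wt k = 1 -> (B ^+ j *m v) k 0 = 0) -> v = 0.
Hypothesis wt_gt0 : forall k, (0 < wt k)%N.
Variables be ss lam Lam : R.
Hypothesis be_gt0 : 0 < be.
Hypothesis ss_gt0 : 0 < ss.
Hypothesis lam_gt0 : 0 < lam.
Hypothesis Lam_gt0 : 0 < Lam.
Hypothesis be_lam : be * 4 * lam = 1.
Hypothesis ss_ge : 2 * be * Lam * (wtsum wt)%:R <= ss.
Hypothesis ss_ge2 : (wtsum wt)%:R / 2 <= ss.
Hypothesis ss_lt : ss < (wtsum wt)%:R / 2 + 1.
Local Notation pt := ('cV[R]_N * R)%type.
Local Notation E := (drift_exp wt B).
Local Notation dil := (dilation wt).
Local Notation kernel := (kernel wt B be ss).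
Local Notation solution := (solution_at wt B lam Lam).
Local Notation Q := (wtsum wt).
Local Notation gmap := (gmap wt B).
Local Notation cell := (group_cell wt B).

Lemma gmap01 (z : pt) : gmap (0, 0) 1 z = z.
Proof.
rewrite /gmap /= dilation1 mul1mx mulmx0 addr0 expr1n mul1r add0r.
by case: z.
Qed.

Lemma gmap_zero (z0 : pt) r : gmap z0 r (0, 0) = z0.
Proof. by rewrite /gmap /= mulmx0 mulr0 drift_exp0 mul1mx add0r addr0; case: z0. Qed.

Lemma gmap_surj (z0 z : pt) r : 0 < r -> exists x, gmap z0 r x = z.
Proof.
move=> r0; exists (dil r^-1 *m (z.1 - E (z.2 - z0.2) *m z0.1), (z.2 - z0.2) / r ^+ 2).
have e : r ^+ 2 * ((z.2 - z0.2) / r ^+ 2) = z.2 - z0.2.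
  by rewrite mulrCA mulfV ?mulr1 // expf_neq0 // gt_eqF.
rewrite /gmap /= e mulmxA dilation_mul mulfV ?gt_eqF // dilation1 mul1mx subrK.
by rewrite addrC subrK; case: z {e}.
Qed.

Lemma cell_center (de : R) (ze : pt) : 0 < de -> cell de ze ze.
Proof.
move=> de0; split; first by rewrite subrr lexx sqr_ge0.
by move=> k; rewrite subrr oppr0 drift_exp0 mul1mx subrr normr0 exprn_gt0.
Qed.

Lemma lattice_point_bound (H : nat) (i : lattice_index wt H) : (0 < H)%N -> in_lattice i ->
  `|(lattice_point R i).1| <= 1 /\ -3 <= (lattice_point R i).2 <= -2.
Proof.
move=> H0 /familyP iP; have HR : 0 < H%:R :> R by rewrite ltr0n.
split.
  apply: norm_le_coord => // k j; rewrite mxE exprVn ger0_norm; last first.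
    by rewrite mulr_ge0 // invr_ge0 exprn_ge0 // ltW.
  rewrite ler_pdivrMr ?exprn_gt0 // mul1r -natrX ler_nat ltnW //.
  by have := iP k; rewrite inE.
rewrite lerDl mulr_ge0 ?sqr_ge0 //=.
have : i.1%:R * H%:R^-1 ^+ 2 <= 1 :> R.
  by rewrite exprVn ler_pdivrMr ?exprn_gt0 // mul1r -natrX ler_nat ltnW.
by move: (_ * _) => x; lra.
Qed.

(* Weak type estimate: a set of lattice cells of positive density on which [v >= 1]
   forces a lower bound at later times. *)
Lemma growth_lattice : exists R0 c2 : R, [/\ 3 < R0, 0 < c2 &
  forall (T : R) (v : pt -> R) (z0 : pt) (r : R) (H : nat) (P : pred (lattice_index wt H)),
  T <= 0 -> 0 < r <= 1 -> (0 < H)%N ->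
  (forall z, box R0 (- (7/2)) T z -> {for z, continuous v}) ->
  (forall z, box R0 (- (7/2)) T z -> 0 <= v z) ->
  (forall z, box R0 (- (7/2)) T z -> - (7/2) < z.2 -> `|z.1| < R0 -> solution v z) ->
  {subset P <= @in_lattice N wt H} ->
  (forall i, P i -> let ze := gmap z0 r (lattice_point R i) in
     `|ze.1| <= 3 /\ - (7/2) <= ze.2 <= -2) ->
  (forall i, P i -> forall x, cell H%:R^-1 (lattice_point R i) x -> 1 <= v (gmap z0 r x)) ->
  (H ^ (Q + 2) <= 2 * #|P|)%N ->
  forall z, `|z.1| <= 1 -> -1 <= z.2 <= T -> c2 * r ^+ (Q + 2) <= v z].
Proof.
have [R0 [c1 [R03 c10 gr]]] := growth B_graded B_observable wt_gt0 be_gt0 ss_gt0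
  lam_gt0 Lam_gt0 be_lam ss_ge.
have [CS CS0 CSP] := lattice_sum B_graded B_observable wt_gt0 be_gt0 ss_gt0 ss_ge2 ss_lt.
have C1 : 0 < CS + 1 by rewrite addr_gt0.
exists R0, (c1 / (4 * (CS + 1))); split => //; first by rewrite divr_gt0 // mulr_gt0.
move=> T v z0 r H P T0 /andP[r0 r1] H0 cv v0 sv Plat Pbd P1 Pcard z z1 zT.
set de := H%:R^-1 : R; have HR : 0 < H%:R :> R by rewrite ltr0n.
have de0 : 0 < de by rewrite invr_gt0.
(* With this weight the superposition is at most CS / (2 (CS + 1)) <= 1/2 off the cells; adding 1 to
   CS also keeps the total mass at most 1. *)
pose w := (r * de) ^+ (Q + 2) / (2 * (CS + 1)).
have w0 : 0 < w by rewrite divr_gt0 ?exprn_gt0 ?mulr_gt0.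
pose c (i : lattice_index wt H) := if P i then w else 0.
have cP i : c i != 0 -> P i by rewrite /c; case: ifP; rewrite ?eqxx.
have sumc : \sum_i c i = w * #|P|%:R.
  by rewrite -big_mkcond sumr_const mulr_natr.
have deH : de ^+ (Q + 2) * H%:R ^+ (Q + 2) = 1 by rewrite -exprMn mulVf ?expr1n // gt_eqF.
have rQ : r ^+ (Q + 2) <= 1 by rewrite exprn_ile1 // ltW.
have cardP : #|P|%:R <= H%:R ^+ (Q + 2) :> R.
  rewrite -natrX ler_nat -(card_lattice wt H0).
  rewrite -!sum1_card big_mkcond [leqRHS]big_mkcond; apply: leq_sum => i _.
  by case: ifP => // /Plat; rewrite !inE => ->.
have wE : w * H%:R ^+ (Q + 2) = r ^+ (Q + 2) / (2 * (CS + 1)).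
  by rewrite /w exprMn mulrAC -[_ * _ * H%:R ^+ _]mulrA deH mulr1.
have sum_ge : r ^+ (Q + 2) / (4 * (CS + 1)) <= \sum_i c i.
  have : w * H%:R ^+ (Q + 2) <= w * (2 * #|P|%:R).
    by rewrite ler_pM2l // -natrX -natrM ler_nat.
  rewrite wE sumc; have -> : r ^+ (Q + 2) / (2 * (CS + 1)) = 2 * (r ^+ (Q + 2) / (4 * (CS + 1))).
    by field; rewrite gt_eqF.
  by rewrite [w * (2 * _)]mulrCA ler_pM2l.
have sum_le : \sum_i c i <= 1.
  rewrite sumc (@le_trans _ _ (w * H%:R ^+ (Q + 2))) ?ler_pM2l // wE.
  rewrite ler_pdivrMr ?mulr_gt0 // mul1r (le_trans rQ) //.
  by move: CS0; lra.
have := gr T v _ c (fun i => gmap z0 r (lattice_point R i)) T0 cv v0 sv _ sum_le _ _ z z1 zT.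
move=> h; apply: le_trans (h _ _ _) => {h}.
- by rewrite mulrAC -mulrA ler_pM2l // mulrC.
- by move=> i; rewrite /c; case: ifP => // _; rewrite ltW.
- by move=> i /cP; exact: Pbd.
move=> y by_ vy; have [x xy] := gmap_surj z0 y r0.
(* Since v >= 1 on the image of each cell and v y <= 1/2, the preimage x of y lies in no cell. *)
have Ncell i : P i -> ~ cell de (lattice_point R i) x.
  by move=> Pi /(P1 i Pi); rewrite xy => /le_trans /(_ vy); lra.
split; last first.
  move=> i /cP Pi yi; have := P1 i Pi _ (cell_center (lattice_point R i) de0).
  by rewrite -yi => /le_trans /(_ vy); lra.
have -> : \sum_i c i * kernel (gmap z0 r (lattice_point R i)) y =
    r ^+ (Q + 2) * expR (- (2 * ss * ln r)) / (2 * (CS + 1)) *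
    (de ^+ (Q + 2) * \sum_(i | P i) kernel (lattice_point R i) x).
  rewrite mulrA mulr_sumr [RHS]big_mkcond; apply: eq_bigr => i _.
  rewrite /c -xy (kernel_gmap B_graded) //; case: ifP => _; last by rewrite mul0r.
  by rewrite /w exprMn; ring.
(* The mass r^(Q+2) outweighs the factor r^(-2 ss) of [kernel_gmap], because r <= 1 and ss < Q/2 +
   1. *)
have rr : r ^+ (Q + 2) * expR (- (2 * ss * ln r)) <= 1.
  rewrite -[r in X in X * _]lnK ?posrE // -expRM_natl -expRD -[leRHS]expR0 ler_expR natrD.
  have -> : (Q%:R + 2) * ln r - 2 * ss * ln r = (Q%:R + 2 - 2 * ss) * ln r by ring.
  rewrite mulr_ge0_le0 ?ln_le0 //; move: ss_lt; lra.
have := CSP H H0 P x Plat Ncell; rewrite -/de => le_CS.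
have rr0 : 0 <= r ^+ (Q + 2) * expR (- (2 * ss * ln r)).
  by rewrite mulr_ge0 ?expR_ge0 // exprn_ge0 // ltW.
rewrite mulrAC ler_pdivrMr ?mulr_gt0 //.
apply: (@le_trans _ _ (1 * CS)); first by rewrite ler_pM // mulr_ge0 ?exprn_ge0 ?(ltW de0) //
  sumr_ge0 // => i _; exact: kernel_ge0.
by move: CS0; lra.
Qed.

End Harnack.

(** * Displacement estimates and continuity for the group maps *)

Section GroupMaps.
Variables (R : realType) (N : nat) (wt : 'I_N -> nat) (B : 'M[R]_N).
Hypothesis B_graded : forall k l, B k l != 0 -> wt l = (wt k).+2.
Hypothesis wt_gt0 : forall k, (0 < wt k)%N.
Local Notation pt := ('cV[R]_N * R)%type.
Local Notation E := (drift_exp wt B).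
Local Notation dil := (dilation wt).
Local Notation gmap := (gmap wt B).
Local Notation cell := (group_cell wt B).

Lemma norm_dilation_le r (v : 'cV[R]_N) : 0 <= r <= 1 -> `|dil r *m v| <= r * `|v|.
Proof.
move=> /andP[r0 r1]; apply: norm_le_coord => [|k j]; first exact: mulr_ge0.
rewrite (ord1 j) dilationE normrM ger0_norm ?exprn_ge0 // ler_pM ?exprn_ge0 ?coord_le_norm //.
by rewrite -[leRHS]expr1 ler_wiXn2l.
Qed.

(** All weights are at least 1 and r <= 1, so the displacement is at most linear in r. This rate is
    enough to make geometric radii give summable displacements. *)
Lemma gmap_dist (R0 : R) : 0 <= R0 -> exists2 C, 4 <= C & forall (z0 x : pt) r,
  `|z0.1| <= 2 -> 0 < r <= 1 -> `|x.1| <= R0 -> `|x.2| <= 4 ->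
  `|(gmap z0 r x).1 - z0.1| <= C * r /\ `|(gmap z0 r x).2 - z0.2| <= C * r.
Proof.
move=> R00; have [CE CE1 CEP] := drift_exp_bound wt B.
have CE0 : 0 <= CE := le_trans ler01 CE1.
exists (R0 + 8 * CE + 4) => [|z0 x r z02 /andP[r0 r1] xR x4].
  by rewrite lerDr addr_ge0 // mulr_ge0.
have r2 : r ^+ 2 * `|x.2| <= 4 * r.
  by rewrite expr2 mulrC mulrA ler_pM2r // -[leRHS]mulr1 ler_pM // ltW.
have e2 : `|r ^+ 2 * x.2| <= 4 * r by rewrite normrM normrX gtr0_norm.
split => /=; last first.
  rewrite addrC addKr (le_trans e2) // ler_pM2r // lerDr addr_ge0 // mulr_ge0 //.
have -> : (R0 + 8 * CE + 4) * r = R0 * r + (8 * CE * r + 4 * r) by ring.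
rewrite -addrA (le_trans (ler_normD _ _)) // lerD //.
  rewrite (le_trans (norm_dilation_le _ _)) ?(ltW r0) // mulrC ler_pM2r //.
have [|_ h] := CEP (r ^+ 2 * x.2) z0.1; first by rewrite (le_trans e2) // ler_piMr.
apply: (le_trans h); rewrite (@le_trans _ _ (CE * (4 * r) * 2)) //.
  by rewrite ler_pM ?mulr_ge0 // ler_wpM2l.
have -> : CE * (4 * r) * 2 = 8 * CE * r by ring.
by rewrite lerDl mulr_ge0 // ltW.
Qed.

Lemma norm_dilation r (v : 'cV[R]_N) : 0 <= r -> `|dil r *m v| <= (\sum_k r ^+ wt k) * `|v|.
Proof.
move=> r0; have s0 : 0 <= \sum_k r ^+ wt k by apply: sumr_ge0 => k _; exact: exprn_ge0.
apply: norm_le_coord => [|k j]; first exact: mulr_ge0.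
rewrite (ord1 j) dilationE normrM ger0_norm ?exprn_ge0 // ler_pM ?exprn_ge0 ?coord_le_norm //.
by rewrite (bigD1 k) //= lerDl sumr_ge0 // => i _; exact: exprn_ge0.
Qed.

Lemma gmap_continuous (U : pt -> R) (z0 x : pt) r : 0 < r ->
  {for gmap z0 r x, continuous U} -> {for x, continuous (fun y => U (gmap z0 r y))}.
Proof.
move=> r0 /continuous_ptP cU; apply/continuous_ptP => e e0.
have [d d0 dP] := cU e e0; have [CE CE1 CEP] := drift_exp_bound wt B.
pose K := `|E (r ^+ 2 * x.2) *m z0.1| + 1.
have K0 : 0 < K by rewrite ltr_wpDl.
have CE0 : 0 < CE := lt_le_trans ltr01 CE1.
pose M := \sum_k r ^+ wt k + r ^+ 2 + 1.
have S0 : 0 <= \sum_k r ^+ wt k by apply: sumr_ge0 => k _; rewrite exprn_ge0 // ltW.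
have M0 : 0 < M by rewrite ltr_wpDl // addr_ge0 // sqr_ge0.
have MS : \sum_k r ^+ wt k <= M by rewrite /M -addrA lerDl addr_ge0 // sqr_ge0.
have Mr : r ^+ 2 <= M by rewrite /M addrAC lerDr addr_ge0.
have CK : 0 < 2 * (CE * K) by rewrite !mulr_gt0.
pose m := Num.min (Num.min 4 d) (Num.min (d / 2) (d / (2 * (CE * K)))).
have m0 : 0 < m by rewrite !lt_min ltr0n d0 !divr_gt0.
exists (m / M); first exact: divr_gt0.
move=> y; rewrite ltr_pdivlMr // mulrC => y1; rewrite ltr_pdivlMr // mulrC => y2'.
have e1 : `|dil r *m (y.1 - x.1)| < m.
  by rewrite (le_lt_trans (norm_dilation _ (ltW r0))) // (le_lt_trans _ y1) // ler_wpM2r.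
have e2 : `|r ^+ 2 * (y.2 - x.2)| < m.
  by rewrite normrM ger0_norm ?sqr_ge0 // (le_lt_trans _ y2') // ler_wpM2r.
move: e1 e2; rewrite !lt_min => /andP[_ /andP[y1' _]] /andP[/andP[y4 yd] /andP[_ y2]].
apply: dP => /=.
  have -> : dil r *m y.1 + E (r ^+ 2 * y.2) *m z0.1 - (dil r *m x.1 + E (r ^+ 2 * x.2) *m z0.1) =
     dil r *m (y.1 - x.1) + (E (r ^+ 2 * (y.2 - x.2)) *m (E (r ^+ 2 * x.2) *m z0.1) -
       E (r ^+ 2 * x.2) *m z0.1).
    rewrite mulmxA -(drift_expD B_graded) -mulrDr subrK mulmxBr opprD.
    by rewrite addrACA.
  rewrite (le_lt_trans (ler_normD _ _)) //.
  have [|_ h] := CEP (r ^+ 2 * (y.2 - x.2)) (E (r ^+ 2 * x.2) *m z0.1).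
    exact: ltW.
  have -> : d = d / 2 + d / 2 by field.
  rewrite ltrD // (le_lt_trans h) //.
  rewrite (@le_lt_trans _ _ (CE * `|r ^+ 2 * (y.2 - x.2)| * K)) //.
    by rewrite ler_pM ?mulr_ge0 ?(ltW CE0) // ?ler_pM2l // lerDl.
  rewrite mulrAC mulrC -ltr_pdivlMr ?mulr_gt0 //.
  by rewrite (lt_le_trans y2) // le_eqVlt; apply/orP; left; apply/eqP; field; rewrite !gt_eqF.
by have -> : z0.2 + r ^+ 2 * y.2 - (z0.2 + r ^+ 2 * x.2) = r ^+ 2 * (y.2 - x.2) by ring.
Qed.

(** Lets uniform continuity carry a bound from a lattice point to its whole cell. *)
Lemma cell_close : exists2 C, 0 < C & forall (de : R) (ze x : pt), 0 < de <= 1 ->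
  `|ze.1| <= 1 -> cell de ze x -> `|x.1 - ze.1| <= C * de /\ `|x.2 - ze.2| <= C * de.
Proof.
have [CE CE1 CEP] := drift_exp_bound wt B.
have CE0 : 0 < CE := lt_le_trans ltr01 CE1.
exists (2 * CE + 1) => [|de ze x /andP[de0 de1] ze1 [/andP[t0 tde] xP]].
  by rewrite addr_gt0 ?mulr_gt0.
have dd : de ^+ 2 <= de by rewrite expr2 ler_piMl // ltW.
have td : `|x.2 - ze.2| <= de by rewrite ger0_norm // (le_trans tde).
split; last by rewrite (le_trans td) // ler_peMl ?(ltW de0) // lerDr mulr_ge0 // ltW.
set x' := E (- (x.2 - ze.2)) *m x.1 in xP.
have xx : x.1 = E (x.2 - ze.2) *m x' by rewrite mulmxA drift_expNK // mul1mx.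
have d1 : `|x' - ze.1| <= de.
  apply: norm_le_coord => [|k j]; first exact: ltW.
  rewrite (ord1 j) !mxE; have := xP k; rewrite mxE => /ltW/le_trans; apply.
  by rewrite -[leRHS]expr1 ler_wiXn2l // ltW.
have x'2 : `|x'| <= 2.
  by rewrite (le_trans (norm_le_addr d1)) // (_ : 2 = 1 + 1) ?lerD //; ring.
have [|_ h] := CEP (x.2 - ze.2) x'; first by rewrite (le_trans td) // (le_trans de1) // ler1n.
have -> : (2 * CE + 1) * de = CE * de * 2 + de by ring.
rewrite xx -(subrK x' (E _ *m x')) -addrA (le_trans (ler_normD _ _)) // lerD //.
by rewrite (le_trans h) // ler_pM ?mulr_ge0 ?(ltW CE0) // ler_pM2l.
Qed.

End GroupMaps.

(** With n = Q + 2 this is the ratio of consecutive radii: the loss th^(Q+2) is compensated by the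
    gain 1 + ka. Bernoulli's inequality shows that 1 - x works for the small x chosen below. *)
Lemma pow_le_neg (R : realFieldType) (n : nat) (ka : R) : 0 < ka ->
  exists2 th : R, 0 < th < 1 & 1 <= th ^+ n * (1 + ka).
Proof.
move=> ka0.
pose x := ka / (2 * (1 + ka) * n.+1%:R).
have p : 0 < 2 * (1 + ka) * n.+1%:R by rewrite !mulr_gt0 // addr_gt0.
have x0 : 0 < x by exact: divr_gt0.
have nx : n%:R * x <= ka / (1 + ka).
  rewrite /x [leRHS](_ : _ = 2 * n.+1%:R * (ka / (2 * (1 + ka) * n.+1%:R))); last first.
    by field; rewrite !gt_eqF // ltr_pwDl // ltW.
  rewrite ler_pM2r ?divr_gt0 // -natr1; have := ler0n R n; lra.
have x1 : x < 1.
  rewrite ltr_pdivrMr // mul1r.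
  apply: (@lt_le_trans _ _ (2 * (1 + ka))); first by move: ka0; lra.
  by rewrite ler_peMr ?ler1n // mulr_ge0 // addr_ge0 // ltW.
have bern m : 1 - m%:R * x <= (1 - x) ^+ m.
  elim: m => [|m IH]; first by rewrite mul0r subr0 expr0.
  rewrite exprSr (le_trans _ (ler_wpM2r _ IH)) ?subr_ge0 ?(ltW x1) //.
  have -> : (1 - m%:R * x) * (1 - x) = 1 - (m%:R + 1) * x + m%:R * x ^+ 2 by ring.
  by rewrite natr1 lerDl mulr_ge0 ?sqr_ge0.
exists (1 - x); first by apply/andP; split; move: x0 x1; lra.
rewrite (le_trans _ (ler_wpM2r _ (bern n))) ?addr_ge0 ?(ltW ka0) //.
have h : ka / (1 + ka) * (1 + ka) = ka by rewrite divfK // gt_eqF // addr_gt0.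
have := ler_wpM2r (addr_ge0 ler01 (ltW ka0)) nx; rewrite h => h2.
by rewrite mulrBl mul1r lerBrDr addrC; move: h2; rewrite -lerBrDl; lra.
Qed.

Lemma bernoulli_unbounded (R : realType) (ka a b : R) : 0 < ka -> 0 < a ->
  exists k, b < (1 + ka) ^+ k * a.
Proof.
move=> ka0 a0.
have [k hk] : exists k : nat, b / (a * ka) < k%:R.
  exists (Num.bound `|b / (a * ka)|).
  by rewrite (le_lt_trans (ler_norm _)) // archi_boundP.
exists k; move: hk; rewrite ltr_pdivrMr ?mulr_gt0 // => hk.
have bern m : 1 + m%:R * ka <= (1 + ka) ^+ m.
  elim: m => [|m IH]; first by rewrite mul0r addr0 expr0.
  rewrite exprSr (le_trans _ (ler_wpM2r _ IH)) ?addr_ge0 ?(ltW ka0) //.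
  have -> : (1 + m%:R * ka) * (1 + ka) = 1 + (m%:R + 1) * ka + m%:R * ka ^+ 2 by ring.
  by rewrite natr1 lerDl mulr_ge0 ?sqr_ge0.
rewrite (lt_le_trans hk) // mulrCA mulrC ler_pM2r // (le_trans _ (bern k)) // lerDr ler01 //.
Qed.

Lemma leq_half_sum (n a b : nat) : n = (a + b)%N -> (n <= 2 * a)%N \/ (n <= 2 * b)%N.
Proof. lia. Qed.

(** * The Harnack inequality at unit scale *)

Section HarnackUnit.
Variables (R : realType) (N : nat) (wt : 'I_N -> nat) (B : 'M[R]_N).
Hypothesis B_graded : forall k l, B k l != 0 -> wt l = (wt k).+2.
Hypothesis B_observable : forall v : 'cV[R]_N,
  (forall j k, wt k = 1 -> (B ^+ j *m v) k 0 = 0) -> v = 0.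
Hypothesis wt_gt0 : forall k, (0 < wt k)%N.
Variables be ss lam Lam : R.
Hypothesis be_gt0 : 0 < be.
Hypothesis ss_gt0 : 0 < ss.
Hypothesis lam_gt0 : 0 < lam.
Hypothesis Lam_gt0 : 0 < Lam.
Hypothesis be_lam : be * 4 * lam = 1.
Hypothesis ss_ge : 2 * be * Lam * (wtsum wt)%:R <= ss.
Hypothesis ss_ge2 : (wtsum wt)%:R / 2 <= ss.
Hypothesis ss_lt : ss < (wtsum wt)%:R / 2 + 1.
Local Notation pt := ('cV[R]_N * R)%type.
Local Notation solution := (solution_at wt B lam Lam).
Local Notation Q := (wtsum wt).
Local Notation gmap := (gmap wt B).
Local Notation cell := (group_cell wt B).

Definition nonneg_solution (r : R) (U : pt -> R) := forall z : pt, `|z.1| <= r -> -4 < z.2 < 0 ->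
  [/\ {for z, continuous U}, 0 <= U z & solution U z].

(* At a point [zs] where [U >= M], at scale [r] around [zs], either [U >= M/2] on half of the
   lattice points, and the weak type estimate bounds [U zp] below, or [U < M/2] on half
   of them, and growth applied to [sup U - U] shows that [U] exceeds [(1+ka) M] nearby. *)
Lemma growth_step : exists R1 C3 C1 ka : R, [/\ [/\ 3 < R1, 4 <= C3, 0 < C1 & 0 < ka] &
  forall (U : pt -> R) (zp zs : pt) (r M : R), nonneg_solution R1 U ->
  `|zp.1| <= 1 -> -1 <= zp.2 < 0 -> `|zs.1| <= 2 -> - (13 / 4) <= zs.2 <= -2 ->
  0 < r -> C3 * r <= 1 / 4 -> 0 < M -> M <= U zs -> C1 * U zp < M * r ^+ (Q + 2) ->
  exists z, [/\ `|z.1 - zs.1| <= C3 * r, `|z.2 - zs.2| <= C3 * r, z.2 <= zs.2 &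
                (1 + ka) * M <= U z]].
Proof.
have [R0 [c2 [R03 c20 gr]]] := growth_lattice B_graded B_observable wt_gt0 be_gt0 ss_gt0
  lam_gt0 Lam_gt0 be_lam ss_ge ss_ge2 ss_lt.
have R00 : 0 <= R0 by move: R03; lra.
have [C3 C34 C3P] := gmap_dist B wt_gt0 R00.
have [Cc Cc0 CcP] := cell_close B_graded wt_gt0.
have C30 : 0 < C3 by move: C34; lra.
(* An oscillation of M/4 on cells turns U >= M/2 into 4 U / M >= 1, and U < M/2 into S - U >= S - 3
   M/4 with S the local maximum. The first yields C1 = 4 / c2, the second a gain of at least c2
   M/4. *)
exists R0, C3, (4 / c2), (c2 / 4); split; first by split => //; rewrite divr_gt0.
move=> U zp zs r M solU zp1 /andP[zpt zp0] zs1 /andP[zst zs2] r0 C3r M0 UM small.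
have r14 : r <= 1 / 4.
  apply: le_trans C3r; rewrite ler_peMl ?(ltW r0) //; move: C34; lra.
have r1 : 0 < r <= 1 by rewrite r0 /=; move: r14; lra.
have near x : `|x.1| <= R0 -> - (7 / 2) <= x.2 <= 0 ->
   [/\ `|(gmap zs r x).1 - zs.1| <= C3 * r, `|(gmap zs r x).2 - zs.2| <= C3 * r
     & (gmap zs r x).2 <= zs.2].
  move=> xR /andP[x1 x2]; have [|h1 h2] := C3P zs x r zs1 r1 xR.
    by rewrite ler0_norm //; move: x1; lra.
  split => //; rewrite /gmap /= gerDl mulr_ge0_le0 ?sqr_ge0 //.
have dom x : `|x.1| <= R0 -> - (7 / 2) <= x.2 <= 0 ->
   [/\ `|(gmap zs r x).1| <= 9 / 4, - (7 / 2) <= (gmap zs r x).2 <= -2 &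
    [/\ {for gmap zs r x, continuous U}, 0 <= U (gmap zs r x) & solution U (gmap zs r x)]].
  move=> xR xt; have [h1 h2 h3] := near x xR xt.
  have n1 : `|(gmap zs r x).1| <= 9 / 4.
    by rewrite (le_trans (norm_le_addr (le_trans h1 C3r))) //; move: zs1; lra.
  have t1 : - (7 / 2) <= (gmap zs r x).2 <= -2.
    have := le_trans h2 C3r; rewrite ler_norml => /andP[h4 _].
    by apply/andP; split; [move: h4 zst; lra|exact: le_trans h3 zs2].
  split => //; apply: solU; first by rewrite (le_trans n1) //; move: R03; lra.
  by case/andP: t1 => t1 t2; apply/andP; split; [move: t1|move: t2]; lra.
pose V x := U (gmap zs r x).
have cV x : box R0 (- (7/2)) 0 x -> {for x, continuous V}.
  by move=> [xR xt]; have [_ _ [cU _ _]] := dom x xR xt; apply: gmap_continuous cU => //; case/andP: r1.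
(* The mesh chosen from here depends on U and zs, whereas c2 is uniform in the mesh. *)
have [|d d0 dP] := box_unif_continuous cV (e := M / 4); first by rewrite divr_gt0.
have [H H0 HP] : exists2 H, (0 < H)%N & Cc * H%:R^-1 < d.
  exists (Num.bound `|Cc / d|).+1 => //.
  rewrite ltr_pdivrMr // mulrC -ltr_pdivrMr //.
  by rewrite (le_lt_trans (ler_norm _)) // (lt_trans (archi_boundP _)) ?ltr_nat.
have HR : 0 < H%:R :> R by rewrite ltr0n.
have de01 : 0 < (H%:R^-1 : R) <= 1 by rewrite invr_gt0 HR invf_le1 // ler1n.
have latbox i : @in_lattice N wt H i -> box R0 (- (7/2)) 0 (lattice_point R i).
  move=> /(lattice_point_bound R H0)[l1 /andP[l2 l3]].
  by split; [move: l1 R03; lra|apply/andP; split; [move: l2|move: l3]; lra].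
have osc i : @in_lattice N wt H i -> forall x, cell H%:R^-1 (lattice_point R i) x ->
    `|V x - V (lattice_point R i)| <= M / 4.
  move=> li x cx; have [l1 _] := lattice_point_bound R H0 li.
  have [h1 h2] := CcP _ _ _ de01 l1 cx; apply: dP (latbox i li) _ _.
    exact: le_lt_trans h1 HP.
  exact: le_lt_trans h2 HP.
pose P1 := [pred i : lattice_index wt H | in_lattice i && (M / 2 <= V (lattice_point R i))].
pose P2 := [pred i : lattice_index wt H | in_lattice i && (V (lattice_point R i) < M / 2)].
have card12 : (H ^ (Q + 2) = #|P1| + #|P2|)%N.
  rewrite -(card_lattice wt H0) -!sum1_card [LHS]big_mkcond [X in (X + _)%N]big_mkcond.
  rewrite [X in (_ + X)%N]big_mkcond -big_split; apply: eq_bigr => i _ /=.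
  by rewrite !inE; case: (in_lattice i) => //=; case: leP.
have [c1|c2'] := leq_half_sum card12.
- exfalso.
  have domU z : box R0 (- (7/2)) zp.2 z -> [/\ {for z, continuous U}, 0 <= U z & solution U z].
    move=> [zR /andP[z1 z2]]; apply: solU => //.
    by apply/andP; split; [move: z1; lra|exact: le_lt_trans z2 zp0].
  have M4 : 0 < 4 / M by rewrite divr_gt0.
  (* The solution stays at unit scale and only the lattice is shrunk to size r around zs, so the
     bound reaches zp at the cost of r^(Q+2). *)
  have := gr zp.2 (fun z => 4 / M * U z + 0) zs r H P1 (ltW zp0) r1 H0.
  move=> /(_ _ _ _ _ _ _ c1 zp zp1 _) h.
  have : c2 * r ^+ (Q + 2) <= 4 / M * U zp + 0.
    apply: h.
    + move=> z /domU[cU _ _]; apply: cvgD; last exact: cvg_cst.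
      by apply: cvgM; [exact: cvg_cst|exact: cU].
    + by move=> z /domU[_ U0 _]; rewrite addr0 mulr_ge0 // ltW.
    + by move=> z /domU[_ _ sU] _ _; exact: solution_affine.
    + by move=> i /andP[].
    + move=> i /andP[li _] /=; have [lR lt] := latbox i li; have [h1 h2 _] := dom _ lR lt.
      by split => //; move: h1; lra.
    + move=> i /andP[li Vi] x cx; have := osc i li x cx; rewrite ler_norml => /andP[h1 _].
      rewrite addr0 mulrAC ler_pdivlMr // mul1r -/(V x).
      by move: h1 Vi; move: (V x) (V _) => a b; lra.
    + by rewrite zpt lexx.
  rewrite addr0 mulrAC ler_pdivlMr // => h2.
  have := small; rewrite -(ltr_pM2l c20).
  have -> : c2 * (4 / c2 * U zp) = 4 * U zp by field; rewrite gt_eqF.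
  by move=> /(le_lt_trans h2); rewrite mulrA mulrAC ltxx.
have [||zm zmD zmax] := @compact_EVT_max _ R V _ _ (@box_compact R N R0 (- (7/2)) 0).
- by exists (0, 0); split; rewrite /= ?normr0 // lexx andbT; lra.
- by apply: continuous_in_subspaceT => z /set_mem /cV.
move: zmD; rewrite inE => -[zmR zmt]; have [n1 n2 n3] := near zm zmR zmt.
exists (gmap zs r zm); split => //.
have VM x : box R0 (- (7/2)) 0 x -> V x <= V zm by move=> bx; apply: zmax; rewrite inE.
have V0 : M <= V (0, 0) by rewrite /V gmap_zero.
have b0 : box R0 (- (7/2)) 0 ((0, 0) : pt).
  by split; rewrite /= ?normr0 // lexx andbT; lra.
have SM : M <= V zm := le_trans V0 (VM _ b0).
rewrite -/(V zm); set S := V zm in SM VM *.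
have S34 : 0 < S - 3 / 4 * M by move: SM M0; lra.
pose v x := - (S - 3 / 4 * M)^-1 * V x + S / (S - 3 / 4 * M).
have vE x : v x = (S - V x) / (S - 3 / 4 * M) by rewrite /v; ring.
(* Here the solution itself is rescaled around zs and the lattice has r = 1, so no power of r is
   lost; the bound is read at the origin, which stands for zs. *)
have := gr 0 v (0, 0) 1 H P2 (lexx _) _ H0.
move=> /(_ _ _ _ _ _ _ _ c2' (0, 0)) h.
have : c2 * 1 ^+ (Q + 2) <= v (0, 0).
  apply: h.
  + by rewrite ltr01 lexx.
  + move=> z /cV cVz; apply: cvgD; last exact: cvg_cst.
    by apply: cvgM; [exact: cvg_cst|exact: cVz].
  + by move=> z bz; rewrite vE divr_ge0 ?(ltW S34) // subr_ge0 VM.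
  + move=> z [zR zt] _ _; apply: solution_affine.
    by apply: (solution_gmap B_graded) => //; have [_ _ []] := dom z zR zt.
  + by move=> i /andP[].
  + move=> i /andP[li _]; rewrite gmap01; have [l1 /andP[l2 l3]] := lattice_point_bound R H0 li.
    split; first by apply: le_trans l1 _; rewrite ler1n.
    by apply/andP; split; [apply: le_trans l2; lra|exact: l3].
  + move=> i /andP[li Vi] x cx; rewrite gmap01 vE ler_pdivlMr // mul1r.
    have := osc i li x cx; rewrite ler_norml => /andP[_ h2].
    by move: h2 Vi; move: (V x) (V _) => a b; lra.
  + by rewrite /= normr0.
  + by rewrite /= lexx andbT; lra.
rewrite expr1n mulr1 vE ler_pdivlMr // => h2.
have h3 : c2 * (M / 4) <= c2 * (S - 3 / 4 * M) by rewrite ler_pM2l //; move: SM; lra.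
have h4 := le_trans h3 h2; rewrite mulrDl mul1r.
by move: h4 V0; move: (V (0, 0)) => a; lra.
Qed.

End HarnackUnit.

(** With M_k = (1 + ka)^k U(zm) and r_k = r0 th^k, the product M_k r_k^(Q+2) does not decrease, so
    the smallness of U(zp) required by [growth_step] persists and the chain of points never
    stops. *)
Lemma harnack_unit (R : realType) (N : nat) (wt : 'I_N -> nat) (B : 'M[R]_N)
    (B_graded : forall k l, B k l != 0 -> wt l = (wt k).+2)
    (B_observable : forall v : 'cV[R]_N,
      (forall j k, wt k = 1 -> (B ^+ j *m v) k 0 = 0) -> v = 0)
    (wt_gt0 : forall k, (0 < wt k)%N) (lam Lam : R) (lam_gt0 : 0 < lam) (Lam_gt0 : 0 < Lam)
    (Q_gt0 : (0 < wtsum wt)%N) (cordes : Lam / lam < 1 + 2 / (wtsum wt)%:R) :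
  exists R1 C : R, [/\ 3 < R1, 0 < C &
  forall (U : 'cV[R]_N * R -> R) (zm zp : 'cV[R]_N * R), nonneg_solution wt B lam Lam R1 U ->
    `|zm.1| <= 1 -> -3 <= zm.2 <= -2 -> `|zp.1| <= 1 -> -1 <= zp.2 < 0 -> U zm <= C * U zp].
Proof.
set Q := wtsum wt in Q_gt0 cordes *.
have QR : 0 < Q%:R :> R by rewrite ltr0n.
(* Both lower bounds on ss are below Q/2 + 1: for the first, 2 be Lam Q = (Lam / lam) Q/2, this is
   the Cordes-Landis condition. *)
pose be := (4 * lam)^-1; pose ss := Num.max (2 * be * Lam * Q%:R) (Q%:R / 2).
have be0 : 0 < be by rewrite invr_gt0 mulr_gt0.
have be_lam : be * 4 * lam = 1 by rewrite /be; field; rewrite gt_eqF.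
have ss1 : 2 * be * Lam * Q%:R <= ss by rewrite le_max lexx.
have ss2 : Q%:R / 2 <= ss by rewrite le_max lexx orbT.
have ss0 : 0 < ss by apply: lt_le_trans ss2; rewrite divr_gt0.
have ss3 : ss < Q%:R / 2 + 1.
  rewrite gt_max; apply/andP; split; last by rewrite ltrDl.
  have -> : 2 * be * Lam * Q%:R = Lam / lam * (Q%:R / 2) by rewrite /be; field; rewrite gt_eqF.
  have -> : Q%:R / 2 + 1 = (1 + 2 / Q%:R) * (Q%:R / 2) :> R by field; rewrite gt_eqF.
  by rewrite ltr_pM2r // divr_gt0.
have [R1 [C3 [C1 [ka [[R13 C34 C10 ka0] step]]]]] := growth_step B_graded B_observable wt_gt0
  be0 ss0 lam_gt0 Lam_gt0 be_lam ss1 ss2 ss3.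
have [th /andP[th0 th1] thP] := pow_le_neg (Q + 2) ka0.
have C30 : 0 < C3 := lt_le_trans (ltr0n R 4) C34.
(* Makes the displacements C3 r0 th^k add up to at most 1/4. *)
pose r0 := (1 - th) / (4 * C3).
have r00 : 0 < r0 by rewrite divr_gt0 ?mulr_gt0 // subr_gt0.
have rQ : 0 < r0 ^+ (Q + 2) by exact: exprn_gt0.
exists R1, (C1 / r0 ^+ (Q + 2)); split => //; first exact: divr_gt0.
move=> U zm zp solU zm1 /andP[zm2 zm3] zp1 zp2; rewrite leNgt; apply/negP => big.
have Uzp : 0 <= U zp.
  have [||_ //] := solU zp; first by rewrite (le_trans zp1) // ltW // (lt_trans _ R13) // ltr1n.
  by case/andP: zp2 => h ->; rewrite andbT (lt_le_trans _ h) // ltrN2 ltr1n.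
have M0 : 0 < U zm by apply: le_lt_trans big; rewrite mulr_ge0 // divr_ge0 // ltW.
have big2 : C1 * U zp < U zm * r0 ^+ (Q + 2) by rewrite -ltr_pdivrMr // mulrAC.
have thk k : 0 < th ^+ k <= 1 by rewrite exprn_gt0 //= exprn_ile1 // ltW.
have geom k : (1 - th ^+ k) / 4 + C3 * (r0 * th ^+ k) = (1 - th ^+ k.+1) / 4.
  by rewrite exprS /r0; field; rewrite gt_eqF.
have quarter k : (1 - th ^+ k) / 4 <= 1 / 4.
  by rewrite ler_pM2r ?invr_gt0 // gerBl; have /andP[/ltW] := thk k.
have chain k : exists z : 'cV[R]_N * R, [/\ `|z.1 - zm.1| <= (1 - th ^+ k) / 4,
    `|z.2 - zm.2| <= (1 - th ^+ k) / 4, z.2 <= -2 & (1 + ka) ^+ k * U zm <= U z].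
  elim: k => [|k [z [z1 z2 z3 Uz]]].
    by exists zm; split; rewrite ?subrr ?normr0 ?mul0r ?expr0 ?mul1r.
  have Mk : 0 < (1 + ka) ^+ k * U zm by rewrite mulr_gt0 // exprn_gt0 // addr_gt0.
  have [|||||w [w1 w2 w3 w4]] := step U zp z (r0 * th ^+ k) _ solU zp1 zp2 _ _ _ _ Mk Uz.
  - have := norm_le_addr (le_trans z1 (quarter k)); move: zm1; lra.
  - rewrite z3 andbT; have := le_trans z2 (quarter k); rewrite ler_norml; move: zm2; lra.
  - by rewrite mulr_gt0 //; case/andP: (thk k).
  - have := geom k; have := quarter k.+1; have /andP[_] := thk k; lra.
  - apply: lt_le_trans big2 _; rewrite -/Q.
    have -> : (r0 * th ^+ k) ^+ (Q + 2) = r0 ^+ (Q + 2) * (th ^+ (Q + 2)) ^+ k.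
      by rewrite exprMn -!exprM [(k * _)%N]mulnC.
    have -> : (1 + ka) ^+ k * U zm * (r0 ^+ (Q + 2) * (th ^+ (Q + 2)) ^+ k) =
      U zm * r0 ^+ (Q + 2) * (th ^+ (Q + 2) * (1 + ka)) ^+ k.
      rewrite [(th ^+ (Q + 2) * (1 + ka)) ^+ k]exprMn.
      by move: ((th ^+ (Q + 2)) ^+ k) ((1 + ka) ^+ k) (r0 ^+ (Q + 2)) => x y w; ring.
    by rewrite ler_peMr ?mulr_ge0 ?(ltW M0) ?(ltW rQ) // exprn_ege1.
  exists w; split.
  - have -> : w.1 - zm.1 = (w.1 - z.1) + (z.1 - zm.1) by rewrite addrA subrK.
    by rewrite (le_trans (ler_normD _ _)) // -geom addrC lerD.
  - have -> : w.2 - zm.2 = (w.2 - z.2) + (z.2 - zm.2) by rewrite addrA subrK.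
    by rewrite (le_trans (ler_normD _ _)) // -geom addrC lerD.
  - exact: le_trans w3 z3.
  - by rewrite exprS -mulrA.
(* The chain stays within 1/4 of zm and never moves to later times, so it remains in this compact
   box, on which U is bounded. *)
have [||zx _ zxmax] := @compact_EVT_max _ R U _ _ (@box_compact R N 2 (- (13/4)) (-2)).
- by exists zm; split; [move: zm1|rewrite zm3 andbT; move: zm2]; lra.
- apply: continuous_in_subspaceT => z /set_mem [z1 /andP[z2 z3]].
  have [||//] := solU z; first by move: z1 R13; lra.
  by apply/andP; split; [move: z2|move: z3]; lra.
have [k kP] := bernoulli_unbounded (U zx) ka0 M0.
have [z [z1 z2 z3 Uz]] := chain k.
have : U z <= U zx.
  apply: zxmax; rewrite inE; split.
    have := norm_le_addr (le_trans z1 (quarter k)); move: zm1; lra.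
  rewrite z3 andbT; have := le_trans z2 (quarter k); rewrite ler_norml; move: zm2; lra.
by move=> /(le_trans Uz)/(lt_le_trans kP); rewrite ltxx.
Qed.

(** * C^2 solutions satisfy the pointwise equation on lines and drift curves *)

Section ClassicalSolutions.
Variables (R : realType) (n : nat) (p : 'I_n.+1 -> nat).
Local Notation N := (dimN p).
Local Notation pt := ('cV[R]_N * R)%type.
Implicit Types (f : pt -> R) (z c : pt) (L : option 'I_N -> R).

Definition coordinate c (k : option 'I_N) : R := if k is Some i then c.1 i 0 else c.2.

Definition linform L c := \sum_i c.1 i 0 * L (Some i) + c.2 * L None.

Lemma coordinate_le c k : `|coordinate c k| <= `|c|.
Proof.
rewrite prod_normE /= le_max; case: k => [i|] /=; last by rewrite lexx orbT.
by rewrite coord_le_norm.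
Qed.

Lemma norm_dir k : `|@dir R n p k| <= 1.
Proof.
rewrite prod_normE /= ge_max; case: k => [i|] /=; rewrite ?normr0 ?normr1 ?ler01 ?lexx ?andbT //=.
by apply: norm_le_coord => // a b; rewrite mxE; case: (_ && _); rewrite ?normr1 ?normr0.
Qed.

Definition all_dirs : seq (option 'I_N) := None :: [seq Some i | i <- enum 'I_N].

Lemma sum_all_dirs (V : zmodType) (F : option 'I_N -> V) :
  \sum_(k <- all_dirs) F k = \sum_i F (Some i) + F None.
Proof. by rewrite big_cons big_map big_enum addrC. Qed.

Lemma coordinate_sum c : \sum_(k <- all_dirs) coordinate c k *: @dir R n p k = c.
Proof.
have s1 (l : seq (option 'I_N)) (F : option 'I_N -> pt) :
  (\sum_(k <- l) F k).1 = \sum_(k <- l) (F k).1 by apply: (big_morph (fun x : pt => x.1)).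
have s2 (l : seq (option 'I_N)) (F : option 'I_N -> pt) :
  (\sum_(k <- l) F k).2 = \sum_(k <- l) (F k).2 by apply: (big_morph (fun x : pt => x.2)).
rewrite [LHS]surjective_pairing s1 s2 !sum_all_dirs /= [RHS]surjective_pairing.
congr (_, _).
  rewrite scaler0 addr0; apply/matrixP => i j; rewrite (ord1 j) summxE (bigD1 i) //=.
  rewrite big1 ?addr0 => [|k ki]; rewrite !mxE ?eqxx ?mulr1 //.
  by rewrite eq_sym (negbTE ki) mulr0.
by rewrite big1 ?add0r => [|i _]; rewrite /GRing.scale /= ?mulr1 ?mulr0.
Qed.

Lemma is_derive_line f z v (t : R) : derivable f (z + t *: v) v ->
  is_derive t 1 (fun s => f (z + s *: v)) ('D_v f (z + t *: v)).
Proof.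
have e : (fun h : R => h^-1 *: (((fun s => f (z + s *: v)) \o shift t) (h *: (1 : R)) - f (z + t *: v))) =
  (fun h : R => h^-1 *: ((f \o shift (z + t *: v)) (h *: v) - f (z + t *: v))).
  apply/funext => h /=; congr (_ *: (f _ - _)).
  by rewrite scaler1 scalerDl addrCA.
move=> df; apply: DeriveDef; first by rewrite /derivable e.
by rewrite /derive e.
Qed.

Definition has_diff f z L := forall e, 0 < e -> exists2 d, 0 < d &
  forall c, `|c| < d -> `|f (z + c) - f z - linform L c| <= e * `|c|.

(** The point z + c is reached along one coordinate direction at a time, with the mean value bound
    on each leg; the induction is on the list of directions. *)
Lemma has_diff_C1 f z :
  (\forall y \near z, forall k, derivable f y (@dir R n p k)) ->
  (forall k, {for z, continuous (fun y => 'D_(@dir R n p k) f y)}) ->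
  has_diff f z (fun k => 'D_(@dir R n p k) f z).
Proof.
move=> df cD.
pose D k y := 'D_(@dir R n p k) f y.
pose S l c := \sum_(k <- l) coordinate c k *: @dir R n p k.
have normS l c : `|S l c| <= (size l)%:R * `|c|.
  rewrite (le_trans (ler_norm_sum _ _ _)) // (@le_trans _ _ (\sum_(k <- l) `|c|)) //.
    apply: ler_sum => k _; rewrite normrZ -[leRHS]mulr1 ler_pM ?norm_dir ?coordinate_le //.
  by rewrite big_const_seq count_predT iter_addr_0 mulr_natl.
suff h l e : 0 < e -> exists2 d, 0 < d & forall c, `|c| < d ->
    `|f (z + S l c) - f z - \sum_(k <- l) coordinate c k * D k z| <= e * `|c|.
  move=> e e0; have [d d0 dP] := h all_dirs e e0; exists d => // c /dP.
  by rewrite sum_all_dirs /S coordinate_sum.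
elim: l e => [|k l IHl] e e0.
  by exists 1 => // c _; rewrite /S !big_nil addr0 !subrr normr0 mulr_ge0 // ltW.
have e20 : 0 < e / 2 by rewrite divr_gt0.
have [d1 d10 IH] := IHl _ e20.
have /nbhs_normP[d2 /= d20 d2P] := df.
have /cvgrPdist_le/(_ _ e20)/nbhs_normP[d3 /= d30 d3P] := cD k.
(* After size l legs of length at most |c|, one more leg has to stay in the common neighbourhood. *)
pose m := (size l).+1%:R : R; have m0 : 0 < m by rewrite ltr0n.
exists (Num.min d1 (Num.min d2 d3 / m)).
  by rewrite lt_min d10 divr_gt0 // lt_min d20.
move=> c; rewrite lt_min => /andP[/IH h1]; rewrite ltr_pdivlMr // => cm.
pose y := z + S l c.
pose dd := Num.min d2 d3 / m.
have near_y (s : R) : `|s| < dd -> `|z - (y + s *: @dir R n p k)| < Num.min d2 d3.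
  move=> sc; rewrite distrC addrAC /y (addrAC z) subrr add0r.
  rewrite (le_lt_trans (ler_normD _ _)) //.
  have -> : Num.min d2 d3 = Num.min d2 d3 / m * (size l)%:R + dd.
    by rewrite /dd -[X in _ + X]mulr1 -mulrDr natr1 divfK // gt_eqF.
  rewrite ler_ltD //.
    by rewrite (le_trans (normS _ _)) // mulrC ler_wpM2r // ltW // ltr_pdivlMr.
  by rewrite normrZ (le_lt_trans _ sc) // ler_piMr // norm_dir.
pose g (s : R) := f (y + s *: @dir R n p k) - s * D k z.
have dg (s : R) : `|s| < dd -> is_derive s 1 g (D k (y + s *: @dir R n p k) - D k z).
  move=> /near_y; rewrite lt_min => /andP[sd _].
  have ? : is_derive s 1 (fun s => f (y + s *: @dir R n p k)) (D k (y + s *: @dir R n p k)).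
    by apply: is_derive_line; exact: d2P sd k.
  by apply: is_derive_eq; rewrite /GRing.scale /= mulr0 mulr1 add0r.
have cdd : `|coordinate c k| < dd.
  by rewrite (le_lt_trans (coordinate_le _ _)) // ltr_pdivlMr.
have := @mean_value_le _ _ _ _ (e / 2) dg _ cdd; move=> mv.
have bd x : `|x| <= `|coordinate c k| -> `|D k (y + x *: @dir R n p k) - D k z| <= e / 2.
  move=> xc; rewrite distrC; apply: d3P => /=.
  by have := near_y x (le_lt_trans xc cdd); rewrite lt_min => /andP[].
have := mv bd; rewrite /g scale0r addr0 mul0r subr0 => h2.
rewrite !big_cons.
have -> : z + S (k :: l) c = y + coordinate c k *: @dir R n p k.
  by rewrite /S big_cons addrCA addrC.
set a := f _ in h2 *; set b := f y in h2; set w := \sum_(_ <- _) _ in h1 *.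
have -> : a - f z - (coordinate c k * D k z + w) = (a - coordinate c k * D k z - b) + (b - f z - w) by ring.
rewrite (le_trans (ler_normD _ _)) // (splitr e) mulrDl lerD //.
by rewrite (le_trans h2) // ler_wpM2l ?coordinate_le // ltW.
Qed.

Lemma is_deriveP (f : R -> R) (x a : R) : is_derive x 1 f a <->
  forall e, 0 < e -> \forall h \near (0 : R), `|f (x + h) - f x - a * h| <= e * `|h|.
Proof.
split=> [df e e0|h].
  have [d d0 dP] := is_derive_approx df e0.
  by apply/nbhs_normP; exists d => //= y; rewrite /ball_ /= sub0r normrN; exact: dP.
have cv : h0^-1 *: ((f \o shift x) (h0 *: (1 : R)) - f x) @[h0 --> 0^'] --> a.
  apply/cvgrPdist_le => e e0; have /nbhs_normP[d /= d0 dP] := h e e0.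
  apply/nbhs_normP; exists d => //= y; rewrite /ball_ /= => yd y0.
  have := dP y yd; rewrite -ler_pdivrMr ?normr_gt0 // -normf_div.
  congr (_ <= _); rewrite distrC; congr `|_|.
  by rewrite /GRing.scale /= mulr1 (addrC y); field.
by apply: DeriveDef; [apply/cvg_ex; exists a|exact: cvg_lim cv].
Qed.

Lemma is_derive_affine (a b x : R) : is_derive x 1 (fun s => a + s * b) b.
Proof.
apply/is_deriveP => e e0; near=> s.
have -> : a + (x + s) * b - (a + x * b) - b * s = 0 by ring.
by rewrite normr0 mulr_ge0 // ltW.
Unshelve. all: by end_near.
Qed.

Lemma is_derive_path f z L (ga : R -> pt) (v : pt) : has_diff f z L -> ga 0 = z ->
  (forall k, is_derive (0 : R) 1 (fun s => coordinate (ga s) k) (coordinate v k)) ->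
  is_derive (0 : R) 1 (f \o ga) (linform L v).
Proof.
move=> df ga0 dga; apply/is_deriveP => e e0.
pose M := \sum_i `|L (Some i)| + `|L None| + 1.
have M0 : 0 < M by rewrite ltr_wpDl // addr_ge0 // sumr_ge0.
have v0 : 0 < `|v| + 1 by rewrite ltr_wpDl.
have [d d0 dP] := df (e / 2 / (`|v| + 1)) ltac:(by rewrite !divr_gt0).
have app (e' : R) : 0 < e' -> \forall s \near (0 : R), forall k,
    `|coordinate (ga s - z) k - s * coordinate v k| <= e' * `|s|.
  move=> e'0; apply: (@filter_forall _ _ (fun k s => `|coordinate (ga s - z) k - s * coordinate v k| <= e' * `|s|) (nbhs (0 : R))) => k.
  have := (is_deriveP _ _ _).1 (dga k) _ e'0; apply: filterS => s.
  rewrite add0r ga0 mulrC; congr (`|_ - _| <= _).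
  by case: k => [i|] /=; rewrite ?mxE.
have norm_pt (w : pt) (a : R) : 0 <= a -> (forall k, `|coordinate w k| <= a) -> `|w| <= a.
  move=> a0 wa; rewrite prod_normE /= ge_max; apply/andP; split.
    by apply: norm_le_coord => // i j; rewrite (ord1 j); exact: wa (Some i).
  exact: wa None.
have a1 := app 1 ltr01.
have e20 : 0 < e / 2 / M by rewrite !divr_gt0.
have a2 := app _ e20.
have sm : \forall s \near (0 : R), `|s| < d / (`|v| + 1).
  apply/nbhs_normP; exists (d / (`|v| + 1)); first by rewrite /= divr_gt0.
  by move=> s /=; rewrite /ball_ /= sub0r normrN.
near=> s.
have s1 : `|ga s - z| <= (`|v| + 1) * `|s|.
  apply: norm_pt => [|k]; first by rewrite mulr_ge0 // ltW.
  have h : `|coordinate (ga s - z) k - s * coordinate v k| <= 1 * `|s|.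
    by move: k; near: s.
  rewrite -[coordinate (ga s - z) k](subrK (s * coordinate v k)).
  rewrite (le_trans (ler_normD _ _)) // addrC mulrDl lerD // normrM mulrC.
  by rewrite ler_wpM2r // coordinate_le.
have s2 : `|ga s - z| < d.
  by rewrite (le_lt_trans s1) // mulrC -ltr_pdivlMr //; near: s.
have := dP _ s2; rewrite (addrC z) subrK => h1.
have h2 : `|linform L (ga s - z) - s * linform L v| <= e / 2 * `|s|.
  have -> : linform L (ga s - z) - s * linform L v =
     \sum_i (coordinate (ga s - z) (Some i) - s * coordinate v (Some i)) * L (Some i) +
     (coordinate (ga s - z) None - s * coordinate v None) * L None.
    rewrite /linform mulrDr opprD addrACA mulr_sumr -sumrB; congr (_ + _); last by rewrite /=; ring.
    by apply: eq_bigr => i _; rewrite /=; ring.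
  have h k : `|coordinate (ga s - z) k - s * coordinate v k| <= e / 2 / M * `|s|.
    by move: k; near: s.
  rewrite (@le_trans _ _ (e / 2 / M * `|s| * M)) //; last first.
    by rewrite mulrAC divfK // gt_eqF.
  have : 0 <= e / 2 / M * `|s| by rewrite mulr_ge0 // ltW.
  move: (e / 2 / M * `|s|) h => a h a0.
  rewrite (le_trans (ler_normD _ _)) // /M !mulrDr -[leRHS]addrA lerD //.
    rewrite (le_trans (ler_norm_sum _ _ _)) // mulr_sumr.
    by apply: ler_sum => i _; rewrite normrM ler_wpM2r.
  by rewrite -[leLHS]addr0 lerD ?normrM ?ler_wpM2r // mulr1.
rewrite /= add0r ga0.
have -> : f (ga s) - f z - linform L v * s =
  (f (ga s) - f z - linform L (ga s - z)) + (linform L (ga s - z) - s * linform L v) by ring.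
rewrite (le_trans (ler_normD _ _)) //.
have -> : e * `|s| = e / 2 * `|s| + e / 2 * `|s| by field.
rewrite lerD // (le_trans h1) //.
rewrite (le_trans (ler_wpM2l _ s1)) ?divr_ge0 ?(ltW e0) ?(ltW v0) //.
by rewrite mulrA divfK // gt_eqF.
Unshelve. all: by end_near.
Qed.

Lemma C2_has_diff (Omega : set pt) (u : pt -> R) z : open Omega -> C2_on Omega u -> Omega z ->
  has_diff u z (fun k => 'D_(@dir R n p k) u z) /\
  forall k, has_diff (fun y => 'D_(@dir R n p k) u y) z
    (fun l => 'D_(@dir R n p l) (fun y => 'D_(@dir R n p k) u y) z).
Proof.
move=> oO cu Oz; have nO : \forall y \near z, Omega y by exact: open_nbhs_nbhs.
split=> [|k]; apply: has_diff_C1.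
- by apply: filterS nO => y /cu[_ h] k; have [] := h k.
- by move=> k; have [_ h] := cu z Oz; have [] := h k.
- by apply: filterS nO => y /cu[_ h] l; have [_ _ /(_ l)[]] := h k.
- by move=> l; have [_ h] := cu z Oz; have [_ _ /(_ l)[]] := h k.
Qed.

Variables (B : 'M[R]_N) (wt : 'I_N -> nat).
Hypothesis B_graded : forall k l, B k l != 0 -> wt l = (wt k).+2.
Local Notation E := (drift_exp wt B).

(** The chain rule is used twice: for u at the nearby points of the line, and for each first partial
    derivative at z alone. *)
Lemma C2_line (Omega : set pt) (u : pt -> R) z (h : 'cV[R]_N) :
  open Omega -> C2_on Omega u -> Omega z ->
  taylor2 (fun s => u (z.1 + s *: h, z.2)) ((h^T *m grad_x u z) 0 0)
    ((h^T *m hess_x u z *m h) 0 0 / 2).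
Proof.
(* The variable s moves and t is the base point, because [is_derive_path] differentiates at
   parameter 0. *)
move=> oO cu Oz; pose ga (s t : R) : pt := (z.1 + (t + s) *: h, z.2).
have dga (t : R) k : is_derive (0 : R) 1 (fun s => coordinate (ga s t) k) (coordinate (h, 0) k).
  case: k => [i|] /=.
    have -> : (fun s => (z.1 + (t + s) *: h) i 0) = (fun s => (z.1 i 0 + t * h i 0) + s * h i 0).
      by apply/funext => s; rewrite !mxE; ring.
    exact: is_derive_affine.
  exact: is_derive_cst.
have lin (L : option 'I_N -> R) : linform L (h, 0) = (h^T *m (\col_i L (Some i))) 0 0.
  by rewrite /linform /= mul0r addr0 mxE; apply: eq_bigr => i _; rewrite !mxE.
pose g' (t : R) := (h^T *m grad_x u (z.1 + t *: h, z.2)) 0 0.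
have -> : (h^T *m grad_x u z) 0 0 = g' 0 by rewrite /g' scale0r addr0 -surjective_pairing.
apply: taylor2_is_derive.
  have /near_ptP[d d0 dP] : \forall y \near z, Omega y by exact: open_nbhs_nbhs.
  have h0 : 0 < `|h| + 1 by rewrite ltr_wpDl.
  exists (d / (`|h| + 1)); first by rewrite divr_gt0.
  move=> t; rewrite ltr_pdivlMr // => td.
  have Ot : Omega (z.1 + t *: h, z.2).
    apply: dP => /=; last by rewrite subrr normr0.
    rewrite addrC addKr normrZ (le_lt_trans _ td) // ler_wpM2l //.
    by rewrite lerDl.
  have [du _] := C2_has_diff oO cu Ot.
  have gat : ga 0 t = (z.1 + t *: h, z.2) by rewrite /ga addr0.
  have /is_deriveP dt := is_derive_path du gat (dga t).
  apply/is_deriveP => e e0; apply: filterS (dt e e0) => s.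
  by rewrite /= /ga add0r addr0 lin.
have [_ du] := C2_has_diff oO cu Oz.
have -> : 2 * ((h^T *m hess_x u z *m h) 0 0 / 2) =
  \sum_i h i 0 * linform (fun l => 'D_(@dir R n p l) (fun y => 'D_(@dir R n p (Some i)) u y) z) (h, 0).
  rewrite mulrC divfK ?pnatr_eq0 // mxE; apply: eq_bigr => i _.
  rewrite lin mulrC !mxE; congr (_ * _); apply: eq_bigr => k _; by rewrite !mxE.
have -> : g' = (fun t => \sum_i h i 0 * ((fun y => 'D_(@dir R n p (Some i)) u y) \o (ga ^~ 0)) t).
  by apply/funext => t; rewrite /g' mxE; apply: eq_bigr => i _; rewrite !mxE /ga /= add0r.
apply: is_derive_sumf => i; apply: is_derive_cmulf.
apply: (is_derive_path (du (Some i))).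
by rewrite /ga addr0 scale0r addr0 -surjective_pairing.
Qed.

(** The curve has velocity (B^T x, -1) at s = 0, so its derivative is the first-order part of the
    operator. *)
Lemma C2_drift (Omega : set pt) (u : pt -> R) z : open Omega -> C2_on Omega u -> Omega z ->
  rderiv (fun s => u (E (- s) *m z.1, z.2 - s)) ((z.1^T *m (B *m grad_x u z)) 0 0 - dt u z).
Proof.
move=> oO cu Oz; have [du _] := C2_has_diff oO cu Oz.
pose v : pt := (B^T *m z.1, -1).
have -> : (z.1^T *m (B *m grad_x u z)) 0 0 - dt u z = linform (fun k => 'D_(@dir R n p k) u z) v.
  rewrite /linform /v /= mulN1r mulmxA -[z.1^T *m B]trmxK trmx_mul trmxK mxE.
  by congr (_ - _); apply: eq_bigr => i _; rewrite !mxE.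
apply: rderiv_is_derive.
apply: (@is_derive_path u z _ (fun s => (E (- s) *m z.1, z.2 - s)) v du).
  by rewrite /= oppr0 drift_exp0 mul1mx addr0 -surjective_pairing.
case=> [i|] /=; first exact: is_derive_drift.
have -> : (fun s => z.2 - s) = (fun s => z.2 + s * -1) by apply/funext => s; rewrite mulrN1.
exact: is_derive_affine.
Qed.

(** With A = H H^T the trace is the sum of the second derivatives along the columns of H, which are
    twice the Taylor coefficients. *)
Lemma solution_at_C2 (lam Lam : R) (A : pt -> 'M[R]_N) (Omega : set pt) (u : pt -> R) z H :
  open Omega -> C2_on Omega u -> Omega z -> A z = H *m H^T -> elliptic_frame wt lam Lam H ->
  LA A B u z = 0 -> solution_at wt B lam Lam u z.
Proof.
move=> oO cu Oz AH fH u0; exists H => //.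
exists (fun j => ((col j H)^T *m grad_x u z) 0 0).
exists (fun j => ((col j H)^T *m hess_x u z *m col j H) 0 0 / 2).
exists ((z.1^T *m (B *m grad_x u z)) 0 0 - dt u z); split.
- by move=> j; exact: (C2_line _ oO cu Oz).
- exact: (C2_drift oO cu Oz).
rewrite -[RHS]u0 /LA AH -[RHS]addrA; congr (_ + _).
rewrite -mulmxA mxtrace_mulC /mxtrace; apply: eq_bigr => j _.
rewrite mulrC divfK ?pnatr_eq0 // tr_col -row_mul !mxE.
by apply: eq_bigr => i _; rewrite !mxE.
Qed.
End ClassicalSolutions.

(** * The block form of B gives the grading and the Kalman condition *)

Section BlockStructure.
Variables (R : realType) (n : nat) (p : 'I_n.+1 -> nat) (B : 'M[R]_(dimN p)).
Local Notation N := (dimN p).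
Hypothesis B_blocks : superdiag_blocks B.

Definition block_wt (k : 'I_N) : nat := (2 * tagnat.sig1 k + 1)%N.

Lemma sum_blocks (V : nmodType) (F : 'I_N -> V) :
  \sum_k F k = \sum_i \sum_(a < p i) F (tagnat.Rank i a).
Proof.
rewrite sig_big_dep (reindex _ tagnat.sig_bij_on).
by apply: eq_bigr => k _ /=; congr F; rewrite -tagnat.rankE tagnat.sigK.
Qed.

Lemma wtsum_blocks : wtsum block_wt = homdim p.
Proof.
rewrite /wtsum /homdim.
rewrite (sum_blocks (block_wt : 'I_N -> nat)); apply: eq_bigr => i _.
rewrite (eq_bigr (fun _ => (2 * i + 1)%N)) ?sum_nat_const ?card_ord ?(mulnC (p i)) // => a _.
by rewrite /block_wt tagnat.Rank1K.
Qed.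

Lemma block_wt_gt0 k : (0 < block_wt k)%N.
Proof. by rewrite /block_wt addn1. Qed.

Lemma block_wt_eq1 i (a : 'I_(p i)) : (block_wt (tagnat.Rank i a) == 1)%N = (i == ord0).
Proof. by rewrite /block_wt tagnat.Rank1K addn1 eqSS muln_eq0. Qed.

Lemma blocks_graded k l : B k l != 0 -> block_wt l = (block_wt k).+2.
Proof.
rewrite -[k]tagnat.sig2K -[l]tagnat.sig2K; move: (tagnat.sig1 k) (tagnat.sig1 l) (tagnat.sig2 k) (tagnat.sig2 l).
move=> i j a b Bab; have := B_blocks i j; case: eqP => [ji _|_ /matrixP/(_ a b)].
  by rewrite /block_wt !tagnat.Rank1K ji mulnS -addnA add2n.
by rewrite !mxE => B0; rewrite B0 eqxx in Bab.
Qed.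

Lemma block_mulmx i (w : 'cV[R]_N) :
  submxcol (B *m w) i = \sum_j submxblock B i j *m submxcol w j.
Proof.
apply/matrixP => a b; rewrite summxE !mxE sum_blocks.
by apply: eq_bigr => j _; rewrite !mxE; apply: eq_bigr => c _; rewrite !mxE (ord1 b).
Qed.

(** Block i of B w is a matrix of full column rank times block i+1 of w, so the blocks vanish one
    after the other; the induction passes from w to B w. *)
Lemma blocks_observable (v : 'cV[R]_N) :
  (forall j k, block_wt k = 1 -> (B ^+ j *m v) k 0 = 0) -> v = 0.
Proof.
move=> obs; suff h (i : nat) : forall (lt : (i < n.+1)%N) (w : 'cV[R]_N),
    (forall j, submxcol (B ^+ j *m w) ord0 = 0) -> submxcol w (Ordinal lt) = 0.
  apply/matrixP => k b; rewrite (ord1 b) mxE -[k]tagnat.sig2K.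
  have hv j : submxcol (B ^+ j *m v) ord0 = 0.
    apply/matrixP => a c; rewrite mxE (ord1 c) [RHS]mxE obs //.
    by apply/eqP; rewrite block_wt_eq1.
  case: (tagnat.sig1 k) (tagnat.sig2 k) => i lt a.
  by have /matrixP/(_ a 0) := h i lt v hv; rewrite !mxE.
elim: i => [|i IH] lt w hw.
  have -> : Ordinal lt = ord0 by apply/val_inj.
  by have := hw 0; rewrite expr0 mul1mx.
have lt' : (i < n.+1)%N := ltnW lt.
have := IH lt' (B *m w); rewrite block_mulmx (bigD1 (Ordinal lt)) //= big1 ?addr0; last first.
  move=> j; rewrite -val_eqE /= => ji; have := B_blocks (Ordinal lt') j.
  by rewrite (negbTE ji) => ->; rewrite mul0mx.
move=> /(_ _)/eqP Bw; have {}Bw : submxblock B (Ordinal lt') (Ordinal lt) *m submxcol w (Ordinal lt) == 0.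
  by apply: Bw => j; rewrite mulmxA; have := hw j.+1; rewrite exprSr.
have := B_blocks (Ordinal lt') (Ordinal lt); rewrite eqxx => rk.
apply/eqP; rewrite -trmx_eq0 -(mulmx_free_eq0 _ (B := (submxblock B (Ordinal lt') (Ordinal lt))^T)).
  by rewrite -trmx_mul trmx_eq0.
by rewrite /row_free mxrank_tr rk.
Qed.

Lemma mx_exprZn (c : R) m (M : 'M[R]_m) j : (c *: M) ^+ j = c ^+ j *: M ^+ j.
Proof.
elim: j => [|j IHj]; first by rewrite !expr0 scale1r.
rewrite !exprS IHj [LHS](_ : _ = (c *: M) *m (c ^+ j *: M ^+ j)) //.
by rewrite -scalemxAl -scalemxAr scalerA.
Qed.

(** By nilpotency the partial sums of the series are eventually constant. *)
Lemma Emx_drift_exp s : Emx B s = drift_exp block_wt B s.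
Proof.
rewrite /Emx /mxexp; apply: lim_near_cst; first exact: norm_hausdorff.
exists (wtsum block_wt).+1 => // m /= mW.
rewrite /series /= (big_cat_nat (n := (wtsum block_wt).+1)) //= big_mkord.
rewrite [X in _ + X]big_nat_cond [X in _ + X]big1 ?addr0; last first.
  move=> j /andP[/andP[jW _] _]; rewrite mx_exprZn (exp_tr_nilp blocks_graded) ?scaler0 //.
by apply: eq_bigr => j _; rewrite mx_exprZn scalerA mulrC.
Qed.

End BlockStructure.

(** * The block ellipticity condition yields a frame *)

Section EllipticBlocks.
Variables (R : realType) (n : nat) (p : 'I_n.+1 -> nat).
Local Notation N := (dimN p).

(** The factorization is applied to the whole degenerate matrix, whose quadratic form is that of its
    first block. *)
Lemma elliptic_frame_blocks (lam Lam : R) (A : 'M[R]_N) : 0 < lam ->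
  (forall i j : 'I_n.+1, ~~ ((i == ord0) && (j == ord0)) -> submxblock A i j = 0) ->
  let A0 := submxblock A ord0 ord0 in
  A0^T = A0 -> loewner_le lam%:M A0 -> loewner_le A0 Lam%:M ->
  exists2 H, A = H *m H^T & elliptic_frame (@block_wt n p) lam Lam H.
Proof.
move=> lam0 A_blocks A0 symA lo hi.
have A_out i j a b : ~~ ((i == ord0) && (j == ord0)) -> A (tagnat.Rank i a) (tagnat.Rank j b) = 0.
  by move=> /A_blocks/matrixP/(_ a b); rewrite !mxE.
have AT : A^T = A.
  apply/matrixP => k l; rewrite mxE -[k]tagnat.sig2K -[l]tagnat.sig2K.
  move: (tagnat.sig1 k) (tagnat.sig1 l) (tagnat.sig2 k) (tagnat.sig2 l) => i j a b.
  case: (boolP ((i == ord0) && (j == ord0))) => [/andP[/eqP i0 /eqP j0]|ij]; last first.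
    by rewrite !A_out // andbC.
  subst i j; have /matrixP/(_ a b) := symA; by rewrite !mxE.
have qA w : qform A w = qform A0 (submxcol w ord0).
  rewrite !qform_sum sum_blocks (bigD1 ord0) //= [X in _ + X]big1 ?addr0; last first.
    move=> i i0; apply: big1 => a _; rewrite sum_blocks big1 // => j _; rewrite big1 // => b _.
    by rewrite A_out ?mulr0 ?mul0r // (negbTE i0).
  apply: eq_bigr => a _; rewrite sum_blocks (bigD1 ord0) //= [X in _ + X]big1 ?addr0; last first.
    by move=> j j0; apply: big1 => b _; rewrite A_out ?mulr0 ?mul0r // (negbTE j0).
  by apply: eq_bigr => b _; rewrite !mxE.
have nA w : sqnorm (proj0 R (@block_wt n p) *m w) = sqnorm (submxcol w ord0).
  rewrite /sqnorm sum_blocks (bigD1 ord0) //= [X in _ + X]big1 ?addr0; last first.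
    by move=> i i0; apply: big1 => a _; rewrite proj0E block_wt_eq1 (negbTE i0) mul0r expr0n.
  by apply: eq_bigr => a _; rewrite proj0E block_wt_eq1 eqxx mul1r mxE.
have sc c (M : 'M[R]_(p ord0)) v : (v^T *m (M - c%:M) *m v) 0 0 = qform M v - c * sqnorm v.
  by rewrite mulmxBr mulmxBl mul_mx_scalar -scalemxAl sqnormE mxE [X in _ + X]mxE [X in _ - X]mxE.
have lo' v : lam * sqnorm v <= qform A0 v by rewrite -subr_ge0 -sc; exact: lo.
have hi' v : qform A0 v <= Lam * sqnorm v.
  have := hi v; rewrite -[Lam%:M - A0]opprB mulmxN mulNmx mxE sc.
  by rewrite oppr_ge0 subr_le0.
have [H AH] : exists H : 'M[R]_N, A = H *m H^T.
  apply: (psd_cholesky AT) => v; rewrite qA (le_trans _ (lo' _)) //.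
  by rewrite mulr_ge0 ?sqnorm_ge0 // ltW.
exists H => // w; rewrite -qform_gram -AH qA nA.
by apply/andP; split; [exact: lo'|exact: hi'].
Qed.

End EllipticBlocks.

(** * The homogeneous gauge compared with the sup norm *)

Section Gauge.
Variables (R : realType) (n : nat) (p : 'I_n.+1 -> nat).
Local Notation N := (dimN p).
Local Notation dil := (dilation (@block_wt n p)).
Implicit Types (x : 'cV[R]_N) (r : R).

Lemma enorm_ge0 k (v : 'cV[R]_k) : 0 <= enorm v.
Proof. exact: sqrtr_ge0. Qed.

Lemma coord_le_enorm k (v : 'cV[R]_k) i : `|v i 0| <= enorm v.
Proof.
rewrite -sqrtr_sqr ler_wsqrtr // (bigD1 i) //= lerDl sumr_ge0 // => j _; exact: sqr_ge0.
Qed.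

Lemma enorm_le_norm k (v : 'cV[R]_k) : enorm v <= k%:R * `|v|.
Proof.
have k0 : 0 <= k%:R * `|v| by rewrite mulr_ge0.
rewrite -[leRHS](ger0_norm k0) -sqrtr_sqr ler_wsqrtr // (@le_trans _ _ (\sum_(i < k) `|v| ^+ 2)) //.
  by apply: ler_sum => i _; rewrite -real_normK ?num_real // lerXn2r ?nnegrE // coord_le_norm.
rewrite sumr_const card_ord -[leLHS]mulr_natl exprMn ler_wpM2r ?sqr_ge0 //.
by rewrite -natrX ler_nat -mulnn; case: (k) => // m; rewrite leq_pmulr.
Qed.

Lemma enormZ k (c : R) (v : 'cV[R]_k) : 0 <= c -> enorm (c *: v) = c * enorm v.
Proof.
move=> c0; rewrite -{2}(ger0_norm c0) -sqrtr_sqr /enorm -sqrtrM ?sqr_ge0 // mulr_sumr.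
by congr Num.sqrt; apply: eq_bigr => i _; rewrite mxE exprMn.
Qed.

Lemma submxcol_dilation r x i : submxcol (dil r *m x) i = r ^+ (2 * i + 1) *: submxcol x i.
Proof.
apply/matrixP => a b; rewrite !mxE.
have := dilationE (@block_wt n p) r x (tagnat.Rank i a); rewrite mxE (ord1 b) => ->.
by rewrite /block_wt tagnat.Rank1K.
Qed.

Lemma powR_invn_exp (e : R) m : 0 <= e -> (e `^ (m.+1%:R)^-1) ^+ m.+1 = e.
Proof. by move=> e0; rewrite -powR_mulrn ?powR_ge0 // -powRrM mulVf ?pnatr_eq0 // powRr1. Qed.

Lemma powR_invn_le (e c : R) m : 0 <= e -> 0 <= c -> (e `^ (m.+1%:R)^-1 <= c) = (e <= c ^+ m.+1).
Proof.
by move=> e0 c0; rewrite -[in RHS](powR_invn_exp m e0) ler_pXn2r // nnegrE ?powR_ge0.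
Qed.

(** Raising to the power 2i+1 removes the root in the gauge; the added 1 makes the bound at least 1,
    hence below its own powers. *)
Lemma Bnorm_dilation_le r x : 0 <= r ->
  Bnorm (dil r *m x) <= r * \sum_(i < n.+1) (1 + (p i)%:R * `|x|).
Proof.
move=> r0; rewrite mulr_sumr; apply: ler_sum => i _.
have h0 : 0 <= 1 + (p i)%:R * `|x| by rewrite addr_ge0 // mulr_ge0.
rewrite addn1 powR_invn_le ?enorm_ge0 ?mulr_ge0 // -[(2 * i).+1]addn1 submxcol_dilation.
rewrite enormZ ?exprn_ge0 // exprMn ler_wpM2l ?exprn_ge0 //.
rewrite (@le_trans _ _ (1 + (p i)%:R * `|x|)) //; last first.
  by rewrite addn1 -[leLHS]expr1 ler_weXn2l // lerDl mulr_ge0.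
rewrite (le_trans (enorm_le_norm _)) // ler_wpDl // ler_wpM2l //.
apply: norm_le_coord => // a b; rewrite mxE (ord1 b); exact: coord_le_norm.
Qed.

Lemma Bnorm_le_dilation r x : 0 < r -> Bnorm x <= r -> `|dil r^-1 *m x| <= 1.
Proof.
move=> r0 xr; apply: norm_le_coord => // k b; rewrite (ord1 b) dilationE.
rewrite normrM ger0_norm ?exprn_ge0 ?invr_ge0 ?(ltW r0) // exprVn.
rewrite mulrC ler_pdivrMr ?exprn_gt0 // mul1r.
rewrite -[k]tagnat.sig2K /block_wt tagnat.Rank1K.
move: (tagnat.sig1 k) (tagnat.sig2 k) => i a.
have ->  : x (tagnat.Rank i a) 0 = submxcol x i a 0 by rewrite mxE.
rewrite (le_trans (coord_le_enorm _ _)) // addn1 -powR_invn_le ?enorm_ge0 ?(ltW r0) //.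
rewrite (le_trans _ xr) // /Bnorm (bigD1 i) //= addn1 lerDl sumr_ge0 // => j _.
exact: powR_ge0.
Qed.

End Gauge.

(** * Transfer to the cylinders of the statement *)

Unset Implicit Arguments.

Theorem theorem1p1 (R : realType) (n : nat) (hn : (1 <= n)%N)
    (p : 'I_n.+1 -> nat) (hp : block_sizes p)
    (B : 'M[R]_(dimN p)) (hB : superdiag_blocks B)
    (lam Lam : R) (hlam : 0 < lam) (hLam : 0 < Lam)
    (hCL : Lam / lam < 1 + 2 / (homdim p)%:R) :
  exists b K s0 C : R,
    [/\ 0 < b, 0 < K, 0 < s0 & 0 < C] /\ s0 < K /\
    forall (Omega : set (spacetime R p)) (A : spacetime R p -> 'M[R]_(dimN p)),
      open Omega -> elliptic_on Omega lam Lam A ->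
    forall (z0 : spacetime R p) (r : R),
      0 < r -> rel_compact_in (cyl B (K * r) (- b * r ^+ 2) 0 z0) Omega ->
    forall u : spacetime R p -> R, C2_on Omega u ->
      (forall z, cyl B (K * r) (- b * r ^+ 2) 0 z0 z ->
         0 <= u z /\ LA A B u z = 0) ->
      let Qminus := cyl B (s0 / 2 * r)
        (- (3 * b / 4) * r ^+ 2) (- (b / 2) * r ^+ 2) z0 in
      let Qplus := cyl B (s0 / 2 * r) (- (b / 4) * r ^+ 2) 0 z0 in
      (ereal_sup [set (u z)%:E | z in Qminus] <=
         C%:E * ereal_inf [set (u z)%:E | z in Qplus])%E.
Proof.
have Hg := blocks_graded hB; have Ho := blocks_observable hB.
have H0 := @block_wt_gt0 n p; have WQ := wtsum_blocks p.
have Q0 : (0 < wtsum (@block_wt n p))%N.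
  rewrite WQ /homdim big_ord_recl addn_gt0 muln_gt0 addn1 /=.
  by have [_ ->] := hp.
have hC : Lam / lam < 1 + 2 / (wtsum (@block_wt n p))%:R by rewrite WQ.
have [R1 [C [R13 C0 harnack]]] := harnack_unit Hg Ho H0 hlam hLam Q0 hC.
have R10 : 0 < R1 by rewrite (lt_trans _ R13).
(* For |x| <= R1 the gauge of dil(r) x is at most r times this sum, so the cylinder of width K r
   contains the image of the box on which [harnack] requires a solution; the summand 3 gives K >
   2. *)
pose K := \sum_(i < n.+1) (1 + (p i)%:R * R1) + 3.
have S0 : 0 <= \sum_(i < n.+1) (1 + (p i)%:R * R1).
  by apply: sumr_ge0 => i _; rewrite addr_ge0 // mulr_ge0 // ltW.
have K3 : 3 <= K by rewrite lerDr.
(* With b = 4 the rescaled cylinders have times (-3, -2) and (-1, 0), inside (-4, 0), and s0 / 2 = 1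
   makes their base the unit gauge ball. *)
exists 4, K, 2, C; split; first by split => //; rewrite (lt_le_trans _ K3).
split; first by rewrite (lt_le_trans _ K3) // ltr_nat.
move=> Omega A oO ellA z0 r r0 [_ cylO] u cu uA.
have r20 : 0 < r ^+ 2 := exprn_gt0 2 r0.
pose g := gmap (@block_wt n p) B z0 r.
have gcyl (rho t1 t2 : R) x : Bnorm (dilation (@block_wt n p) r *m x.1) < rho ->
    t1 < r ^+ 2 * x.2 < t2 -> cyl B rho t1 t2 z0 (g x).
  move=> xr xt; exists (dilation (@block_wt n p) r *m x.1, r ^+ 2 * x.2) => //.
  by rewrite /gop /= (Emx_drift_exp hB).
have cylg (t1 t2 : R) z : cyl B (2 / 2 * r) (t1 * r ^+ 2) (t2 * r ^+ 2) z0 z ->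
    exists x, [/\ g x = z, `|x.1| <= 1 & t1 < x.2 < t2].
  rewrite divff ?pnatr_eq0 // mul1r => -[w [wr wt] <-].
  exists (dilation (@block_wt n p) r^-1 *m w.1, w.2 / r ^+ 2); split.
  - rewrite /g /gmap /gop /= mulmxA dilation_mul divff ?gt_eqF // dilation1 mul1mx.
    by rewrite (Emx_drift_exp hB) mulrC divfK ?gt_eqF.
  - exact: Bnorm_le_dilation (ltW wr).
  - by rewrite ltr_pdivlMr // ltr_pdivrMr.
have sol : nonneg_solution (@block_wt n p) B lam Lam R1 (fun x => u (g x)).
  move=> x xR /andP[x1 x2].
  have cx : cyl B (K * r) (- 4 * r ^+ 2) 0 z0 (g x).
    apply: gcyl; last by rewrite mulrC ltr_pM2l // x1 pmulr_rlt0.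
    rewrite (le_lt_trans (Bnorm_dilation_le _ (ltW r0))) // mulrC ltr_pM2r //.
    rewrite (@le_lt_trans _ _ (\sum_(i < n.+1) (1 + (p i)%:R * R1))) //.
      by apply: ler_sum => i _; rewrite lerD2l ler_wpM2l.
    by rewrite ltrDl.
  have Ox : Omega (g x) := cylO _ (subset_closure cx).
  have [ux Ax] := uA _ cx; split => //.
    by apply: gmap_continuous => //; have [] := cu _ Ox.
  apply: solution_gmap => //.
  have [Ab [symA lo hi]] := ellA _ Ox.
  have [H AH fH] := elliptic_frame_blocks hlam Ab symA lo hi.
  exact: (solution_at_C2 Hg oO cu Ox AH fH Ax).
cbv zeta; apply: ge_ereal_sup => _ [zm zmQ <-].
have [xm [<- xm1 /andP[xm2 xm3]]] : exists x, [/\ g x = zm, `|x.1| <= 1 & -3 < x.2 < -2].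
  apply: cylg; move: zmQ.
  have -> : - (3 * 4 / 4) = -3 :> R by field.
  by have -> : - (4 / 2) = -2 :> R by field.
(* Dividing by C first lets the infimum be bounded below point by point. *)
have -> : (u (g xm))%:E = (C%:E * (u (g xm) / C)%:E)%E.
  by rewrite -EFinM mulrC divfK // gt_eqF.
rewrite lee_pmul2l ?lte_fin //; apply: le_ereal_inf_tmp => _ [zp zpQ <-].
have [xp [<- xp1 /andP[xp2 xp3]]] : exists x, [/\ g x = zp, `|x.1| <= 1 & -1 < x.2 < 0].
  apply: cylg; rewrite mul0r; move: zpQ.
  by have -> : - (4 / 4) = -1 :> R by field.
rewrite lee_fin ler_pdivrMr // mulrC.
by apply: (harnack (fun x => u (g x))) => //; apply/andP; split => //; exact: ltW.
Qed.
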